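(* Let $G$ be a torsionfree discrete countable group. There exists a family of subgroups $\{ G_i \mid i \in I \}$ of $G$ such that: (i) $G$ is the disjoint union $G = \{e\} \cup \bigcup_{i \in I} \dot G_i$, where $\dot G_i=G_i\setminus\{e\}$. (ii) For every $i\in I$, the group $G_i$ is malnormal in $G$. (iii) If every non-zero element of $\mathbb Z G$ acts without kernel on $\ell^2 G$, then $G_i$ is free from $G_j$ for all $i \neq j$. (iv) $\beta_1^{(2)}(G_i)=0$ for all $i \in I$.
   Context: A subgroup $K\subset G$ is malnormal if $gKg^{-1}\cap K=\{e\}$ for all $g\in G\setminus K$. Two subgroups $A,B\subset G$ are free from each other if the canonical homomorphism $A\ast B\to\langle A,B\rangle\subset G$ is an isomorphism. $\mathbb Z G$ acts on the Hilbert space $\ell^2 G$ via the linear extension of the left regular representation; ''without kernel'' means injectively. $\beta_1^{(2)}(\Gamma)=\dim_{L\Gamma}H_1(\Gamma;L\Gamma)$ is the first $\ell^2$-Betti number of a countable discrete group $\Gamma$, where $L\Gamma$ is the group von Neumann algebra and $\dim_{L\Gamma}$ is Lück's dimension function. *)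

(* Defs.v *)
From HB Require Import structures.
From mathcomp Require Import all_boot all_order all_algebra.
From mathcomp Require Import finmap all_classical.
From mathcomp Require Import reals ereal esum.
From mathcomp Require Import complex ring lra.
(* The notations of monalg are incompatible with those of complex. *)
From mathcomp Require Import (canonicals, coercions) monalg.

Set Implicit Arguments.
Unset Strict Implicit.
Unset Printing Implicit Defensive.

Import Order.TTheory GRing.Theory Num.Theory.

Local Open Scope quotient_scope.
Local Open Scope classical_set_scope.

Section Subgroups.
Variable G : groupType.
Local Open Scope group_scope.

Definition torsion_free := forall (g : G) (n : nat), g ^+ n.+1 = 1 -> g = 1.

Implicit Types K A B : groupClosed G.

Definition malnormal K :=
  forall g, g \notin K -> [set g * k * g^-1 | k in [set` K]] `&` [set` K] = [set 1].

Definition subgroup_of K := {x : G | x \in K}.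
HB.instance Definition _ K := Choice.on (subgroup_of K).
HB.instance Definition _ K := SubType.on (subgroup_of K).

Fact subgroup_of_closed K : group_closed (mem K).
Proof. by split=> [|x y Kx Ky]; [exact: gpred1 | exact: gpredF]. Qed.

HB.instance Definition _ K :=
  SubChoice_isSubGroup.Build G (mem K) (subgroup_of K) (subgroup_of_closed K).

Definition join_subgroup A B : {pred G} := fun x =>
  `[< forall K, {subset A <= K} -> {subset B <= K} -> x \in K >].

Fact join_subgroupM A B : mulg_closed (join_subgroup A B).
Proof.
move=> x y /asboolP Kx /asboolP Ky; apply/asboolP => K AK BK.
by rewrite gpredM ?Kx ?Ky.
Qed.
Fact join_subgroup1 A B : 1 \in join_subgroup A B.
Proof. by apply/asboolP => K _ _; exact: gpred1. Qed.
Fact join_subgroupV A B : invg_closed (join_subgroup A B).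
Proof.
by move=> x /asboolP Kx; apply/asboolP => K AK BK; rewrite gpredV Kx.
Qed.
HB.instance Definition _ A B :=
  isMulClosed.Build G (join_subgroup A B) (@join_subgroupM A B).
HB.instance Definition _ A B :=
  isMul1Closed.Build G (join_subgroup A B) (@join_subgroup1 A B).
HB.instance Definition _ A B :=
  isInvClosed.Build G (join_subgroup A B) (@join_subgroupV A B).

End Subgroups.

Section FreeProduct.
Variables A B : groupType.
Local Open Scope group_scope.

Inductive fprod_eq : seq (A + B) -> seq (A + B) -> Prop :=
| FpRefl u : fprod_eq u u
| FpSym u v : fprod_eq u v -> fprod_eq v u
| FpTrans u v w : fprod_eq u v -> fprod_eq v w -> fprod_eq u w
| FpCat u u' v v' : fprod_eq u u' -> fprod_eq v v' -> fprod_eq (u ++ v) (u' ++ v')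
| FpOnel : fprod_eq [:: inl 1] [::]
| FpOner : fprod_eq [:: inr 1] [::]
| FpMull a a' : fprod_eq [:: inl a; inl a'] [:: inl (a * a')]
| FpMulr b b' : fprod_eq [:: inr b; inr b'] [:: inr (b * b')].

Definition fprod_eqb u v := `[< fprod_eq u v >].

Fact fprod_eqb_equiv : equiv_class_of fprod_eqb.
Proof.
split=> [u|u v|v u w]; first exact/asboolP/FpRefl.
  by apply/asboolP/asboolP; exact: FpSym.
by move=> /asboolP uv /asboolP vw; apply/asboolP/(FpTrans uv).
Qed.

Canonical fprod_equiv := EquivRelPack fprod_eqb_equiv.
Canonical fprod_encModRel := defaultEncModRel fprod_eqb.

(* Words in A and B, up to the congruence generated by
   the multiplication tables of A and B. *)
Definition free_product := {eq_quot fprod_eqb}.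
HB.instance Definition _ := EqQuotient.on free_product.
HB.instance Definition _ := Choice.on free_product.

Definition fp_class (u : seq (A + B)) : free_product := \pi u.

Lemma fp_classP u v : fp_class u = fp_class v <-> fprod_eq u v.
Proof. by split=> [/eqmodP/asboolP|/asboolP uv]; last exact/eqmodP. Qed.

Definition letterV (x : A + B) : A + B :=
  match x with inl a => inl a^-1 | inr b => inr b^-1 end.

Definition fp_one := fp_class [::].
Definition fp_mul (x y : free_product) := fp_class (repr x ++ repr y).
Definition fp_inv (x : free_product) := fp_class (rev (map letterV (repr x))).

Lemma fprod_eq_repr u : fprod_eq (repr (fp_class u)) u.
Proof. by apply/fp_classP; rewrite /fp_class reprK. Qed.

Lemma fp_mulE u v : fp_mul (fp_class u) (fp_class v) = fp_class (u ++ v).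
Proof. by apply/fp_classP/FpCat; exact: fprod_eq_repr. Qed.

Lemma fprod_eqV u v :
  fprod_eq u v -> fprod_eq (rev (map letterV u)) (rev (map letterV v)).
Proof.
elim=> {u v} [u|u v _|u v w _ uv _|u u' v v' _ uu' _ vv'||||].
- exact: FpRefl.
- exact: FpSym.
- exact: FpTrans uv.
- by rewrite !map_cat !rev_cat; exact: FpCat.
- by rewrite /= /rev /= invg1; exact: FpOnel.
- by rewrite /= /rev /= invg1; exact: FpOner.
- by move=> a a'; rewrite /= /rev /= invgM; exact: FpMull.
- by move=> b b'; rewrite /= /rev /= invgM; exact: FpMulr.
Qed.

Lemma fp_invE u : fp_inv (fp_class u) = fp_class (rev (map letterV u)).
Proof. by apply/fp_classP/fprod_eqV/fprod_eq_repr. Qed.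

Lemma fprod_eqVl u : fprod_eq (rev (map letterV u) ++ u) [::].
Proof.
elim: u => [|x u IHu]; first exact: FpRefl.
rewrite /= rev_cons cat_rcons -[_ :: _]/([:: _; x] ++ u) catA.
apply: FpTrans IHu; apply: FpCat (FpRefl u).
rewrite -[X in fprod_eq _ X]cats0; apply: FpCat (FpRefl _) _.
case: x => c.
  by apply: FpTrans FpOnel; rewrite -(mulVg c); exact: FpMull.
by apply: FpTrans FpOner; rewrite -(mulVg c); exact: FpMulr.
Qed.

Lemma letterVK : involutive letterV.
Proof. by case=> c /=; rewrite invgK. Qed.

Lemma fp_classK x : fp_class (repr x) = x. Proof. exact: reprK. Qed.

Fact fp_mulA : associative fp_mul.
Proof.
move=> x y z; rewrite -[x]fp_classK -[y]fp_classK -[z]fp_classK.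
by rewrite !fp_mulE catA.
Qed.
Fact fp_mul1 : left_id fp_one fp_mul.
Proof. by move=> x; rewrite -[x]fp_classK fp_mulE. Qed.
Fact fp_mulr1 : right_id fp_one fp_mul.
Proof. by move=> x; rewrite -[x]fp_classK fp_mulE cats0. Qed.
Fact fp_mulV : left_inverse fp_one fp_inv fp_mul.
Proof.
move=> x; rewrite -[x]fp_classK fp_invE fp_mulE.
exact/fp_classP/fprod_eqVl.
Qed.
Fact fp_mulrV : right_inverse fp_one fp_inv fp_mul.
Proof.
move=> x; rewrite -[x]fp_classK fp_invE fp_mulE; apply/fp_classP.
set u := repr x; have := fprod_eqVl (rev (map letterV u)).
by rewrite map_rev revK (mapK letterVK).
Qed.

HB.instance Definition _ := isGroup.Build free_product
  fp_mulA fp_mul1 fp_mulr1 fp_mulV fp_mulrV.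

End FreeProduct.

Section Free.
Variables (G : groupType) (A B : groupClosed G).
Local Open Scope group_scope.

Let U := subgroup_of A.
Let V := subgroup_of B.

Definition letter_val (x : U + V) : G :=
  match x with inl a => val a | inr b => val b end.
Definition word_val (u : seq (U + V)) : G := \prod_(x <- u) letter_val x.

Lemma word_val_eq u v : fprod_eq u v -> word_val u = word_val v.
Proof.
rewrite /word_val.
elim=> {u v} [//|//|u v w _ -> //|u u' v v' _ eu _ ev||||].
- by rewrite !big_cat /= eu ev.
- by rewrite big_seq1 big_nil.
- by rewrite big_seq1 big_nil.
- by move=> a a'; rewrite big_cons !big_seq1.
- by move=> b b'; rewrite big_cons !big_seq1.
Qed.

Lemma word_val_cat u v : word_val (u ++ v) = word_val u * word_val v.
Proof. exact: big_cat. Qed.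

Fact word_val_join u : word_val u \in join_subgroup A B.
Proof.
apply: gpred_prod => x _; apply/asboolP => K AK BK.
by case: x => [a|b]; [exact/AK/(valP a) | exact/BK/(valP b)].
Qed.

Definition canonical_hom (x : free_product U V) : subgroup_of (join_subgroup A B) :=
  Sub (word_val (repr x)) (word_val_join (repr x)).

Lemma canonical_homE u : val (canonical_hom (fp_class u)) = word_val u.
Proof. by rewrite SubK; exact/word_val_eq/fprod_eq_repr. Qed.

Fact canonical_homM : {morph canonical_hom : x y / x * y}.
Proof.
move=> x y; apply/val_inj; rewrite [RHS]valM -word_val_cat.
exact: canonical_homE.
Qed.
HB.instance Definition _ :=
  isMultiplicative.Build _ _ canonical_hom canonical_homM.

(* canonical_hom goes from A * B to the join <A, B>, not to the whole of G. *)
Definition free_from := bijective canonical_hom.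

End Free.

Local Open Scope ring_scope.

Section EllTwo.
Variables (R : realType) (G : choiceType).
Local Notation C := (R[i]).

Definition sqnorm (f : G -> C) : \bar R :=
  (\esum_(x in [set: G]) (Normc.normc (f x) ^+ 2)%:E)%E.

Definition square_summable : {pred G -> C} := fun f => (sqnorm f < +oo)%E.

Implicit Types f g : G -> C.

Lemma sqnorm_ge0 f : (0 <= sqnorm f)%E.
Proof. by apply: esum_ge0 => x _; rewrite lee_fin sqr_ge0. Qed.

Lemma sqnorm0 : sqnorm 0 = 0%E.
Proof. by apply: esum1 => x _; rewrite Normc.normc0 expr0n. Qed.

Lemma sqnormZ (a : C) f :
  (sqnorm (a *: f)%R <= (Normc.normc a ^+ 2)%:E * sqnorm f)%E.
Proof.
apply: ge_ereal_sup => _ [X [finX _] <-].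
rewrite (eq_fsbigr (fun x => (Normc.normc a ^+ 2)%:E * (Normc.normc (f x) ^+ 2)%:E)%E);
  last by move=> x _; rewrite -EFinM -exprMn -Normc.normcM.
rewrite -ge0_mule_fsumr; last by move=> x; rewrite lee_fin sqr_ge0.
apply: lee_wpmul2l; first by rewrite lee_fin sqr_ge0.
by apply: ereal_sup_ubound; exists X.
Qed.

Lemma sqnormD f g :
  (sqnorm (f + g)%R <= (sqnorm f + sqnorm f) + (sqnorm g + sqnorm g))%E.
Proof.
have pos (h : G -> C) x : [set: G] x -> (0 <= (Normc.normc (h x) ^+ 2)%:E)%E.
  by rewrite lee_fin sqr_ge0.
rewrite -!esumD; do ?[by move=> x _; rewrite ?adde_ge0 ?lee_fin ?sqr_ge0].
apply: le_esum => x _; rewrite -!EFinD lee_fin.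
set a := f x; set b := g x; have := le_normcD a b.
move: (normr_ge0 (a : Rcomplex R)) (normr_ge0 (b : Rcomplex R)).
move: (normr_ge0 ((a + b) : Rcomplex R)); rewrite /Num.norm /=.
rewrite -[(f + g) x]/(a + b).
move: (Normc.normc _) (Normc.normc a) (Normc.normc b) => z s t z0 s0 t0 zst.
have : z ^+ 2 <= (s + t) ^+ 2 by rewrite lerXn2r ?nnegrE ?addr_ge0.
have := sqr_ge0 (s - t); rewrite sqrrB sqrrD; lra.
Qed.

Fact square_summable_submod : submod_closed square_summable.
Proof.
split=> [|a f g]; rewrite !unfold_in.
  by rewrite /square_summable sqnorm0 ltry.
rewrite /square_summable => f2 g2; apply: le_lt_trans (sqnormD _ _) _.
have af2 : (sqnorm (a *: f)%R < +oo)%E.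
  apply: le_lt_trans (sqnormZ _ _) _.
  by rewrite -(fineK (_ : sqnorm f \is a fin_num)) ?ltry // ge0_fin_numE ?sqnorm_ge0.
by rewrite !lte_add_pinfty.
Qed.

HB.instance Definition _ :=
  GRing.isSubmodClosed.Build C (G -> C) square_summable square_summable_submod.

Definition l2 := {f : G -> C | f \in square_summable}.
HB.instance Definition _ := Choice.on l2.
HB.instance Definition _ := SubType.on l2.
HB.instance Definition _ := [SubChoice_isSubLmodule of l2 by <:].

Definition l2norm (f : l2) : R := Num.sqrt (fine (sqnorm (val f))).

Fact delta_square_summable (x : G) : (fun y => (y == x)%:R : C) \in square_summable.
Proof.
rewrite unfold_in /square_summable /sqnorm (esumID [set x]) ?setTI; last first.
  by move=> y _; rewrite lee_fin sqr_ge0.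
rewrite esum_set1 ?lee_fin ?sqr_ge0 // esum1 ?adde0 ?ltry // => y /= yx.
by have /negbTE-> : y != x by [apply/eqP]; rewrite Normc.normc0 expr0n.
Qed.

Definition delta (x : G) : l2 :=
  Sub (fun y => (y == x)%:R : C) (delta_square_summable x).

Definition bounded_operator (T : l2 -> l2) : Prop :=
  linear T /\ exists M : R, forall f : l2, l2norm (T f) <= M * l2norm f.

Definition commutant (X : set (l2 -> l2)) : set (l2 -> l2) :=
  [set T | bounded_operator T /\ forall S, X S -> T \o S = S \o T].

End EllTwo.

Section BoundedOperators.
Variables (R : realType) (G : choiceType).
Local Notation H := (l2 R G).
Implicit Types (S T : H -> H) (f g : H) (X : set (H -> H)).

Lemma sqnorm_l2 f : sqnorm (val f) = (l2norm f ^+ 2)%:E.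
Proof.
have fin : sqnorm (val f) \is a fin_num.
  by rewrite ge0_fin_numE ?sqnorm_ge0 //; have := valP f; rewrite unfold_in.
by rewrite /l2norm sqr_sqrtr ?fineK // fine_ge0 ?sqnorm_ge0.
Qed.

Lemma l2norm_ge0 f : 0 <= l2norm f. Proof. exact: sqrtr_ge0. Qed.

Lemma l2norm0 : l2norm (0 : H) = 0.
Proof. by rewrite /l2norm raddf0 sqnorm0 sqrtr0. Qed.

Lemma l2normN f : l2norm (- f) = l2norm f.
Proof.
rewrite /l2norm raddfN; congr (Num.sqrt (fine _)).
by apply: eq_esum => x _; rewrite -[(- val f) x]/(- val f x) normcN.
Qed.

Lemma l2normD f g : l2norm (f + g) <= 2 * (l2norm f + l2norm g).
Proof.
rewrite -(@ler_pXn2r _ 2) ?nnegrE ?mulr_ge0 ?addr_ge0 ?l2norm_ge0 //.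
have := sqnormD (val f) (val g).
rewrite -raddfD !sqnorm_l2 -!EFinD lee_fin => /le_trans; apply.
have := l2norm_ge0 f; have := l2norm_ge0 g; nra.
Qed.

Lemma bounded_operator0 : bounded_operator (0 : H -> H).
Proof.
split=> [a f g|]; first by rewrite scaler0 addr0.
by exists 0 => f; rewrite l2norm0 mul0r.
Qed.

Lemma bounded_operator_id : bounded_operator (id : H -> H).
Proof. by split=> //; exists 1 => f; rewrite mul1r. Qed.

Lemma bounded_operatorN T : bounded_operator T -> bounded_operator (- T).
Proof.
move=> [linT [M TM]]; split=> [a f g|].
  by rewrite -![(- T) _]/(- T _) linT opprD scalerN.
by exists M => f; rewrite -[(- T) f]/(- T f) l2normN.
Qed.

Lemma bounded_operatorD S T :
  bounded_operator S -> bounded_operator T -> bounded_operator (S + T).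
Proof.
move=> [linS [M SM]] [linT [N TN]]; split=> [a f g|].
  by rewrite -![(S + T) _]/(S _ + T _) linS linT scalerDr addrACA.
exists (2 * (M + N)) => f; apply: le_trans (l2normD _ _) _.
by rewrite -mulrA ler_pM2l // mulrDl lerD.
Qed.

Lemma bounded_operator_comp S T :
  bounded_operator S -> bounded_operator T -> bounded_operator (S \o T).
Proof.
move=> [linS [M SM]] [linT [N TN]]; split=> [a f g|] /=.
  by rewrite linT linS.
exists (`|M| * N) => f; apply: le_trans (SM _) _.
apply: le_trans (ler_wpM2r (l2norm_ge0 _) (ler_norm M)) _.
by rewrite -mulrA ler_wpM2l.
Qed.

Lemma commutant0 X : X `<=` @bounded_operator R G -> commutant X 0.
Proof.
move=> bX; split=> [|S /bX [linS _]]; first exact: bounded_operator0.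
apply/funext => f /=; have := linS (-1) f f.
by rewrite !scaleN1r !addNr.
Qed.

Lemma commutant_id X : commutant X id.
Proof. by split=> //; exact: bounded_operator_id. Qed.

Lemma commutant_comp X S T :
  commutant X S -> commutant X T -> commutant X (S \o T).
Proof.
move=> [bS cS] [bT cT]; split=> [|U XU]; first exact: bounded_operator_comp.
by rewrite -compA cT // compA cS // compA.
Qed.

Lemma commutantB X S T : X `<=` @bounded_operator R G ->
  commutant X S -> commutant X T -> commutant X (S - T).
Proof.
move=> bX [bS cS] [bT cT]; split=> [|U XU].
  by apply: bounded_operatorD => //; exact: bounded_operatorN.
have [linU _] := bX _ XU.
apply/funext => f /=; rewrite -![(S - T) _]/(S _ - T _).
have /(congr1 (fun h => h f)) /= -> := cS _ XU.
have /(congr1 (fun h => h f)) /= -> := cT _ XU.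
by rewrite addrC -scaleN1r -linU scaleN1r addrC.
Qed.

Lemma commutant_bounded X : commutant X `<=` @bounded_operator R G.
Proof. by move=> T []. Qed.

End BoundedOperators.

Section GroupVonNeumannAlgebra.
Variables (R : realType) (G : groupType).
Local Notation C := (R[i]).
Local Notation H := (l2 R G).

Fact sqnorm_translate (g : G) (f : G -> C) :
  sqnorm (fun x => f (g^-1 * x)%g) = sqnorm f.
Proof.
rewrite [RHS](@reindex_esum _ _ _ [set: G] [set: G] (fun x => g^-1 * x)%g) //.
split=> // [x y _ _|x _]; first exact: mulgI.
by exists (g * x)%g; rewrite // mulKg.
Qed.

Fact translate_square_summable (g : G) (f : H) :
  (fun x => val f (g^-1 * x)%g) \in @square_summable R G.
Proof. by have := valP f; rewrite !unfold_in /square_summable sqnorm_translate. Qed.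

Definition left_regular (g : G) (f : H) : H :=
  Sub (fun x => val f (g^-1 * x)%g) (translate_square_summable g f).

Lemma left_regular_linear g : linear (left_regular g).
Proof. by move=> a f h; apply/val_inj; rewrite SubK !linearP; apply/funext. Qed.

Lemma left_regular_bounded g : bounded_operator (left_regular g).
Proof.
split=> [|]; first exact: left_regular_linear.
by exists 1 => f; rewrite mul1r /l2norm sqnorm_translate.
Qed.

(* The bicommutant of the left regular representation. *)
Definition groupVN_pred : {pred H -> H} :=
  fun T => `[< commutant (commutant (range left_regular)) T >].

Definition groupVN := {T : H -> H | T \in groupVN_pred}.
HB.instance Definition _ := Choice.on groupVN.
HB.instance Definition _ := SubType.on groupVN.

Fact groupVN_zmod : zmod_closed groupVN_pred.
Proof.
have bX := @commutant_bounded R G (range left_regular).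
split=> [|S T /asboolP S2 /asboolP T2]; apply/asboolP; first exact: commutant0.
exact: commutantB.
Qed.

HB.instance Definition _ :=
  GRing.isZmodClosed.Build (H -> H) groupVN_pred groupVN_zmod.
HB.instance Definition _ := [SubChoice_isSubZmodule of groupVN by <:].

Implicit Types S T U : groupVN.

Fact groupVN_comp_in S T : val S \o val T \in groupVN_pred.
Proof.
by apply/asboolP/commutant_comp; apply/asboolP; [exact: (valP S) | exact: (valP T)].
Qed.
Fact groupVN_id_in : id \in groupVN_pred.
Proof. exact/asboolP/commutant_id. Qed.

Definition groupVN_mul S T : groupVN := Sub (val S \o val T) (groupVN_comp_in S T).
Definition groupVN_one : groupVN := Sub id groupVN_id_in.

Lemma groupVN_linear T : linear (val T).
Proof. by have /asboolP[[]] := valP T. Qed.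

Fact groupVN_mulA : associative groupVN_mul.
Proof. by move=> S T U; apply/val_inj. Qed.
Fact groupVN_mul1 : left_id groupVN_one groupVN_mul.
Proof. by move=> S; apply/val_inj. Qed.
Fact groupVN_mulr1 : right_id groupVN_one groupVN_mul.
Proof. by move=> S; apply/val_inj. Qed.
Fact groupVN_mulDl : left_distributive groupVN_mul +%R.
Proof. by move=> S T U; apply/val_inj. Qed.
Fact groupVN_mulDr : right_distributive groupVN_mul +%R.
Proof.
move=> S T U; apply/val_inj/funext => f.
have := groupVN_linear S 1 (val T f) (val U f).
by rewrite !scale1r.
Qed.
Fact groupVN_1neq0 : groupVN_one != 0.
Proof.
apply/eqP => /(congr1 (fun T : groupVN => val (val T (delta R 1%g)) 1%g)).
rewrite SubK raddf0 /= eqxx => /eqP.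
by rewrite oner_eq0.
Qed.

HB.instance Definition _ := GRing.Zmodule_isNzRing.Build groupVN
  groupVN_mulA groupVN_mul1 groupVN_mulr1 groupVN_mulDl groupVN_mulDr
  groupVN_1neq0.

Fact left_regular_in g : left_regular g \in groupVN_pred.
Proof.
apply/asboolP; split=> [|S [_ cS]]; first exact: left_regular_bounded.
by rewrite cS //; exists g.
Qed.

Definition group_unitary (g : G) : groupVN := Sub (left_regular g) (left_regular_in g).

(* The trace T |-> <T delta_e, delta_e>; only its real part is kept, since the
   trace of an idempotent matrix over the group von Neumann algebra is real. *)
Definition groupVN_trace (T : groupVN) : R := complex.Re (val (val T (delta R 1%g)) 1%g).

(* ZG as an additive group is the free Z-module monalg.malg G int. *)
Definition group_ring_act (a : monalg.malg G int) (f : H) : H :=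
  \sum_(g <- monalg.msupp a) left_regular g f *~ monalg.mcoeff g a.

End GroupVonNeumannAlgebra.

Section QuotientModule.
Variables (A : pzRingType) (V : lmodType A).
Variables (W : {pred V}) (submodW : submod_closed W).

Definition submodule of submod_closed W : {pred V} := W.
HB.instance Definition _ :=
  GRing.isSubmodClosed.Build A V (submodule submodW) submodW.

Local Notation quot := (Quotient.quot (submodule submodW)).

Definition quotient_module := quot.
HB.instance Definition _ := GRing.Zmodule.on quotient_module.

Definition quotient_proj (v : V) : quotient_module := \pi_quot v.
Definition quotient_scale (a : A) (x : quotient_module) : quotient_module :=
  quotient_proj (a *: repr x).

Lemma quotient_projP u v : quotient_proj u = quotient_proj v <-> u - v \in submodule submodW.
Proof.
by rewrite Quotient.idealrBE; split=> [uv|/eqP//]; apply/eqP.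
Qed.

Lemma quotient_projD u v :
  quotient_proj (u + v) = quotient_proj u + quotient_proj v.
Proof. by rewrite /quotient_proj !piE. Qed.

Lemma quotient_projK x : quotient_proj (repr x) = x. Proof. exact: reprK. Qed.

Lemma quotient_projZ a v : quotient_proj (a *: v) = quotient_scale a (quotient_proj v).
Proof.
apply/quotient_projP; rewrite -scalerBr rpredZ //.
by apply/quotient_projP; rewrite quotient_projK.
Qed.

Fact quotient_scaleA a b x :
  quotient_scale a (quotient_scale b x) = quotient_scale (a * b) x.
Proof. by rewrite -[x]quotient_projK -!quotient_projZ scalerA. Qed.
Fact quotient_scale1 : left_id 1 quotient_scale.
Proof. by move=> x; rewrite -[x]quotient_projK -quotient_projZ scale1r. Qed.
Fact quotient_scaleDr : right_distributive quotient_scale +%R.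
Proof.
move=> a x y; rewrite -[x]quotient_projK -[y]quotient_projK.
by rewrite -quotient_projD -!quotient_projZ -quotient_projD scalerDr.
Qed.
Fact quotient_scaleDl x :
  {morph quotient_scale^~ x : a b / a + b >-> a + b}.
Proof.
by move=> a b; rewrite -[x]quotient_projK -!quotient_projZ -quotient_projD scalerDl.
Qed.

HB.instance Definition _ := GRing.Zmodule_isLmodule.Build A quotient_module
  quotient_scaleA quotient_scale1 quotient_scaleDr quotient_scaleDl.

End QuotientModule.

Section LuckDimension.
Variables (R : realType) (G : groupType).
Local Notation LG := (groupVN R G).

Definition matrix_trace n (A : 'M[LG]_n) : R := \sum_i groupVN_trace (A i i).

(* P is isomorphic to the image of right multiplication by the idempotent A on
   LG^n. An isomorphism psi from this image to P is given by the map
   phi = psi \o (mulmxr A), which agrees with psi on the image. *)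
Definition fg_projective (M : lmodType LG) (P : set M) n (A : 'M[LG]_n) : Prop :=
  A *m A = A /\
  exists phi : {linear 'rV[LG]_n -> M},
    set_inj (range (fun x : 'rV[LG]_n => x *m A)) phi /\
    phi @` range (fun x : 'rV[LG]_n => x *m A) = P.

Definition luck_dim (M : lmodType LG) : \bar R :=
  ereal_sup [set d | exists (P : set M) (n : nat) (A : 'M[LG]_n),
                       fg_projective P A /\ d = (matrix_trace A)%:E].

End LuckDimension.

Section FreeModule.
Variables (A : nzRingType) (K : choiceType) (V : lmodType A).
Variable phi : K -> A -> V.
Hypothesis phiD : forall k, {morph phi k : a b / a + b}.
Hypothesis phiZ : forall k a b, phi k (a * b) = a *: phi k b.

Definition malg_lift (c : monalg.malg K A) : V :=
  \sum_(k <- monalg.msupp c) phi k (monalg.mcoeff k c).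

Lemma malg_liftE (D : {fset K}) c :
  {subset monalg.msupp c <= D} ->
  malg_lift c = \sum_(k <- D) phi k (monalg.mcoeff k c).
Proof.
move=> cD; rewrite /malg_lift [RHS](big_fsetID _ (mem (monalg.msupp c))) /=.
rewrite [X in _ + X]big1_fset ?addr0; last first.
  move=> k; rewrite !inE => /andP[_ kc] _; rewrite monalg.mcoeff_outdom //.
  by rewrite -[0 in LHS](mul0r 0) phiZ scale0r.
apply: eq_fbigl => k; rewrite !inE.
by case: (boolP (k \in monalg.msupp c)) => [/cD ->|]; rewrite ?andbF.
Qed.

Lemma malg_lift_linear : linear malg_lift.
Proof.
move=> a c d.
pose D := (monalg.msupp (a *: c + d) `|` monalg.msupp c `|` monalg.msupp d)%fset.
rewrite !(@malg_liftE D); do ?by move=> k; rewrite !inE => ->; rewrite ?orbT.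
rewrite scaler_sumr -big_split /=; apply: eq_bigr => k _.
by rewrite -phiZ -phiD monalg.mcoeffD monalg.mcoeffZ.
Qed.

End FreeModule.

Section FirstHomology.
Variables (R : realType) (G : groupType).
Local Notation LG := (groupVN R G).
Local Notation u := (@group_unitary R G).

(* The complex LG (x)_ZG B_*, for B_* the (unnormalised) bar resolution: in
   degree n it is the free left LG-module on G^n, and g in G acts on LG on the
   right through multiplication by its unitary. *)
Local Notation chain1 := (monalg.malg G LG).
Local Notation chain2 := (monalg.malg (G * G)%type LG).

(* m[g] |-> m g - m *)
Definition bar_term1 (g : G) (m : LG) : LG^o := m * u g - m.

(* m[g|h] |-> m g [h] - m [gh] + m [g] *)
Definition bar_term2 (p : G * G) (m : LG) : chain1 :=
  monalg.mkmalgU p.2 (m * u p.1) - monalg.mkmalgU (p.1 * p.2)%g m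
  + monalg.mkmalgU p.1 m.

Definition boundary1 : chain1 -> LG^o := malg_lift bar_term1.
Definition boundary2 : chain2 -> chain1 := malg_lift bar_term2.

Fact boundary1_linear : linear boundary1.
Proof.
apply: malg_lift_linear => [g m m'|g m m']; rewrite /bar_term1.
  by rewrite mulrDl opprD addrACA.
by rewrite scalerBr -mulrA.
Qed.

Lemma mkmalgUZ (K : choiceType) (A : nzRingType) (k : K) (a b : A) :
  monalg.mkmalgU k (a * b) = a *: monalg.mkmalgU k b.
Proof.
apply/monalg.malgP => k'; rewrite monalg.mcoeffZ !monalg.mcoeffU.
by rewrite mulrnAr.
Qed.

Fact boundary2_linear : linear boundary2.
Proof.
apply: malg_lift_linear => [p m m'|p m m']; rewrite /bar_term2.
  rewrite mulrDl !monalg.monalgUD opprD [RHS]addrACA.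
  by congr (_ + _); rewrite addrACA.
by rewrite -mulrA !mkmalgUZ -scalerBr -scalerDr.
Qed.

HB.instance Definition _ :=
  GRing.isLinear.Build LG chain1 LG^o *:%R boundary1 boundary1_linear.
HB.instance Definition _ :=
  GRing.isLinear.Build LG chain2 chain1 *:%R boundary2 boundary2_linear.

Lemma boundary1U g m : boundary1 (monalg.mkmalgU g m) = m * u g - m.
Proof.
rewrite /boundary1 (@malg_liftE _ _ _ _ _ [fset g]%fset).
- by rewrite big_seq_fset1 monalg.mcoeffUU.
- by move=> k a b; rewrite /bar_term1 scalerBr -mulrA.
- by apply/fsubsetP/monalg.msuppU_le.
Qed.

Lemma group_unitaryM g h : u (g * h)%g = u g * u h.
Proof.
apply/val_inj/funext => f; apply/val_inj/funext => x /=.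
by rewrite invgM mulgA.
Qed.

Lemma boundary1_boundary2 c : boundary1 (boundary2 c) = 0.
Proof.
rewrite /boundary2 /malg_lift raddf_sum big1 //= => -[g h] _.
rewrite /bar_term2 /= raddfD raddfB /= !boundary1U group_unitaryM mulrA.
by rewrite opprB [X in X + _]addrC !subrKA subrr.
Qed.

Definition cycle_pred : {pred chain1} := fun c => boundary1 c == 0.

Fact cycle_submod : submod_closed cycle_pred.
Proof.
split=> [|a c d]; rewrite !unfold_in /cycle_pred ?raddf0 //.
by move=> /eqP c0 /eqP d0; rewrite boundary1_linear c0 d0 scaler0 addr0.
Qed.

HB.instance Definition _ :=
  GRing.isSubmodClosed.Build LG chain1 cycle_pred cycle_submod.

Definition cycles := {c : chain1 | c \in cycle_pred}.
HB.instance Definition _ := Choice.on cycles.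
HB.instance Definition _ := SubType.on cycles.
HB.instance Definition _ := [SubChoice_isSubLmodule of cycles by <:].

Definition boundaries : {pred cycles} := fun z => `[< exists b, boundary2 b = val z >].

Fact boundaries_submod : submod_closed boundaries.
Proof.
split=> [|a z w /asboolP[b bz] /asboolP[c cw]]; apply/asboolP.
  by exists 0; rewrite !raddf0.
by exists (a *: b + c); rewrite boundary2_linear bz cw linearP.
Qed.

Definition homology1 := quotient_module boundaries_submod.
HB.instance Definition _ := GRing.Lmodule.on homology1.

Definition l2_betti1 : \bar R := luck_dim homology1.

End FirstHomology.

(* Main.v *)
(* Let L be the group von Neumann algebra of a torsion-free group H and U its
   Ore localisation at the nonsingular elements, i.e. the algebra of affiliated
   operators.  Call H small if H_1(H; U) = 0; this implies that the first
   l2-Betti number of H vanishes.  For h <> 1 the operator h - 1 is invertible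
   over U, so for small H a 1-cocycle with values in a U-module is determined by
   its value at any one h <> 1.  Consequently cyclic groups are small, and so is
   the subgroup generated by two small subgroups with nontrivial intersection,
   or by a small subgroup A and an element g such that A and its conjugate by g
   intersect nontrivially.  The maximal small subgroups therefore partition the
   group away from 1 and are malnormal.

   If two small subgroups A and B are not free from each other, expand a cocycle
   c along a shortest nontrivial relation: writing c(k) = (k - 1) xi on B, the
   letters of B contribute alpha xi, where alpha in ZG is nonzero because the
   prefixes of the relation are distinct.  If alpha acts injectively, xi is
   determined by the restriction of c to A, so that A and B together generate a
   small subgroup.

   The Ore condition holds because L is finite.  For x, s in L with s
   nonsingular, let q be the projection onto the orthogonal complement of the
   range of v |-> (x v, s v).  Its first row (a, b) satisfies a x + b s = 0, and
   two applications of the rank-nullity theorem show that a is nonsingular.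

   The localisation is never constructed: "v lies in U w" is expressed by
   t v = y w for some t, y in L with t nonsingular. *)
Require Import Defs.
From HB Require Import structures.
From mathcomp Require Import all_boot all_order all_algebra.
From mathcomp Require Import finmap all_classical.
From mathcomp Require Import reals ereal esum.
From mathcomp Require Import complex ring lra.
From mathcomp Require Import (canonicals, coercions) monalg.

Set Implicit Arguments.
Unset Strict Implicit.
Unset Printing Implicit Defensive.

Import Order.TTheory GRing.Theory Num.Theory.
Local Open Scope classical_set_scope.
Local Open Scope ring_scope.

(** * Sums over arbitrary index sets *)

Section RealSums.
Variables (R : realType) (X : choiceType).
Implicit Types F P Q : X -> R.

Definition abs_summable F := (\esum_(x in [set: X]) `|F x|%:E < +oo)%E.

(** [fine] sends +oo to 0, so the value is meaningful only for summable families; the same holds for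
    [rsum], built from the positive and negative parts. *)
Definition nnsum F : R := fine (\esum_(x in [set: X]) (F x)%:E).

Definition rsum F : R :=
  nnsum (fun x => Num.max (F x) 0) - nnsum (fun x => Num.max (- F x) 0).

Lemma esum_leP F (M : R) :
  (forall x, 0 <= F x) ->
  ((\esum_(x in [set: X]) (F x)%:E <= M%:E)%E <->
   forall E : {fset X}, \sum_(x <- E) F x <= M).
Proof.
move=> F0; split=> [leM E|leM].
  rewrite -lee_fin -sumEFin; apply: le_trans leM.
  apply: esum_ge; exists [set` E]; first by split.
  by rewrite fsbig_finite //= set_fsetK.
apply: ge_ereal_sup => _ [D [finD _] <-].
rewrite fsbig_finite //= sumEFin lee_fin; exact: leM.
Qed.

Lemma abs_summable_le F P : (forall x, `|F x| <= P x) ->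
  abs_summable P -> abs_summable F.
Proof.
move=> leFP; apply: le_lt_trans; apply: le_esum => x _.
by rewrite lee_fin (le_trans (leFP x)) ?ler_norm.
Qed.

Lemma abs_summableD F P : abs_summable F -> abs_summable P ->
  abs_summable (fun x => F x + P x).
Proof.
move=> sF sP; apply: le_lt_trans (lte_add_pinfty sF sP).
rewrite -esumD; do ?by move=> x _; rewrite lee_fin.
by apply: le_esum => x _; rewrite -EFinD lee_fin ler_normD.
Qed.

Lemma abs_summable_bound F (M : R) : (forall x, 0 <= F x) ->
  (forall E : {fset X}, \sum_(x <- E) F x <= M) -> abs_summable F.
Proof.
move=> F0 /(esum_leP M F0) leM; apply: le_lt_trans (ltry M).
by under eq_esum => x _ do rewrite ger0_norm //.
Qed.

Lemma abs_summableZ (r : R) F : abs_summable F ->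
  abs_summable (fun x => r * F x).
Proof.
move=> sF.
have fin : (\esum_(x in [set: X]) `|F x|%:E)%E \is a fin_num.
  by rewrite ge0_fin_numE // esum_ge0 // => x _; rewrite lee_fin.
have H : forall E : {fset X}, \sum_(x <- E) `|F x| <= nnsum (fun x => `|F x|).
  by apply/(esum_leP _ (fun x => normr_ge0 _)); rewrite /nnsum fineK.
suff : abs_summable (fun x => `|r * F x|).
  exact: abs_summable_le.
apply: (@abs_summable_bound _ (`|r| * nnsum (fun x => `|F x|))) => // E.
under eq_bigr => x _ do rewrite normrM.
by rewrite -mulr_sumr ler_wpM2l.
Qed.

Lemma nnsumE P : (forall x, 0 <= P x) -> abs_summable P ->
  (\esum_(x in [set: X]) (P x)%:E)%E = (nnsum P)%:E.
Proof.
move=> P0 sP; rewrite fineK // ge0_fin_numE.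
  by move: sP; rewrite /abs_summable; under eq_esum => x _ do rewrite ger0_norm //.
by apply: esum_ge0 => x _; rewrite lee_fin.
Qed.

Lemma nnsumD P Q : (forall x, 0 <= P x) -> (forall x, 0 <= Q x) ->
  abs_summable P -> abs_summable Q ->
  nnsum (fun x => P x + Q x) = nnsum P + nnsum Q.
Proof.
move=> P0 Q0 sP sQ; apply: EFin_inj; rewrite EFinD -!nnsumE //.
- by rewrite -esumD // => x _; rewrite lee_fin.
- by move=> x; rewrite addr_ge0.
- exact: abs_summableD.
Qed.

Lemma abs_summable_pos F : abs_summable F ->
  abs_summable (fun x => Num.max (F x) 0).
Proof.
apply: le_lt_trans; apply: le_esum => x _; rewrite lee_fin.
by case: (lerP (F x) 0) => h; rewrite ?normr0 ?normr_ge0.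
Qed.

Lemma abs_summableN F : abs_summable F -> abs_summable (fun x => - F x).
Proof.
by apply: le_lt_trans; apply: le_esum => x _; rewrite normrN.
Qed.

(** Positive parts are not additive, so sums are compared through arbitrary decompositions:
    pointwise, [P] plus the negative part of [F] equals [Q] plus its positive part. Additivity of
    [rsum] follows. *)
Lemma rsum_split P Q F : (forall x, 0 <= P x) -> (forall x, 0 <= Q x) ->
  abs_summable P -> abs_summable Q -> (forall x, F x = P x - Q x) ->
  rsum F = nnsum P - nnsum Q.
Proof.
move=> P0 Q0 sP sQ FE.
have sF : abs_summable F.
  have := abs_summableD sP (abs_summableN sQ).
  by congr abs_summable; apply/funext.
have m0 (a : R) : 0 <= Num.max a 0 by rewrite le_max lexx orbT.
have e : nnsum (fun x => Num.max (F x) 0 + Q x) =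
         nnsum (fun x => Num.max (- F x) 0 + P x).
  congr nnsum; apply/funext => x; rewrite FE.
  case: (lerP (P x - Q x) 0); case: (lerP (- (P x - Q x)) 0); lra.
have sF' := abs_summableN sF.
move: e; rewrite !nnsumD //; try exact: abs_summable_pos.
rewrite /rsum; lra.
Qed.

Lemma rsum_nn F : (forall x, 0 <= F x) -> abs_summable F -> rsum F = nnsum F.
Proof.
move=> F0 sF.
have n0 : nnsum (fun _ : X => 0) = 0 by rewrite /nnsum esum1.
have s0 : abs_summable (fun _ : X => 0).
  by apply: (abs_summable_bound (M := 0)) => // E; rewrite big1.
by rewrite (@rsum_split F (fun=> 0)) ?n0 ?subr0 // => x; rewrite subr0.
Qed.

Lemma rsumD F P : abs_summable F -> abs_summable P ->
  rsum (fun x => F x + P x) = rsum F + rsum P.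
Proof.
move=> sF sP; have sF' := abs_summableN sF; have sP' := abs_summableN sP.
have m0 (a : R) : 0 <= Num.max a 0 by rewrite le_max lexx orbT.
rewrite (@rsum_split (fun x => Num.max (F x) 0 + Num.max (P x) 0)
  (fun x => Num.max (- F x) 0 + Num.max (- P x) 0)).
- rewrite !nnsumD //; try exact: abs_summable_pos.
  by rewrite /rsum; lra.
- by move=> x; rewrite addr_ge0.
- by move=> x; rewrite addr_ge0.
- by apply: abs_summableD; exact: abs_summable_pos.
- by apply: abs_summableD; exact: abs_summable_pos.
- move=> x; case: (lerP (F x) 0); case: (lerP (- (F x)) 0);
  case: (lerP (P x) 0); case: (lerP (- (P x)) 0); lra.
Qed.

Lemma rsumN F : rsum (fun x => - F x) = - rsum F.
Proof.
rewrite /rsum opprB; congr (_ - _).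
by congr nnsum; apply/funext => x; rewrite opprK.
Qed.

Lemma rsum_ge0 F : (forall x, 0 <= F x) -> abs_summable F -> 0 <= rsum F.
Proof.
move=> F0 sF; rewrite rsum_nn // fine_ge0 // esum_ge0 // => x _.
by rewrite lee_fin.
Qed.

Lemma rsum_ge F (E : {fset X}) : (forall x, 0 <= F x) -> abs_summable F ->
  \sum_(x <- E) F x <= rsum F.
Proof.
move=> F0 sF; rewrite rsum_nn //.
by apply: (esum_leP (nnsum F) F0).1; rewrite nnsumE.
Qed.

Lemma rsum_le F M : (forall x, 0 <= F x) ->
  (forall E : {fset X}, \sum_(x <- E) F x <= M) -> rsum F <= M.
Proof.
move=> F0 leM; have sF := abs_summable_bound F0 leM.
by rewrite rsum_nn // -lee_fin -nnsumE //; exact/esum_leP.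
Qed.

Lemma rsum_approx F (e : R) : (forall x, 0 <= F x) -> abs_summable F -> 0 < e ->
  exists E : {fset X}, rsum F - e <= \sum_(x <- E) F x.
Proof.
move=> F0 sF e0; apply: contrapT => /forallNP H.
have : rsum F <= rsum F - e.
  by apply: rsum_le => // E; have /negP := H E; rewrite -ltNge => /ltW.
lra.
Qed.

Lemma rsumZ (r : R) F : abs_summable F -> rsum (fun x => r * F x) = r * rsum F.
Proof.
have pos (s : R) P : 0 <= s -> (forall x, 0 <= P x) -> abs_summable P ->
    rsum (fun x => s * P x) <= s * rsum P.
  move=> s0 P0 sP; apply: rsum_le => [x|E]; first exact: mulr_ge0.
  by rewrite -mulr_sumr ler_wpM2l // rsum_ge.
have posE (s : R) P : 0 <= s -> (forall x, 0 <= P x) -> abs_summable P ->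
    rsum (fun x => s * P x) = s * rsum P.
  move=> s0 P0 sP; apply/eqP; rewrite eq_le pos //=.
  have [->|sN0] := eqVneq s 0.
    rewrite mul0r; apply: rsum_ge0 => [x|]; first by rewrite mul0r.
    exact: abs_summableZ.
  have s0' : 0 < s by rewrite lt_def sN0.
  (* The reverse inequality is [pos] for the factor s^-1, applied to the family s P. *)
  have := @pos s^-1 (fun x => s * P x).
  rewrite (_ : (fun x => s^-1 * (s * P x)) = P); last first.
    by apply/funext => x; rewrite mulKf.
  rewrite invr_ge0 => /(_ s0) H.
  rewrite -ler_pdivlMl //; apply: H => [x|]; first exact: mulr_ge0.
  exact: abs_summableZ.
have m0 (a : R) : 0 <= Num.max a 0 by rewrite le_max lexx orbT.
have posr (s : R) P : 0 <= s -> abs_summable P ->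
    rsum (fun x => s * P x) = s * rsum P.
  move=> s0 sP; have sP' := abs_summableN sP.
  have sp := abs_summable_pos sP; have sn := abs_summable_pos sP'.
  have -> : (fun x => s * P x) = (fun x => s * Num.max (P x) 0 + - (s * Num.max (- P x) 0)).
    apply/funext => x; rewrite -mulrBr; congr (_ * _).
    case: (lerP (P x) 0); case: (lerP (- (P x)) 0); lra.
  rewrite rsumD ?rsumN; [|exact: abs_summableZ|by apply: abs_summableN; exact: abs_summableZ].
  rewrite !posE // -mulrBr; congr (_ * _).
  by rewrite (rsum_nn _ sp) // (rsum_nn _ sn).
move=> sF; have [r0|r0] := leP 0 r; first exact: posr.
rewrite -[RHS]opprK -mulNr -posr ?oppr_ge0 1?ltW // -rsumN.
by congr rsum; apply/funext => x; rewrite mulNr opprK.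
Qed.

Lemma rsum_supp F x0 : (forall x, x != x0 -> F x = 0) -> rsum F = F x0.
Proof.
have nn P : (forall x, 0 <= P x) -> (forall x, x != x0 -> P x = 0) ->
    abs_summable P /\ nnsum P = P x0.
  move=> P0 Px.
  have e : (\esum_(x in [set: X]) (P x)%:E)%E = (P x0)%:E.
    rewrite (esumID [set x0]) ?setTI; last by move=> y _; rewrite lee_fin.
    rewrite esum_set1 ?lee_fin // esum1 ?adde0 // => y /= yx.
    by rewrite Px //; apply/eqP.
  split; last by rewrite /nnsum e.
  rewrite /abs_summable; under eq_esum => x _ do rewrite ger0_norm //.
  by rewrite e ltry.
have m0 (a : R) : 0 <= Num.max a 0 by rewrite le_max lexx orbT.
move=> Fx; rewrite /rsum.
have [|_ ->] := nn _ (fun x => m0 (F x)).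
  by move=> x /Fx ->; rewrite maxxx.
have [|_ ->] := nn _ (fun x => m0 (- F x)).
  by move=> x /Fx ->; rewrite oppr0 maxxx.
case: (lerP (F x0) 0); case: (lerP (- (F x0)) 0); lra.
Qed.

End RealSums.

Lemma abs_summable_reindex (R : realType) (X Y : choiceType) (e : X -> Y)
    (F : Y -> R) : bijective e -> abs_summable F -> abs_summable (F \o e).
Proof.
move=> be; rewrite /abs_summable (@reindex_esum _ _ _ setT setT e) ?setTT_bijective //.
Qed.

Lemma rsum_reindex (R : realType) (X Y : choiceType) (e : X -> Y) (F : Y -> R) :
  bijective e -> rsum F = rsum (F \o e).
Proof.
move=> be; rewrite /rsum /nnsum; congr (fine _ - fine _);
by rewrite (@reindex_esum _ _ _ setT setT e) ?setTT_bijective //.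
Qed.

(** * Real and complex Hilbert spaces *)

Section RealLimits.
Variable R : realType.
Implicit Types (x y : nat -> R) (l : R).

Definition rcvg x l :=
  forall e, 0 < e -> exists n0, forall n, (n0 <= n)%N -> `|x n - l| <= e.

Lemma rcvg_unique x l m : rcvg x l -> rcvg x m -> l = m.
Proof.
move=> xl xm; apply/eqP; rewrite -subr_eq0 -normr_le0; apply/ler_addgt0Pl => e e0.
have e20 : 0 < e / 2 by lra.
have [n1 /(_ (maxn n1 _) (leq_maxl _ _)) h1] := xl _ e20.
have [n2 /(_ (maxn _ n2) (leq_maxr _ _)) h2] := xm _ e20.
have := h1 n2; have := h2 n1; rewrite !ler_norml => /andP[? ?] /andP[? ?].
apply/andP; lra.
Qed.

Lemma rcvg_cst l : rcvg (fun=> l) l.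
Proof. by move=> e e0; exists 0%N => n _; rewrite subrr normr0 ltW. Qed.

Lemma rcvgB x y l m : rcvg x l -> rcvg y m -> rcvg (fun n => x n - y n) (l - m).
Proof.
move=> xl ym e e0; have e20 : 0 < e / 2 by lra.
have [n1 h1] := xl _ e20; have [n2 h2] := ym _ e20.
exists (maxn n1 n2) => n; rewrite geq_max => /andP[/h1 + /h2].
rewrite !ler_norml => /andP[? ?] /andP[? ?]; apply/andP; lra.
Qed.

Lemma rcvgD x y l m : rcvg x l -> rcvg y m -> rcvg (fun n => x n + y n) (l + m).
Proof.
move=> xl ym e e0; have e20 : 0 < e / 2 by lra.
have [n1 h1] := xl _ e20; have [n2 h2] := ym _ e20.
exists (maxn n1 n2) => n; rewrite geq_max => /andP[/h1 + /h2].
rewrite !ler_norml => /andP[? ?] /andP[? ?]; apply/andP; lra.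
Qed.

Lemma rcvg_nonincreasing x : (forall n, 0 <= x n) -> (forall n, x n.+1 <= x n) ->
  exists l, rcvg x l.
Proof.
move=> x0 xS; have dec n k : x (n + k)%N <= x n.
  by elim: k => [|k IH]; rewrite ?addn0 // addnS (le_trans (xS _)).
have hi : has_inf (range x) by split; [exists (x 0%N); exists 0%N | exists 0 => _ [n _ <-]].
exists (inf (range x)) => e e0.
have [_ [n0 _ <-] lt] := inf_adherent e0 hi.
exists n0 => n /subnKC <-; have := dec n0 (n - n0)%N.
have : inf (range x) <= x (n0 + (n - n0))%N by apply: ge_inf; [case: hi | exists (n0 + (n - n0))%N].
by rewrite ler_norml => ? ?; apply/andP; lra.
Qed.

Lemma rcvg_cauchy x :
  (forall e, 0 < e -> exists n0, forall m n, (n0 <= m)%N -> (n0 <= n)%N -> `|x m - x n| <= e) ->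
  exists l, rcvg x l.
Proof.
move=> cx.
(* The supremum of this set is the lower limit of [x]. *)
pose S := [set r | exists n0, forall n, (n0 <= n)%N -> r <= x n].
have [n1 h1] := cx _ ltr01.
have hS : has_sup S.
  split.
    exists (x n1 - 1); exists n1 => n nn; have := h1 _ _ (leqnn n1) nn.
    by rewrite ler_norml => /andP[? ?]; lra.
  exists (x n1 + 1) => r [n0 h0].
  have := h0 _ (leq_maxl n0 n1); have := h1 _ _ (leq_maxr n0 n1) (leqnn n1).
  by rewrite ler_norml => /andP[? ?] ?; lra.
exists (sup S) => e e0; have [n0 h0] := cx _ e0; exists n0 => n nn.
rewrite ler_norml; apply/andP; split.
  suff : sup S <= x n + e by lra.
  apply: ge_sup; first by case: hS.
  move=> r [n2 h2]; have := h2 _ (leq_maxr n0 n2).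
  have := h0 _ _ (leq_maxl n0 n2) nn.
  by rewrite ler_norml => /andP[? ?] ?; lra.
suff : x n - e <= sup S by lra.
apply: ub_le_sup; first by case: hS.
exists n0 => m nm; have := h0 _ _ nm nn.
by rewrite ler_norml => /andP[? ?]; lra.
Qed.

End RealLimits.

(** * Abstract Hilbert spaces and projections onto kernels *)

Section Hilbert.
Variable R : realType.
Local Notation C := R[i].

(* B stands for the real part of a complex inner product; it has the same norm,
   and the same orthogonal complements of complex subspaces. *)
Record hilbert (V : lmodType C) (B : V -> V -> R) : Prop := Hilbert {
  hilC : forall u v, B u v = B v u;
  hilDl : forall u v w, B (u + v) w = B u w + B v w;
  hilZl : forall (a : R) u v, B (a%:C%C *: u) v = a * B u v;
  hil_ge0 : forall u, 0 <= B u u;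
  hil_def : forall u, B u u = 0 -> u = 0;
  hil_i : forall u v, B ('i%C *: u) ('i%C *: v) = B u v;
  hil_complete : forall u : nat -> V,
    (forall e, 0 < e -> exists n0, forall m n, (n0 <= m)%N -> (n0 <= n)%N ->
       B (u m - u n) (u m - u n) <= e) ->
    exists l, forall e, 0 < e -> exists n0, forall n, (n0 <= n)%N ->
       B (u n - l) (u n - l) <= e }.

Section Theory.
Variables (V : lmodType C) (B : V -> V -> R).
Hypothesis HB : hilbert B.
Implicit Types (u v w : V).

Lemma hilDr u v w : B u (v + w) = B u v + B u w.
Proof. by rewrite hilC // hilDl // !(hilC HB u). Qed.

Lemma hil0l v : B 0 v = 0.
Proof. by have := hilDl HB 0 0 v; rewrite addr0; lra. Qed.

Lemma hilNl u v : B (- u) v = - B u v.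
Proof. by have := hilDl HB u (- u) v; rewrite subrr hil0l; lra. Qed.

Lemma hil0r v : B v 0 = 0. Proof. by rewrite hilC // hil0l. Qed.

Lemma hilNr u v : B u (- v) = - B u v.
Proof. by rewrite hilC // hilNl hilC. Qed.

Lemma hilBl u v w : B (u - v) w = B u w - B v w.
Proof. by rewrite hilDl // hilNl. Qed.

Lemma hilBr u v w : B u (v - w) = B u v - B u w.
Proof. by rewrite hilDr // hilNr. Qed.

Lemma hilZr (a : R) u v : B u (a%:C%C *: v) = a * B u v.
Proof. by rewrite hilC // hilZl // hilC. Qed.

Lemma hil_CS u v : B u v ^+ 2 <= B u u * B v v.
Proof.
have [u0|uN0] := eqVneq (B u u) 0.
  by rewrite (hil_def HB u0) !hil0l mul0r expr0n.
have u0 : 0 < B u u by rewrite lt_def uN0 hil_ge0.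
have := hil_ge0 HB ((B u v)%:C%C *: u - (B u u)%:C%C *: v).
rewrite !hilBl !hilBr !(hilZl HB) !hilZr (hilC HB v u) => h.
rewrite -(ler_pM2l u0); nra.
Qed.

Lemma hil_normD u v : B (u + v) (u + v) <= 2 * (B u u + B v v).
Proof.
have := hil_ge0 HB (u - v); rewrite !hilBl !hilBr !(hilDl HB) !hilDr (hilC HB v u).
lra.
Qed.

(** Multiplication by i is an isometry with square -1, so the value equals its own negative. *)
Lemma hil_iC u : B u ('i%C *: u) = 0.
Proof.
have := hil_i HB u ('i%C *: u); rewrite scalerA -expr2 sqr_i scaleN1r hilNr.
rewrite (hilC HB _ u); lra.
Qed.

Lemma hil_normZ (a : C) u :
  B (a *: u) (a *: u) = (complex.Re a ^+ 2 + complex.Im a ^+ 2) * B u u.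
Proof.
rewrite [a in LHS]complexE mulrC scalerDl -scalerA.
rewrite !(hilDl HB) !hilDr !(hilZl HB) !hilZr hil_i // hil_iC (hilC HB _ u) hil_iC.
by ring.
Qed.

Definition hcvg (u : nat -> V) l :=
  forall e, 0 < e -> exists n0, forall n, (n0 <= n)%N -> B (u n - l) (u n - l) <= e.

Lemma hcvg_ext (u u' : nat -> V) l : (forall n, u n = u' n) -> hcvg u l -> hcvg u' l.
Proof. by move=> uu' ul e /ul [n0 h]; exists n0 => n /h; rewrite uu'. Qed.

Lemma hcvg_weak (u : nat -> V) l v : hcvg u l -> rcvg (fun n => B (u n) v) (B l v).
Proof.
move=> ul e e0; have e1 : 0 < e ^+ 2 / (B v v + 1).
  by rewrite divr_gt0 ?exprn_gt0 // ltr_wpDl // hil_ge0.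
have [n0 h] := ul _ e1; exists n0 => n /h.
rewrite ler_pdivlMr ?ltr_wpDl ?hil_ge0 // -hilBl => h'.
have e0' := ltW e0.
rewrite -(@ler_pXn2r _ 2) ?nnegrE // real_normK ?num_real //.
have := hil_CS (u n - l) v; have := hil_ge0 HB (u n - l); nra.
Qed.

Lemma hil_nondeg u : (forall v, B u v = 0) -> u = 0.
Proof. by move=> /(_ u) /(hil_def HB). Qed.

Lemma hil_ext u v : (forall w, B u w = B v w) -> u = v.
Proof.
move=> e; apply/eqP; rewrite -subr_eq0; apply/eqP/hil_nondeg => w.
by rewrite hilBl e subrr.
Qed.

Lemma hcvg_unique (u : nat -> V) l m : hcvg u l -> hcvg u m -> l = m.
Proof.
by move=> ul um; apply: hil_ext => w; apply: rcvg_unique (hcvg_weak _ ul) (hcvg_weak _ um).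
Qed.

Lemma hcvg_lin (T : V -> V) (u : nat -> V) l (K : R) : 0 <= K -> {morph T : x y / x - y} ->
  (forall v, B (T v) (T v) <= K * B v v) -> hcvg u l -> hcvg (T \o u) (T l).
Proof.
move=> K0 TB TK ul e e0; have e1 : 0 < e / (K + 1) by rewrite divr_gt0 // ltr_wpDl.
have [n0 h] := ul _ e1; exists n0 => n /h /=.
rewrite -TB ler_pdivlMr ?ltr_wpDl // => h'; apply: le_trans (TK _) _.
have := hil_ge0 HB (u n - l); nra.
Qed.

Lemma hcvgD (u u' : nat -> V) l l' : hcvg u l -> hcvg u' l' -> hcvg (fun n => u n + u' n) (l + l').
Proof.
move=> ul ul' e e0; have e1 : 0 < e / 4 by lra.
have [n1 h1] := ul _ e1; have [n2 h2] := ul' _ e1.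
exists (maxn n1 n2) => n; rewrite geq_max => /andP[/h1 ? /h2 ?].
by rewrite opprD addrACA; apply: le_trans (hil_normD _ _) _; lra.
Qed.

Lemma hcvgZ (a : C) (u : nat -> V) l : hcvg u l -> hcvg (fun n => a *: u n) (a *: l).
Proof.
apply: (@hcvg_lin (fun v => a *: v) u l (complex.Re a ^+ 2 + complex.Im a ^+ 2)).
- by rewrite addr_ge0 ?sqr_ge0.
- by move=> x y; rewrite scalerBr.
- by move=> v; rewrite hil_normZ.
Qed.

Section KernelProjection.
Variable A : V -> V.
Hypothesis linA : linear A.
Hypothesis symA : forall u v, B (A u) v = B u (A v).
Hypothesis leA : forall v, B (A v) (A v) <= B (A v) v.

Let a v := v - A v.

Let AB : {morph A : x y / x - y}.
Proof. by move=> x y; rewrite addrC -scaleN1r linA scaleN1r addrC. Qed.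

Let aB : {morph a : x y / x - y}.
Proof. by move=> x y; rewrite /a AB !opprB addrACA [RHS]addrACA; congr (_ + _); rewrite addrC. Qed.

Let lin_a (c : C) u v : a (c *: u + v) = c *: a u + a v.
Proof. by rewrite /a linA opprD addrACA scalerBr. Qed.

Let sym_a u v : B (a u) v = B u (a v).
Proof. by rewrite /a hilBl hilBr symA. Qed.

Let norm_a v : B (a v) (a v) <= B v v.
Proof.
rewrite /a hilBl !hilBr (hilC HB v); have := leA v; have := hil_ge0 HB (A v); lra.
Qed.

(** By symmetry <a^m v, a^n v> = [b v (m + n)], so squared distances between iterates are
    combinations of values of this one sequence. The hypothesis [leA] says that 0 <= A <= 1; it
    makes the sequence nonnegative and nonincreasing, so that the iterates are Cauchy. Even and odd
    indices are treated separately, by splitting the power of [a] evenly between the two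
    arguments. *)
Let b v n := B (iter n a v) v.

Let bE v m n : B (iter m a v) (iter n a v) = b v (m + n).
Proof.
elim: n m => [|n IH] m; first by rewrite addn0.
by rewrite iterS -sym_a -iterS IH addSnnS.
Qed.

Let b_ge0 v n : 0 <= b v n.
Proof.
rewrite -[n]odd_double_half; case: (odd n) => /=; rewrite ?add0n ?add1n -?addnn.
  rewrite -addSn -bE iterS /a hilBl; set w := iter _ _ _.
  have := leA w; have := hil_CS (A w) w; have := hil_ge0 HB (A w).
  have := hil_ge0 HB w; nra.
by rewrite -bE hil_ge0.
Qed.

Let b_dec v n : b v n.+1 <= b v n.
Proof.
rewrite -[n]odd_double_half; case: (odd n) => /=; rewrite ?add0n ?add1n -?addnn.
  rewrite -[in X in _ <= X]addSn -addnS -addSn -!bE !iterS; set w := iter _ _ _.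
  rewrite /a !hilBl !hilBr (hilC HB w (A w)); have := leA w; lra.
rewrite -addSn -!bE iterS; set w := iter _ _ _.
by rewrite /a hilBl; have := leA w; have := hil_ge0 HB (A w); lra.
Qed.

Let iter_cvg v : exists l, hcvg (fun n => iter n a v) l.
Proof.
have [l bl] := rcvg_nonincreasing (b_ge0 v) (b_dec v).
apply: (hil_complete HB) => e e0; have e1 : 0 < e / 4 by lra.
have [n0 h] := bl _ e1; exists n0 => m n nm nn.
rewrite hilBl !hilBr !bE.
have := h (m + m)%N (leq_trans nm (leq_addr _ _)).
have := h (m + n)%N (leq_trans nm (leq_addr _ _)).
have := h (n + m)%N (leq_trans nn (leq_addr _ _)).
have := h (n + n)%N (leq_trans nn (leq_addr _ _)).
rewrite !ler_norml => /andP[? ?] /andP[? ?] /andP[? ?] /andP[? ?]; lra.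
Qed.

(* The powers (1 - A)^n of a positive contraction converge strongly to the
   orthogonal projection onto ker A. *)
Lemma kernel_projection : exists p : V -> V,
  [/\ forall v, hcvg (fun n => iter n (fun v => v - A v) v) (p v),
      linear p,
      forall u v, B (p u) v = B u (p v),
      forall v, A (p v) = 0
    & forall v, A v = 0 -> p v = v].
Proof.
have [p pP] := choice iter_cvg; exists p; split => //.
- move=> c u v; apply: (hcvg_unique (pP _)).
  apply: hcvg_ext (hcvgD (hcvgZ c (pP u)) (pP v)) => n.
  by elim: n => //= n <-; rewrite lin_a.
- move=> u v; apply: (rcvg_unique (hcvg_weak v (pP u))) => e e0.
  have [n0 h] := hcvg_weak u (pP v) e0; exists n0 => n /h.
  rewrite (hilC HB u) (_ : B (iter n a v) u = B (iter n a u) v) //.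
  rewrite [RHS](hilC HB); elim: n {h} (u) => //= n IH w.
  by rewrite -[in RHS]iterS iterSr -IH sym_a.
(* As [a] is continuous and shifting the sequence of iterates does not change its limit, the limit
   is a fixed point of [a], that is, a kernel vector of [A]. *)
- move=> v; have : a (p v) = p v.
    apply: hcvg_unique (pP v) => //.
    have /= := hcvg_lin ler01 aB _ (pP v).
    move=> /(_ (fun w => _)) h.
    have {}h : hcvg (a \o (fun n => iter n a v)) (a (p v)).
      by apply: h => w; rewrite mul1r norm_a.
    move=> e /h [n0 H]; exists n0.+1 => -[//|n]; rewrite ltnS => /H /=.
    by [].
  by rewrite /a => /(canRL (subrK _)) /(canLR (addKr _)); rewrite addNr => <-.
- move=> v Av; apply: (hcvg_unique (pP v)).
  apply: (@hcvg_ext (fun=> v)) => [n|e e0]; last first.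
    by exists 0%N => n _; rewrite subrr hil0l ltW.
  by elim: n => //= n <-; rewrite /a Av subr0.
Qed.

End KernelProjection.

End Theory.

End Hilbert.

(** * The Hilbert space of square-summable functions *)

Section EllTwoForm.
Variables (R : realType) (X : choiceType).
Local Notation C := R[i].
Local Notation H := (l2 R X).
Implicit Types (f g h : H) (x : X).

Definition redot (a b : C) : R :=
  complex.Re a * complex.Re b + complex.Im a * complex.Im b.

Definition l2form f g : R := rsum (fun x => redot (val f x) (val g x)).

Lemma redot_ge0 a : 0 <= redot a a.
Proof. by rewrite /redot -!expr2 addr_ge0 ?sqr_ge0. Qed.

Lemma redotC a b : redot a b = redot b a.
Proof. by rewrite /redot; congr (_ + _); rewrite mulrC. Qed.

Lemma redotDl a b c : redot (a + b) c = redot a c + redot b c.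
Proof. by case: a b => a a' [b b']; rewrite /redot /=; ring. Qed.

Lemma normc_redot a : Normc.normc a ^+ 2 = redot a a.
Proof. by case: a => a b; rewrite /= sqr_sqrtr ?addr_ge0 ?sqr_ge0. Qed.

Lemma l2valD f g x : val (f + g) x = val f x + val g x. Proof. by []. Qed.
Lemma l2valZ (a : C) f x : val (a *: f) x = a * val f x. Proof. by []. Qed.
Lemma l2valB f g x : val (f - g) x = val f x - val g x. Proof. by []. Qed.

Lemma in_l2E (f : X -> C) :
  (f \in @square_summable R X) = abs_summable (fun x => redot (f x) (f x)) :> Prop.
Proof.
rewrite unfold_in /square_summable /sqnorm /abs_summable.
congr (is_true (_ < _)%E); apply: eq_esum => x _.
by rewrite normc_redot ger0_norm ?redot_ge0.
Qed.

Lemma l2_sqr_summable f : abs_summable (fun x => redot (val f x) (val f x)).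
Proof. by rewrite -in_l2E; exact: valP. Qed.

Lemma l2_summable f g : abs_summable (fun x => redot (val f x) (val g x)).
Proof.
apply: abs_summable_le (abs_summableD (l2_sqr_summable f) (l2_sqr_summable g)) => x.
rewrite /redot; set a := complex.Re _; set b := complex.Re _.
set c := complex.Im _; set d := complex.Im _.
have := sqr_ge0 (a - b); have := sqr_ge0 (a + b).
have := sqr_ge0 (c - d); have := sqr_ge0 (c + d).
rewrite ler_norml !sqrrD !sqrrN -!expr2 => ? ? ? ?; apply/andP; split; nra.
Qed.

Lemma l2norm_form f : l2norm f ^+ 2 = l2form f f.
Proof.
apply: EFin_inj; rewrite -sqnorm_l2 /sqnorm /l2form.
rewrite rsum_nn; [|by move=> x; exact: redot_ge0|exact: l2_summable].
rewrite -nnsumE; [|by move=> x; exact: redot_ge0|exact: l2_summable].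
by apply: eq_esum => x _; rewrite normc_redot.
Qed.

Definition l2_of (f : X -> C) (hf : f \in @square_summable R X) : H := Sub f hf.

Lemma l2_eq f g : (forall x, val f x = val g x) -> f = g.
Proof. by move=> fg; apply/val_inj/funext. Qed.

(** The form is only the real part of the inner product: testing against [delta] gives real parts of
    coordinates, and testing against i times [delta] gives imaginary parts. Both families are needed
    to separate vectors. *)
Lemma l2form_delta x f : l2form (delta R x) f = complex.Re (val f x).
Proof.
rewrite /l2form (rsum_supp (x0 := x)) /redot => [|y /negbTE yx] /=.
  by rewrite eqxx /= mul1r mul0r addr0.
by rewrite yx /= !mul0r addr0.
Qed.

Lemma l2form_idelta x f : l2form ('i%C *: delta R x) f = complex.Im (val f x).
Proof.
rewrite /l2form (rsum_supp (x0 := x)) /redot => [|y /negbTE yx].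
  by rewrite l2valZ /= eqxx mulr1 /= mul1r mul0r add0r.
by rewrite l2valZ /= yx mulr0 /= !mul0r addr0.
Qed.

Lemma l2form_point x f : redot (val f x) (val f x) <= l2form f f.
Proof.
have := rsum_ge [fset x]%fset (fun x => redot_ge0 (val f x)) (l2_sqr_summable f).
by rewrite big_seq_fset1.
Qed.

Lemma l2form_complete (u : nat -> H) :
  (forall e, 0 < e -> exists n0, forall m n, (n0 <= m)%N -> (n0 <= n)%N ->
     l2form (u m - u n) (u m - u n) <= e) ->
  exists l, forall e, 0 < e -> exists n0, forall n, (n0 <= n)%N ->
     l2form (u n - l) (u n - l) <= e.
Proof.
move=> cu.
have ptw x e : 0 < e -> exists n0, forall m n, (n0 <= m)%N -> (n0 <= n)%N ->
    redot (val (u m) x - val (u n) x) (val (u m) x - val (u n) x) <= e ^+ 2.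
  move=> e0; have [n0 h] := cu _ (exprn_gt0 2 e0); exists n0 => m n nm nn.
  exact: le_trans (l2form_point x _) (h _ _ nm nn).
have ex_re x : exists l, rcvg (fun n => complex.Re (val (u n) x)) l.
  apply: rcvg_cauchy => e e0; have [n0 h] := ptw x _ e0; exists n0 => m n nm nn.
  have := h _ _ nm nn; case: (val (u m) x) (val (u n) x) => a b [c d].
  rewrite /redot /= => h'; have e0' := ltW e0.
  rewrite -(@ler_pXn2r _ 2) ?nnegrE // real_normK ?num_real //.
  by have := sqr_ge0 (b - d); nra.
have [re reP] := choice ex_re.
have ex_im x : exists l, rcvg (fun n => complex.Im (val (u n) x)) l.
  apply: rcvg_cauchy => e e0; have [n0 h] := ptw x _ e0; exists n0 => m n nm nn.
  have := h _ _ nm nn; case: (val (u m) x) (val (u n) x) => a b [c d].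
  rewrite /redot /= => h'; have e0' := ltW e0.
  rewrite -(@ler_pXn2r _ 2) ?nnegrE // real_normK ?num_real //.
  by have := sqr_ge0 (a - c); nra.
have [im imP] := choice ex_im.
pose l0 x : C := (re x +i* im x)%C.
have close n x e : 0 < e -> exists n0, forall m, (n0 <= m)%N ->
    redot (val (u n) x - l0 x) (val (u n) x - l0 x) <=
    redot (val (u n) x - val (u m) x) (val (u n) x - val (u m) x) + e.
  move=> e0.
  have := rcvgB (rcvg_cst (complex.Re (val (u n) x))) (reP x).
  have := rcvgB (rcvg_cst (complex.Im (val (u n) x))) (imP x).
  set p := complex.Im _ - im x; set q := complex.Re _ - re x => hp hq.
  (* Since p^2 - s^2 <= 2 |p| |p - s|, and likewise for q and t, closeness up to this [d] costs at
     most 2 d (|p| + |q|) <= e. *)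
  pose d := Num.min 1 (e / (2 * (`|p| + `|q| + 1))).
  have pq0 : 0 < 2 * (`|p| + `|q| + 1) by rewrite mulr_gt0 // ltr_wpDl ?addr_ge0.
  have d0 : 0 < d by rewrite lt_min ltr01 divr_gt0.
  have [n1 h1] := hp _ d0; have [n2 h2] := hq _ d0.
  exists (maxn n1 n2) => m; rewrite geq_max => /andP[/h1 + /h2].
  set s := complex.Im (val (u n) x) - _; set t := complex.Re (val (u n) x) - _.
  have -> : redot (val (u n) x - l0 x) (val (u n) x - l0 x) = q ^+ 2 + p ^+ 2.
    by rewrite /redot /q /p /l0 /=; case: (val (u n) x) => ? ? /=; rewrite !expr2.
  have -> : redot (val (u n) x - val (u m) x) (val (u n) x - val (u m) x) = t ^+ 2 + s ^+ 2.
    rewrite /redot /t /s; case: (val (u n) x) (val (u m) x) => ? ? [? ?] /=.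
    by rewrite !expr2.
  have dle : d * (2 * (`|p| + `|q| + 1)) <= e.
    by rewrite -ler_pdivlMr // ge_min lexx orbT.
  have := ler_norm p; have := ler_norm q; have := ler_norm (- p); have := ler_norm (- q).
  rewrite !normrN !ler_norml => ? ? ? ? /andP[? ?] /andP[? ?].
  have hs : p ^+ 2 - s ^+ 2 <= 2 * d * `|p|.
    have [p0|p0] := leP 0 p; last first.
      rewrite ltr0_norm //; have := sqr_ge0 (p - s); nra.
    rewrite ger0_norm //; have := sqr_ge0 (p - s); nra.
  have ht : q ^+ 2 - t ^+ 2 <= 2 * d * `|q|.
    have [q0|q0] := leP 0 q; last first.
      rewrite ltr0_norm //; have := sqr_ge0 (q - t); nra.
    rewrite ger0_norm //; have := sqr_ge0 (q - t); nra.
  nra.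
(* The Cauchy estimate holds for every finite partial sum, uniformly in [E]; letting m tend to
   infinity on the finite set [E] replaces u m by the pointwise limit. *)
have bound e : 0 < e -> exists n0, forall n, (n0 <= n)%N -> forall E : {fset X},
    \sum_(x <- E) redot (val (u n) x - l0 x) (val (u n) x - l0 x) <= e.
  move=> e0; have [n0 h] := cu _ e0; exists n0 => n nn E.
  apply/ler_addgt0Pl => d d0.
  have [m [nm Em]] : exists m, (n0 <= m)%N /\
      \sum_(x <- E) redot (val (u n) x - l0 x) (val (u n) x - l0 x) <=
      \sum_(x <- E) redot (val (u n) x - val (u m) x) (val (u n) x - val (u m) x) + d.
    suff [m0 hm0] : exists m0, forall m, (m0 <= m)%N ->
      \sum_(x <- E) redot (val (u n) x - l0 x) (val (u n) x - l0 x) <=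
      \sum_(x <- E) redot (val (u n) x - val (u m) x) (val (u n) x - val (u m) x) + d.
      exists (maxn n0 m0); split; first exact: leq_maxl.
      by apply: hm0; exact: leq_maxr.
    elim: (enum_fset E) d d0 => [|x s IH] d d0.
      by exists 0%N => m _; rewrite !big_nil add0r ltW.
    have d2 : 0 < d / 2 by lra.
    have [m1 h1] := IH _ d2; have [m2 h2] := close n x _ d2.
    exists (maxn m1 m2) => m; rewrite geq_max => /andP[/h1 ? /h2 ?].
    by rewrite !big_cons; lra.
  rewrite addrC; apply: le_trans Em _; rewrite lerD2r.
  apply: le_trans (h _ _ nn nm).
  exact: (rsum_ge E (fun x => redot_ge0 _) (l2_sqr_summable (u n - u m))).
have [n1 h1] := bound 1 ltr01.
have dl2 : (fun x => val (u n1) x - l0 x) \in @square_summable R X.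
  rewrite in_l2E; apply: (abs_summable_bound (M := 1)) => [x|E]; first exact: redot_ge0.
  exact: h1.
(* The pointwise limit is square-summable because it is the difference of the two square-summable
   functions u n1 and u n1 - l0. *)
exists (u n1 - l2_of dl2) => e e0; have [n0 h] := bound _ e0; exists n0 => n nn.
apply: rsum_le => [x|E]; first exact: redot_ge0.
apply: le_trans (h _ nn E); rewrite le_eqVlt; apply/orP; left; apply/eqP.
apply: eq_bigr => x _.
by rewrite l2valB l2valB SubK subKr.
Qed.

Lemma l2form_hilbert : hilbert l2form.
Proof.
split=> [f g|f g h|a f g|f|f f0|f g|].
- by congr rsum; apply/funext => x; rewrite redotC.
- rewrite -rsumD; [|exact: l2_summable|exact: l2_summable].
  by congr rsum; apply/funext => x; rewrite l2valD redotDl.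
- rewrite -rsumZ; last exact: l2_summable.
  congr rsum; apply/funext => x; rewrite l2valZ /redot.
  by case: (val f x) => b c /=; ring.
- by apply: rsum_ge0; [move=> x; exact: redot_ge0 | exact: l2_summable].
- apply: l2_eq => x; have := l2form_point x f; rewrite f0 /redot /=.
  case: (val f x) => a b /= h.
  have a2 := sqr_ge0 a; have b2 := sqr_ge0 b.
  have /eqP : a ^+ 2 = 0 by nra.
  have /eqP : b ^+ 2 = 0 by nra.
  by rewrite !expf_eq0 /= => /eqP -> /eqP ->.
- congr rsum; apply/funext => x; rewrite !l2valZ /redot.
  by case: (val f x) (val g x) => a b [c d] /=; ring.
- exact: l2form_complete.
Qed.

Lemma l2form_ext f g :
  (forall x, l2form (delta R x) f = l2form (delta R x) g) ->
  (forall x, l2form ('i%C *: delta R x) f = l2form ('i%C *: delta R x) g) -> f = g.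
Proof.
move=> re im; apply: l2_eq => x; apply/eqP; rewrite eq_complex.
by rewrite -!l2form_delta -!l2form_idelta re im !eqxx.
Qed.

End EllTwoForm.

Section HilbertMore.
Variables (R : realType) (V : lmodType R[i]) (B : V -> V -> R).
Hypothesis HB : hilbert B.

Lemma hil_iN u v : B ('i%C *: u) v = - B u ('i%C *: v).
Proof.
have := hil_i HB u ('i%C *: v); rewrite scalerA -expr2 sqr_i scaleN1r hilNr //.
by move=> <-; rewrite opprK.
Qed.

Lemma hilZ_conj (a : R[i]) u v : B (a *: u) v = B u ((a^*)%C *: v).
Proof.
rewrite (complexE (a^*)%C) [a in LHS]complexE ['i%C * _]mulrC ['i%C * _ in RHS]mulrC.
rewrite !scalerDl -!scalerA (hilDl HB) (hilDr HB) !(hilZl HB) !(hilZr HB) hil_iN.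
by case: a => a b /=; ring.
Qed.
End HilbertMore.

(** * Orthogonal direct sums *)

Section ProductHilbert.
Variables (R : realType) (V W : lmodType R[i]).
Variables (BV : V -> V -> R) (BW : W -> W -> R).
Hypotheses (HV : hilbert BV) (HW : hilbert BW).

Definition prod_form (u v : V * W) : R := BV u.1 v.1 + BW u.2 v.2.

Lemma prod_form_hilbert : hilbert prod_form.
Proof.
rewrite /prod_form; split=> [u v|u v w|a u v|u|[u u'] /= h|u v|u cu].
- by rewrite (hilC HV) (hilC HW).
- by rewrite /= (hilDl HV) (hilDl HW) addrACA.
- by rewrite /= (hilZl HV) (hilZl HW) mulrDr.
- by rewrite addr_ge0 ?(hil_ge0 HV) ?(hil_ge0 HW).
- have := hil_ge0 HV u; have := hil_ge0 HW u' => h1 h2.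
  have u0 : u = 0 by apply: (hil_def HV); lra.
  have u'0 : u' = 0 by apply: (hil_def HW); lra.
  by rewrite u0 u'0.
- by rewrite /= (hil_i HV) (hil_i HW).
- have [|l1 h1] := hil_complete HV (u := fun n => (u n).1).
    move=> e /cu [n0 h]; exists n0 => m n nm nn; apply: le_trans (h _ _ nm nn).
    by rewrite /= lerDl (hil_ge0 HW).
  have [|l2 h2] := hil_complete HW (u := fun n => (u n).2).
    move=> e /cu [n0 h]; exists n0 => m n nm nn; apply: le_trans (h _ _ nm nn).
    by rewrite /= lerDr (hil_ge0 HV).
  exists (l1, l2) => e e0; have e1 : 0 < e / 2 by lra.
  have [n1 k1] := h1 _ e1; have [n2 k2] := h2 _ e1.
  exists (maxn n1 n2) => n; rewrite geq_max => /andP[/k1 + /k2] /=; lra.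
Qed.

End ProductHilbert.

(** * Finitely supported vectors and adjoints *)

Section Adjoint.
Variables (R : realType) (X : choiceType).
Local Notation C := R[i].
Local Notation H := (l2 R X).
Local Notation B := (@l2form R X).
Local Notation HB := (@l2form_hilbert R X).
Implicit Types (f g h : H).

Definition l2trunc (E : {fset X}) (c : X -> C) : H := \sum_(x <- E) c x *: delta R x.

Lemma val_l2trunc E c y : val (l2trunc E c) y = if y \in E then c y else 0.
Proof.
have scE (a : C) (f : X -> C) z : (a *: f) z = a * f z by [].
rewrite /l2trunc raddf_sum /= fct_sumE.
have [yE|yE] := boolP (y \in E).
  rewrite (big_fsetD1 y) //= scE eqxx mulr1 big1_fset ?addr0 // => x.
  by rewrite !inE scE => /andP[/negbTE xy _] _; rewrite eq_sym xy mulr0.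
rewrite big1_fset // => x xE _; rewrite scE.
suff /negbTE -> : y != x by rewrite mulr0.
by apply: contraNneq yE => ->.
Qed.

Lemma l2trunc_approx f e : 0 < e -> exists E,
  B (f - l2trunc E (val f)) (f - l2trunc E (val f)) <= e.
Proof.
move=> e0; have F0 x := redot_ge0 (val f x).
have [E hE] := rsum_approx F0 (l2_sqr_summable f) e0; exists E.
apply: rsum_le => [x|D]; first exact: redot_ge0.
apply: (@le_trans _ _ (\sum_(x <- (D `\` E)%fset) redot (val f x) (val f x))).
  have eF x : redot (val (f - l2trunc E (val f)) x) (val (f - l2trunc E (val f)) x) =
      if x \in E then 0 else redot (val f x) (val f x).
    rewrite l2valB val_l2trunc; case: ifP => _; last by rewrite subr0.
    by rewrite subrr /redot !mul0r addr0.
  rewrite (eq_bigr _ (fun x _ => eF x)) (big_fsetID _ (mem E)) /= big1_fset ?add0r; last first.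
    by move=> x; rewrite !inE => /andP[_ ->].
  rewrite le_eqVlt; apply/orP; left; apply/eqP.
  have -> : [fset x | x in D & x \notin mem E]%fset = (D `\` E)%fset.
    by apply/fsetP => x; rewrite !inE andbC.
  apply: eq_fbigr => x; rewrite !inE => /andP[xE _] _.
  by rewrite (negbTE xE).
(* The sums over E and D \ E together are at most the full sum, and E already carries all of it up
   to [e]. *)
have := rsum_ge (E `|` (D `\` E))%fset F0 (l2_sqr_summable f).
rewrite (big_fsetID _ (mem E)) /=.
have -> : [fset x | x in (E `|` (D `\` E)) & x \in mem E]%fset = E.
  by apply/fsetP => x; rewrite !inE; case: (x \in E); rewrite /= ?andbF.
have -> : [fset x | x in (E `|` (D `\` E)) & x \notin mem E]%fset = (D `\` E)%fset.
  by apply/fsetP => x; rewrite !inE; case: (x \in E); rewrite /= ?andbF ?andbT.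
by move: hE; lra.
Qed.

(** The functional vanishes on all truncations, which are dense, and it is continuous by the bound
    [K]. *)
Lemma l2_functional_eq0 (phi : H -> R) (K : R) : {morph phi : f g / f + g} ->
  (forall (r : R) f, phi (r%:C%C *: f) = r * phi f) ->
  (forall f, phi f ^+ 2 <= K * B f f) ->
  (forall x, phi (delta R x) = 0) -> (forall x, phi ('i%C *: delta R x) = 0) ->
  forall f, phi f = 0.
Proof.
move=> phiD phiZ phiK phi0 phii f.
have phi_00 : phi 0 = 0 by have := phiZ 0 0; rewrite mul0r scaler0.
have phitr E c : phi (l2trunc E c) = 0.
  rewrite /l2trunc (big_morph phi phiD phi_00) big1 // => x _.
  rewrite [c x]complexE ['i%C * _]mulrC scalerDl -scalerA phiD !phiZ phi0 phii.
  by rewrite !mulr0 addr0.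
suff : phi f ^+ 2 <= 0.
  by rewrite le_eqVlt ltNge sqr_ge0 orbF expf_eq0 /= => /eqP.
apply/ler_addgt0Pl => e e0; rewrite addr0.
have K1 : 0 < `|K| + 1 by rewrite ltr_wpDl.
have [E hE] := l2trunc_approx f (divr_gt0 e0 K1).
have := phiD (f - l2trunc E (val f)) (l2trunc E (val f)).
rewrite subrK phitr addr0 => ->; apply: le_trans (phiK _) _.
move: hE; rewrite ler_pdivlMr //; have := hil_ge0 HB (f - l2trunc E (val f)).
have := ler_norm K; nra.
Qed.

Lemma bounded_operatorP (T : H -> H) : bounded_operator T <->
  linear T /\ exists2 K : R, 0 <= K & forall f, B (T f) (T f) <= K * B f f.
Proof.
split=> [[lT [M TM]]|[lT [K K0 TK]]]; split=> //.
  exists (M ^+ 2) => [|f]; first exact: sqr_ge0.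
  rewrite -!l2norm_form -exprMn lerXn2r ?nnegrE ?l2norm_ge0 //.
  by apply: le_trans (TM f); exact: l2norm_ge0.
exists (Num.sqrt K) => f.
rewrite -(@ler_pXn2r _ 2) ?nnegrE ?mulr_ge0 ?l2norm_ge0 ?sqrtr_ge0 //.
by rewrite exprMn !l2norm_form sqr_sqrtr.
Qed.

(** The vector S g is given by its coordinates: testing the adjoint relation on delta x and i delta
    x forces them to be [c g x]. It remains to see that they are square-summable and that the
    relation extends from basis vectors to all of l2. *)
Lemma exists_adjoint (T : H -> H) : bounded_operator T ->
  exists2 S : H -> H, bounded_operator S & forall f g, B (T f) g = B f (S g).
Proof.
move=> /bounded_operatorP[lT [K K0 TK]].
have TD : {morph T : f g / f + g} by move=> f g; rewrite -[f]scale1r lT !scale1r.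
have T0 : T 0 = 0 by have := TD 0 0; rewrite addr0 => /esym/(canRL (addrK _)); rewrite subrr.
have TZ a f : T (a *: f) = a *: T f by rewrite -[_ *: f]addr0 lT T0 addr0.
pose c g x : C := (B g (T (delta R x)) +i* B g (T ('i%C *: delta R x)))%C.
have BTc g (E : {fset X}) : B g (T (l2trunc E (c g))) = \sum_(x <- E) redot (c g x) (c g x).
  rewrite /l2trunc (big_morph T TD T0).
  rewrite (big_morph (B g) (hilDr HB g) (hil0r HB g)); apply: eq_bigr => x _.
  rewrite TZ [c g x in LHS]complexE ['i%C * _]mulrC scalerDl -scalerA (hilDr HB) !(hilZr HB).
  by rewrite -TZ.
(* If v is the truncation of [c g] to E and s the sum in question, then s = <g, T v> and |v|^2 <= s.
   Cauchy-Schwarz gives s^2 <= |g|^2 K s, and one divides by s. *)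
have cE g (E : {fset X}) : \sum_(x <- E) redot (c g x) (c g x) <= K * B g g.
  set s := \sum_(x <- E) _.
  have s0 : 0 <= s by apply: sumr_ge0 => x _; exact: redot_ge0.
  have trs : B (l2trunc E (c g)) (l2trunc E (c g)) <= s.
    apply: rsum_le => [x|D]; first exact: redot_ge0.
    have eF x : redot (val (l2trunc E (c g)) x) (val (l2trunc E (c g)) x) =
        if x \in E then redot (c g x) (c g x) else 0.
      by rewrite val_l2trunc; case: ifP => // _; rewrite /redot !mul0r addr0.
    rewrite (eq_bigr _ (fun x _ => eF x)).
    rewrite (big_fsetID _ (mem E)) /= [X in _ + X]big1_fset ?addr0; last first.
      by move=> x; rewrite !inE => /andP[_ /negbTE ->].
    rewrite /s (big_fsetID _ (mem D) E) /=.
    have -> : [fset x | x in D & x \in mem E]%fset = [fset x | x in E & x \in mem D]%fset.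
      by apply/fsetP => x; rewrite !inE andbC.
    rewrite -[leLHS]addr0; apply: lerD; last by apply: sumr_ge0 => x _; exact: redot_ge0.
    rewrite le_eqVlt; apply/orP; left; apply/eqP; apply: eq_fbigr => x.
    by rewrite !inE => /andP[-> _].
  have := hil_CS HB g (T (l2trunc E (c g))); rewrite BTc -/s => h1.
  have h2 := TK (l2trunc E (c g)).
  have h3 := hil_ge0 HB g.
  have [->|sN0] := eqVneq s 0; first by rewrite mulr_ge0.
  have s1 : 0 < s by rewrite lt_def sN0.
  rewrite -(ler_pM2l s1) -expr2; apply: le_trans h1 _.
  apply: le_trans (ler_wpM2l h3 h2) _.
  by rewrite (_ : s * (K * B g g) = B g g * (K * s)) ?ler_wpM2l //; ring.
have cl2 g : c g \in @square_summable R X.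
  rewrite in_l2E; apply: (abs_summable_bound (M := K * B g g)) => [x|E].
    exact: redot_ge0.
  exact: cE.
pose S g : H := l2_of (cl2 g).
have SK g : B (S g) (S g) <= K * B g g by apply: rsum_le => [x|E]; [exact: redot_ge0|exact: cE].
have adj f g : B (T f) g = B f (S g).
  apply/eqP; rewrite -subr_eq0; apply/eqP.
  (* Both terms have square at most K |g|^2 |f|^2, and (p - q)^2 <= 2 p^2 + 2 q^2, whence the factor
     4. *)
  apply: (@l2_functional_eq0 (fun f => B (T f) g - B f (S g)) (4 * K * B g g)).
  - by move=> u v; rewrite TD !(hilDl HB); ring.
  - by move=> r u; rewrite TZ !(hilZl HB); ring.
  - move=> u; have := hil_CS HB (T u) g; have := hil_CS HB u (S g).
    have := TK u; have := SK g; have := hil_ge0 HB u; have := hil_ge0 HB g.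
    set p := B (T u) g; set q := B u (S g) => ? ? h1 h2 h3 h4.
    have h5 : q ^+ 2 <= K * B g g * B u u.
      by apply: le_trans h3 _; rewrite mulrC ler_wpM2r.
    have h6 : p ^+ 2 <= K * B g g * B u u.
      by apply: le_trans h4 _; rewrite mulrAC ler_wpM2r.
    have := sqr_ge0 (p + q); nra.
  - move=> x; rewrite l2form_delta (hilC HB) SubK /=; exact: subrr.
  - move=> x; rewrite l2form_idelta (hilC HB) SubK /=; exact: subrr.
exists S => //; apply/bounded_operatorP; split; last by exists K.
move=> a f g; apply: (hil_ext HB) => w.
have adj' u v : B (S u) v = B u (T v) by rewrite (hilC HB) -adj (hilC HB).
by rewrite adj' !(hilDl HB) !(hilZ_conj HB) !adj' TZ.
Qed.

End Adjoint.

(** * The group von Neumann algebra *)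

Section LinearFunctions.
Variables (A : pzRingType) (V W : lmodType A) (T : V -> W).
Hypothesis lT : linear T.

Lemma linear0_fun : T 0 = 0.
Proof. by have := lT (-1) 0 0; rewrite scaler0 addr0 scaleN1r addNr. Qed.

Lemma linearD_fun u v : T (u + v) = T u + T v.
Proof. by rewrite -[u]scale1r lT !scale1r. Qed.

Lemma linearZ_fun a u : T (a *: u) = a *: T u.
Proof. by rewrite -[_ *: u]addr0 lT linear0_fun addr0. Qed.

Lemma linearB_fun u v : T (u - v) = T u - T v.
Proof. by rewrite linearD_fun -scaleN1r linearZ_fun scaleN1r. Qed.
End LinearFunctions.

(** * Right translations, the commutation theorem and the trace *)

Section RightTranslations.
Variables (R : realType) (G : groupType).
Local Notation C := R[i].
Local Notation H := (l2 R G).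
Local Notation LG := (groupVN R G).
Local Notation B := (@l2form R G).
Local Notation HB := (@l2form_hilbert R G).
Implicit Types (f h : H) (g k : G) (x y t s : LG).

Lemma mulg_bij g : bijective (fun k : G => (k * g)%g).
Proof. by exists (fun k => k * g^-1)%g => k; rewrite ?mulgK ?mulgVK. Qed.

Fact right_translate_in g f : (fun k => val f (k * g)%g) \in @square_summable R G.
Proof.
rewrite in_l2E; exact: (abs_summable_reindex (mulg_bij g) (l2_sqr_summable f)).
Qed.

Definition right_translate g f : H := l2_of (right_translate_in g f).

Lemma right_translate_linear g : linear (right_translate g).
Proof. by move=> a f h; apply: l2_eq. Qed.

Lemma right_translate_form g f h : B (right_translate g f) (right_translate g h) = B f h.
Proof. by rewrite /l2form [RHS](rsum_reindex _ (mulg_bij g)). Qed.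

Lemma right_translate_bounded g : bounded_operator (right_translate g).
Proof.
apply/bounded_operatorP; split; first exact: right_translate_linear.
by exists 1 => // f; rewrite mul1r right_translate_form.
Qed.

Lemma right_translateM g k f :
  right_translate g (right_translate k f) = right_translate (g * k)%g f.
Proof. by apply: l2_eq => z /=; rewrite mulgA. Qed.

Lemma right_translate1 f : right_translate 1%g f = f.
Proof. by apply: l2_eq => z /=; rewrite mulg1. Qed.

Lemma right_translate_delta g k :
  right_translate g (delta R k) = delta R (k * g^-1)%g.
Proof.
apply: l2_eq => z /=; congr (_%:R); congr nat_of_bool.
by apply/eqP/eqP => [<-|->]; rewrite ?mulgK ?mulgVK.
Qed.

Lemma left_regular_delta g k : left_regular g (delta R k) = delta R (g * k)%g.
Proof.
apply: l2_eq => z /=; congr (_%:R); congr nat_of_bool.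
by apply/eqP/eqP => [<-|->]; rewrite ?mulVKg ?mulKg.
Qed.

Lemma groupVN_right x g f : val x (right_translate g f) = right_translate g (val x f).
Proof.
have /asboolP[_ cx] := valP x.
have := cx (right_translate g); apply: (fun p q => congr1 (fun T : H -> H => T f) (q p)).
split; first exact: right_translate_bounded.
move=> _ [k _ <-]; apply/funext => h; apply: l2_eq => z /=.
by rewrite mulgA.
Qed.

Definition right_equivariant (T : H -> H) :=
  forall g f, T (right_translate g f) = right_translate g (T f).

Lemma right_equivariant_coef (T : H -> H) g k : right_equivariant T ->
  val (T (delta R k)) g = val (T (delta R 1%g)) (g * k^-1)%g.
Proof.
by move=> eT; have := right_translate_delta k^-1 1; rewrite invgK mul1g => <-; rewrite eT.
Qed.

Lemma adjoint_coef (T S : H -> H) g k :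
  linear T -> (forall f h, B (T f) h = B f (S h)) ->
  val (S (delta R g)) k = ((val (T (delta R k)) g)^*)%C.
Proof.
move=> lT adj.
apply/eqP; rewrite eq_complex; apply/andP; split; apply/eqP.
  by rewrite -l2form_delta -adj (hilC HB) l2form_delta; case: (val _ _).
rewrite -l2form_idelta -adj (hilC HB) l2form_delta (linearZ_fun lT) l2valZ.
by case: (val _ _) => a b /=; ring.
Qed.

(** Right translations are unitary, with the translation by g^-1 as adjoint, so commuting with all
    of them passes to adjoints. *)
Lemma adjoint_right_equivariant (T S : H -> H) :
  (forall f h, B (T f) h = B f (S h)) -> right_equivariant T -> right_equivariant S.
Proof.
move=> adj eT g f; apply: (hil_ext HB) => h.
rewrite (hilC HB) -adj -[T h]right_translate1 -(mulgV g) -right_translateM.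
rewrite right_translate_form -eT adj -[LHS](right_translate_form g) right_translateM.
by rewrite mulgV right_translate1 (hilC HB).
Qed.

Lemma redot_conj (a b : C) : redot (a^*)%C b = complex.Re (a * b).
Proof. by case: a b => a a' [b b']; rewrite /redot /=; ring. Qed.

(* Tf is the convolution (T delta_1) * f and Sf is f * (S delta_1), so the two
   operators commute by associativity. *)
Lemma convolution_commute_re (T S : H -> H) g k :
  bounded_operator T -> bounded_operator S -> right_equivariant T ->
  (forall g f, S (left_regular g f) = left_regular g (S f)) ->
  B (delta R g) (T (S (delta R k))) = B (delta R g) (S (T (delta R k))).
Proof.
move=> bT bS eT eS.
have [T' _ adjT] := exists_adjoint bT; have [S' _ adjS] := exists_adjoint bS.
have [lT _] := bT; have [lS _] := bS.
rewrite (hilC HB) adjT (hilC HB) [RHS](hilC HB) adjS [RHS](hilC HB).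
have eS' (h z : G) : val (S (delta R h)) z = val (S (delta R 1%g)) (h^-1 * z)%g.
  by have := left_regular_delta h 1; rewrite mulg1 => <-; rewrite eS.
(* The substitution h -> k h^-1 g matches the two convolution sums term by term. *)
have bj : bijective (fun h : G => k * h^-1 * g)%g.
  have c : cancel (fun h : G => k * h^-1 * g)%g (fun h : G => g * h^-1 * k)%g.
    by move=> h; rewrite !invgM invgK !mulgA mulgV mul1g mulgVK.
  exists (fun h : G => g * h^-1 * k)%g => //.
  by move=> h; rewrite !invgM invgK !mulgA mulgV mul1g mulgVK.
rewrite /l2form (rsum_reindex _ bj); congr rsum; apply/funext => h /=.
rewrite !(adjoint_coef _ _ _ adjT) // !(adjoint_coef _ _ _ adjS) // !redot_conj.
rewrite (right_equivariant_coef g _ eT) (right_equivariant_coef h _ eT).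
rewrite (eS' k) (eS' h) mulrC.
rewrite (_ : (k^-1 * (k * h^-1 * g) = h^-1 * g)%g); last by rewrite -mulgA mulKg.
rewrite (_ : (g * (k * h^-1 * g)^-1 = h * k^-1)%g) //.
by rewrite !invgM invgK mulVKg.
Qed.

(** The bicommutant of the left regular representation is the commutant of the right translations.
    For the nontrivial inclusion, [T] must commute with every [S] commuting with left translations:
    [convolution_commute_re] settles this on basis vectors, and boundedness extends it. *)
Lemma groupVNP (T : H -> H) :
  T \in groupVN_pred (G := G) (R := R) <-> bounded_operator T /\ right_equivariant T.
Proof.
split=> [inT|[bT eT]].
  split; first by have /asboolP[] := inT.
  exact: (@groupVN_right (Sub T inT)).
apply/asboolP; split=> // S [bS cS].
have eS g f : S (left_regular g f) = left_regular g (S f).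
  by have := cS (left_regular g) (ex_intro2 _ _ g I erefl) => /(congr1 (fun T => T f)).
have [lT _] := bT; have [lS _] := bS.
have bdi : bounded_operator (fun f : H => 'i%C *: f).
  apply/bounded_operatorP; split=> [a f h|].
    by rewrite scalerDr !scalerA mulrC.
  by exists 1 => // f; rewrite mul1r (hil_i HB).
have re f g : B (delta R g) (T (S f)) = B (delta R g) (S (T f)).
  have [l1 [K1 K10 h1]] := (bounded_operatorP _).1 (bounded_operator_comp bT bS).
  have [l2 [K2 K20 h2]] := (bounded_operatorP _).1 (bounded_operator_comp bS bT).
  apply/eqP; rewrite -subr_eq0; apply/eqP.
  pose D := B (delta R g) (delta R g).
  apply: (@l2_functional_eq0 _ _
    (fun f => B (delta R g) (T (S f)) - B (delta R g) (S (T f))) (2 * (K1 + K2) * D)).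
  - move=> u v; rewrite !(linearD_fun lT) !(linearD_fun lS) !(linearD_fun lT).
    by rewrite !(hilDr HB); ring.
  - move=> r u; rewrite !(linearZ_fun lT) !(linearZ_fun lS) !(linearZ_fun lT).
    by rewrite !(hilZr HB); ring.
  - move=> u; have := h1 u; have := h2 u => /=.
    have := hil_CS HB (delta R g) (T (S u)); have := hil_CS HB (delta R g) (S (T u)).
    have := hil_ge0 HB u; have := hil_ge0 HB (delta R g); rewrite -/D.
    set p := B _ (T _); set q := B _ (S _) => D0 u0 hq hp k2 k1.
    have hq' : q ^+ 2 <= D * (K2 * B u u) by apply: le_trans hq _; rewrite ler_wpM2l.
    have hp' : p ^+ 2 <= D * (K1 * B u u) by apply: le_trans hp _; rewrite ler_wpM2l.
    have := sqr_ge0 (p + q); nra.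
  - move=> k; rewrite (convolution_commute_re g k bT bS eT eS). by rewrite subrr.
  (* For i delta k, the operator S is replaced by S composed with multiplication by i, which still
     commutes with left translations. *)
  - move=> k; rewrite (linearZ_fun lT).
    have := @convolution_commute_re T (S \o (fun f => 'i%C *: f)) g k bT
      (bounded_operator_comp bS bdi) eT.
    move=> /= ->; first by rewrite subrr.
    move=> g' f' /=; rewrite -eS; congr S.
    by rewrite -[LHS]addr0 -[_ *: f']addr0 (left_regular_linear g' 'i%C f' 0)
         (linear0_fun (left_regular_linear g')) !addr0.
apply/funext => f /=; apply: l2form_ext => g; first exact: re.
rewrite !(hil_iN HB) -!(linearZ_fun lT) -!(linearZ_fun lS) -!(linearZ_fun lT).
by rewrite re.
Qed.

Definition trace x : R := B (val x (delta R 1%g)) (delta R 1%g).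

Lemma exists_star x : exists y, forall f h, B (val x f) h = B f (val y h).
Proof.
have /groupVNP[bx ex] := valP x; have [S bS adj] := exists_adjoint bx.
have inS : S \in groupVN_pred (G := G) (R := R).
  by apply/groupVNP; split=> //; exact: adjoint_right_equivariant adj ex.
by exists (Sub S inS).
Qed.

(** With a = u delta_1 and b = v delta_1, the trace of u v is the real part of the sum of a(h^-1)
    b(h), which is symmetric under h -> h^-1. *)
Lemma trace_mulC x y : trace (x * y) = trace (y * x).
Proof.
have tr (u v : LG) : trace (u * v) =
    rsum (fun h : G => complex.Re (val (val u (delta R 1%g)) h^-1%g * val (val v (delta R 1%g)) h)).
  have [u' adj] := exists_star u.
  rewrite /trace -[val (u * v) _]/(val u (val v _)) adj (hilC HB).
  rewrite /l2form; congr rsum; apply/funext => h.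
  rewrite (adjoint_coef _ _ (groupVN_linear u) adj) redot_conj.
  by rewrite (right_equivariant_coef _ _ (groupVN_right u)) mul1g.
have bV : bijective (fun k : G => k^-1)%g by exists (fun k : G => k^-1)%g; exact: invgK.
rewrite !tr (rsum_reindex _ bV); congr rsum; apply/funext => h /=.
by rewrite invgK mulrC.
Qed.

(** The vector [delta R 1] is separating: [x] commutes with right translations, so it kills every
    [delta R k]. Then all coordinates of adjoint images vanish, hence so does [x]. *)
Lemma groupVN_delta_inj x : val x (delta R 1%g) = 0 -> x = 0.
Proof.
move=> x0; have [y adj] := exists_star x.
have xk k : val x (delta R k) = 0.
  have := right_translate_delta k^-1 1; rewrite invgK mul1g => <-.
  by rewrite groupVN_right x0 (linear0_fun (right_translate_linear _)).
apply/val_inj/funext => f.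
apply: (hil_ext HB) => h; rewrite adj (hil0l HB).
rewrite (_ : val y h = 0) ?(hil0r HB) //.
apply: l2form_ext => k; rewrite (hil0r HB) -adj.
  by rewrite xk (hil0l HB).
by rewrite (linearZ_fun (groupVN_linear x)) xk scaler0 (hil0l HB).
Qed.

End RightTranslations.

(** * Rank-nullity and the Ore condition *)

Section Ore.
Variables (R : realType) (G : groupType).
Local Notation C := R[i].
Local Notation H := (l2 R G).
Local Notation LG := (groupVN R G).
Local Notation B := (@l2form R G).
Local Notation HB := (@l2form_hilbert R G).
Local Notation B2 := (prod_form B B).
Local Notation HB2 := (prod_form_hilbert HB HB).
Local Notation d := (delta R (1%g : G)).
Implicit Types (f h : H) (v w : H * H) (x y t s : LG).

Definition nonsingular x := forall f, val x f = 0 -> f = 0.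

Definition adjoint_of x y := forall f h, B (val x f) h = B f (val y h).

Lemma adjoint_ofC x y : adjoint_of x y -> adjoint_of y x.
Proof. by move=> a f h; rewrite (hilC HB) -a (hilC HB). Qed.

Lemma adjoint_ofM x x' y y' :
  adjoint_of x x' -> adjoint_of y y' -> adjoint_of (x * y) (y' * x').
Proof. by move=> ax ay f h; rewrite -[val (x * y) f]/(val x (val y f)) ax ay. Qed.

Definition translate2 g v : H * H := (right_translate g v.1, right_translate g v.2).

Definition column x y f : H * H := (val x f, val y f).

Section Rank.
Variables x s x' s' : LG.
Hypothesis ax : adjoint_of x x'.
Hypothesis as_ : adjoint_of s s'.
Hypothesis contr : forall f, B2 (column x s f) (column x s f) <= B f f.

Let F := column x s.
Let F' v : H := val x' v.1 + val s' v.2.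

Let adjF f v : B2 (F f) v = B f (F' v).
Proof. by rewrite /prod_form /= ax as_ (hilDr HB). Qed.

Let linF : linear F.
Proof. by move=> a f h; rewrite /F /column !groupVN_linear. Qed.

Let linF' : linear F'.
Proof.
move=> a f h; rewrite /F' /= !groupVN_linear scalerDr addrACA //.
Qed.

(** The adjoint of a contraction is a contraction: |F'v|^2 = <FF'v, v> is at most |F'v| |v|. *)
Let contr' v : B (F' v) (F' v) <= B2 v v.
Proof.
have := hil_CS HB2 (F (F' v)) v; rewrite adjF.
have := contr (F' v); rewrite -/F; have := hil_ge0 HB2 v.
have := hil_ge0 HB (F' v); have := hil_ge0 HB2 (F (F' v)).
set p := B _ _; set q := B2 _ _; set r := B2 v v => q0 p0 r0 qp h.
have [->|pN0] := eqVneq p 0; first by [].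
have p1 : 0 < p by rewrite lt_def pN0.
rewrite -(ler_pM2l p1) -expr2; apply: le_trans h _; exact: ler_wpM2r.
Qed.

Let A1 f := F' (F f).
Let A2 v := F (F' v).

(* With F = column x s and F' its adjoint, q and p are the projections onto
   ker F' and ker F, and the last equation reads tr q - tr p = 2 - 1.  It passes
   to the limit from tr (1 - FF')^n - tr (1 - F'F)^n = 1, where the difference
   does not depend on n because the trace is tracial. *)
Lemma rank_nullity : exists (q : H * H -> H * H) (p : H -> H),
  [/\ [/\ linear q, forall v w, B2 (q v) w = B2 v (q w),
          forall g v, q (translate2 g v) = translate2 g (q v),
          forall v, val x' (q v).1 + val s' (q v).2 = 0
        & forall v, val x' v.1 + val s' v.2 = 0 -> q v = v],
      [/\ linear p, forall f h, B (p f) h = B f (p h),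
          forall g f, p (right_translate g f) = right_translate g (p f),
          forall f, column x s (p f) = 0
        & forall f, column x s f = 0 -> p f = f]
    & B2 (q (d, 0)) (d, 0) + B2 (q (0, d)) (0, d) - B (p d) d = 1].
Proof.
(* Since <FF'v, v> = |F'v|^2, the kernel of FF' is that of F'; likewise for F'F and F. The
   projections therefore come from [kernel_projection] applied to FF' and F'F. *)
have F'0 v : A2 v = 0 -> F' v = 0.
  by move=> A20; apply: (hil_def HB); rewrite -adjF -/(A2 v) A20 (hil0l HB2).
have F0 f : A1 f = 0 -> F f = 0.
  by move=> A10; apply: (hil_def HB2); rewrite adjF -/(A1 f) A10 (hil0r HB).
have [||v|q [qc ql qs q0 q1]] := @kernel_projection _ _ B2 HB2 A2.
- by move=> a v w; rewrite /A2 linF' linF.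
- by move=> v w; rewrite /A2 adjF [RHS](hilC HB2) adjF (hilC HB).
- by rewrite /A2 [leRHS]adjF; exact: contr.
have [||f|p [pc pl ps p0 p1]] := @kernel_projection _ _ B HB A1.
- by move=> a v w; rewrite /A1 linF linF'.
- by move=> f h; rewrite /A1 -adjF [LHS](hilC HB) -adjF (hilC HB2).
- by rewrite /A1 [leRHS](hilC HB) -[leRHS]adjF; exact: contr'.
have FR g f : F (right_translate g f) = translate2 g (F f).
  by rewrite /F /column !groupVN_right.
have F'R g v : F' (translate2 g v) = right_translate g (F' v).
  by rewrite /F' /= !groupVN_right (linearD_fun (right_translate_linear g)).
have trB g v w : translate2 g (v - w) = translate2 g v - translate2 g w.
  by rewrite /translate2 /= !(linearB_fun (right_translate_linear g)).
have trform g v : B2 (translate2 g v) (translate2 g v) = B2 v v.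
  by rewrite /prod_form /= !right_translate_form.
exists q, p; split.
- split=> //.
  + move=> g v; apply: (hcvg_unique HB2 (qc _)).
    have {}h := @hcvg_lin _ _ _ HB2 (translate2 g) _ _ 1 ler01 (trB g) _ (qc v).
    apply: (hcvg_ext _ (h _)) => [n|w]; last by rewrite mul1r trform.
    by elim: n => //= n <-; rewrite trB /A2 F'R FR.
  + by move=> v; exact: F'0.
  + move=> v v0; apply: q1; rewrite /A2 /F' v0.
    exact: linear0_fun linF.
- split=> //.
  + move=> g v; apply: (hcvg_unique HB (pc _)).
    have {}h := @hcvg_lin _ _ _ HB (right_translate g) _ _ 1 ler01
      (linearB_fun (right_translate_linear g)) _ (pc v).
    apply: (hcvg_ext _ (h _)) => [n|w]; last by rewrite mul1r right_translate_form.
    elim: n => //= n <-.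
    by rewrite (linearB_fun (right_translate_linear g)) /A1 FR F'R.
  + by move=> f; exact: F0.
  + by move=> f f0; apply: p1; rewrite /A1 /F f0; exact: linear0_fun linF'.
pose a : LG := 1 - (x' * x + s' * s).
have mulE (u v : LG) f : val (u * v) f = val u (val v f) by [].
have aE f : val a f = f - A1 f by [].
have iter1 n f : iter n (fun f => f - A1 f) f = val (a ^+ n) f.
  by elim: n => //= n ->; rewrite exprS mulE aE.
have aF' v : F' (v - A2 v) = val a (F' v).
  by rewrite (linearB_fun linF') aE.
(* From F'(1 - FF') = (1 - F'F)F' one gets FF'(1 - FF')^n = F (1 - F'F)^n F', whose diagonal entries
   are products in the group von Neumann algebra. *)
have iter2 n v : A2 (iter n (fun v => v - A2 v) v) = F (val (a ^+ n) (F' v)).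
  by rewrite /A2; congr F; elim: n => //= n IH; rewrite exprS aF' IH mulE.
have tr2 n : B2 (iter n (fun v => v - A2 v) (d, 0)) (d, 0) +
             B2 (iter n (fun v => v - A2 v) (0, d)) (0, d) - trace (a ^+ n) = 1.
  elim: n => [|n IH].
    rewrite /= /prod_form /= expr0 /trace !(hil0l HB) addr0 add0r.
    by rewrite addrK l2form_delta /= eqxx.
  have F'l : F' (d, 0) = val x' d.
    by rewrite /F' /= (linear0_fun (groupVN_linear s')) addr0.
  have F'r : F' (0, d) = val s' d.
    by rewrite /F' /= (linear0_fun (groupVN_linear x')) add0r.
  rewrite /= !(hilBl HB2) !iter2 F'l F'r.
  have -> : B2 (F (val (a ^+ n) (val x' d))) (d, 0) = trace (x * (a ^+ n * x')).
    by rewrite /prod_form /= (hil0r HB) addr0.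
  have -> : B2 (F (val (a ^+ n) (val s' d))) (0, d) = trace (s * (a ^+ n * s')).
    by rewrite /prod_form /= (hil0r HB) add0r.
  (* By traciality the two diagonal terms decrease by tr(a^n x'x) and tr(a^n s's), whose sum is
     exactly the decrease of tr(a^n). *)
  rewrite (trace_mulC x) (trace_mulC s) -!mulrA.
  have trD (u v : LG) : trace (u + v) = trace u + trace v.
    by rewrite /trace -(hilDl HB).
  have : trace (a ^+ n) - trace (a ^+ n.+1) =
      trace (a ^+ n * (x' * x)) + trace (a ^+ n * (s' * s)).
    set b := x' * x + s' * s.
    rewrite -trD -mulrDr -/b exprSr mulrBr mulr1.
    by rewrite -{1}(subrK (a ^+ n * b) (a ^+ n)) trD addrAC subrr add0r.
  move: IH; set u := B2 _ _; set u' := B2 _ _; set t1 := trace (a ^+ n * _).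
  by set t2 := trace (a ^+ n * _); lra.
apply: (rcvg_unique _ (rcvg_cst 1)).
have h := rcvgB (rcvgD (hcvg_weak HB2 (d, 0) (qc (d, 0))) (hcvg_weak HB2 (0, d) (qc (0, d))))
  (hcvg_weak HB d (pc d)).
move=> e /h [n0 h0]; exists n0 => n /h0.
by rewrite iter1 -/(trace _) tr2 distrC.
Qed.

End Rank.

Lemma in_groupVN (T : H -> H) : linear T ->
  (exists2 K : R, 0 <= K & forall f, B (T f) (T f) <= K * B f f) ->
  right_equivariant T -> exists x, forall f, val x f = T f.
Proof.
move=> lT bT eT; have inT : T \in groupVN_pred (G := G) (R := R).
  by apply/groupVNP; split=> //; apply/bounded_operatorP.
by exists (Sub T inT).
Qed.

Lemma groupVN_bound x : exists2 K : R, 0 <= K & forall f, B (val x f) (val x f) <= K * B f f.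
Proof. by have /groupVNP[/bounded_operatorP[]] := valP x. Qed.

Lemma groupVN_scale x (c : R) : exists y, forall f, val y f = c%:C%C *: val x f.
Proof.
apply: in_groupVN => [a f h||g f].
- by rewrite groupVN_linear scalerDr !scalerA mulrC.
- have [K K0 xK] := groupVN_bound x.
  exists (c ^+ 2 * K) => [|f]; first by rewrite mulr_ge0 ?sqr_ge0.
  rewrite (hilZl HB) (hilZr HB) mulrA -expr2 -mulrA.
  by rewrite ler_wpM2l ?sqr_ge0.
- by rewrite groupVN_right (linearZ_fun (right_translate_linear g)).
Qed.

(** [rank_nullity] requires a contraction; a positive scalar achieves this without changing any
    kernel. If K and L bound the two squared norms, c = 1 / (K + L + 1) works because K + L <= (K +
    L + 1)^2. *)
Lemma column_scale x s : exists2 c : R, 0 < c & forall y t,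
  (forall f, val y f = c%:C%C *: val x f) -> (forall f, val t f = c%:C%C *: val s f) ->
  forall f, B2 (column y t f) (column y t f) <= B f f.
Proof.
have [K K0 xK] := groupVN_bound x; have [L L0 sL] := groupVN_bound s.
have k0 : 0 < K + L + 1 by rewrite ltr_wpDl // addr_ge0.
exists (K + L + 1)^-1 => [|y t yx ts f]; first by rewrite invr_gt0.
set c := (K + L + 1)^-1.
rewrite /column yx ts /prod_form /= !(hilZl HB) !(hilZr HB) !mulrA -!expr2 -mulrDr.
have c1 : c ^+ 2 * (K + L + 1) ^+ 2 = 1.
  by rewrite -exprMn mulVf ?expr1n // gt_eqF.
have := xK f; have := sL f; have f0 := hil_ge0 HB f.
set p := B (val s f) _; set q := B (val x f) _ => hp hq.
have c0 : 0 <= c ^+ 2 by exact: sqr_ge0.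
apply: (@le_trans _ _ (c ^+ 2 * ((K + L) * B f f))).
  by rewrite ler_wpM2l // mulrDl lerD.
rewrite mulrA -[leRHS]mul1r ler_wpM2r // -c1 ler_wpM2l //; nra.
Qed.

Lemma adjoint_scale x x' y y' (c : R) :
  (forall f, val y f = c%:C%C *: val x f) ->
  (forall f, val y' f = c%:C%C *: val x' f) ->
  adjoint_of x x' -> adjoint_of y y'.
Proof. by move=> yE y'E a f h; rewrite yE y'E (hilZl HB) (hilZr HB) a. Qed.

Lemma scale_eq0 (V : lmodType C) (c : R) (u : V) : 0 < c -> c%:C%C *: u = 0 -> u = 0.
Proof.
move=> c0 /eqP; rewrite scaler_eq0 => /orP[/eqP[] c00|/eqP//].
by rewrite c00 ltxx in c0.
Qed.

Lemma symmetric_projection_contr (V : lmodType C) (BV : V -> V -> R) (q : V -> V) :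
  hilbert BV -> (forall v w : V, BV (q v) w = BV v (q w)) ->
  (forall v : V, q (q v) = q v) ->
  forall v : V, BV (q v) (q v) <= BV v v.
Proof.
move=> HV qs qq v; have e : BV (q v) (q v) = BV (q v) v by rewrite qs qq [RHS]qs.
have := hil_CS HV (q v) v; rewrite -e.
have := hil_ge0 HV v; have := hil_ge0 HV (q v).
set p := BV (q v) _ => p0 v0 h.
have [->|pN0] := eqVneq p 0; first by [].
by rewrite -(ler_pM2l (_ : 0 < p)) -?expr2 // lt_def pN0.
Qed.

Section Entries.
Variable q : H * H -> H * H.
Hypothesis ql : linear q.
Hypothesis qs : forall v w, B2 (q v) w = B2 v (q w).
Hypothesis qR : forall g v, q (translate2 g v) = translate2 g (q v).
Hypothesis qq : forall v, q (q v) = q v.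

Let pairl (a : C) f h : (a *: f + h, 0) = a *: (f, 0) + (h, 0) :> H * H.
Proof. by congr (_, _); rewrite /= scaler0 addr0. Qed.
Let pairr (a : C) f h : (0, a *: f + h) = a *: (0, f) + (0, h) :> H * H.
Proof. by congr (_, _); rewrite /= scaler0 addr0. Qed.

(** As a 2 x 2 matrix, q has first row (a, b) and first column (a, c). Its entries commute with
    right translations because q does, and symmetry of q makes a self-adjoint and b the adjoint of
    c. *)
Lemma projection_entries : exists a b c : LG,
  [/\ forall f, q (f, 0) = (val a f, val c f),
      forall f, (q (0, f)).1 = val b f, adjoint_of a a & adjoint_of c b].
Proof.
have qb := symmetric_projection_contr HB2 qs qq.
have tr0 g : right_translate g (0 : H) = 0 by exact: (linear0_fun (right_translate_linear g)).
have nl f : B2 (f, 0) (f, 0) = B f f by rewrite /prod_form /= (hil0l HB) addr0.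
have nr f : B2 (0, f) (0, f) = B f f by rewrite /prod_form /= (hil0l HB) add0r.
have [|||a aE] := @in_groupVN (fun f => (q (f, 0)).1).
- by move=> c f h; rewrite pairl ql.
- exists 1 => // f; rewrite mul1r -(nl f); apply: le_trans (qb _).
  by rewrite /prod_form lerDl (hil_ge0 HB).
- by move=> g f; rewrite -[in LHS](tr0 g) -[(right_translate g f, _)]/(translate2 g (f, 0)) qR.
have [|||c cE] := @in_groupVN (fun f => (q (f, 0)).2).
- by move=> c f h; rewrite pairl ql.
- exists 1 => // f; rewrite mul1r -(nl f); apply: le_trans (qb _).
  by rewrite /prod_form lerDr (hil_ge0 HB).
- by move=> g f; rewrite -[in LHS](tr0 g) -[(right_translate g f, _)]/(translate2 g (f, 0)) qR.
have [|||b bE] := @in_groupVN (fun f => (q (0, f)).1).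
- by move=> u f h; rewrite pairr ql.
- exists 1 => // f; rewrite mul1r -(nr f); apply: le_trans (qb _).
  by rewrite /prod_form lerDl (hil_ge0 HB).
- by move=> g f; rewrite -[in LHS](tr0 g) -[(_, right_translate g f)]/(translate2 g (0, f)) qR.
exists a, b, c; split=> [f|f|f h|f h].
- by rewrite aE cE -surjective_pairing.
- by rewrite bE.
- have := qs (f, 0) (h, 0); rewrite /prod_form /= (hil0r HB) (hil0l HB) !addr0.
  by rewrite !aE.
- have := qs (f, 0) (0, h); rewrite /prod_form /= (hil0r HB) (hil0l HB) addr0 add0r.
  by rewrite !cE !bE.
Qed.

End Entries.

Lemma delta_norm : B d d = 1.
Proof. by rewrite l2form_delta /= eqxx. Qed.

(** Rank-nullity is applied to a multiple of the column (x, 0). Its kernel is 0, and the kernel of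
    its adjoint is ker x' plus the whole second summand, which already has trace 1. So the
    projection onto ker x' has trace 0, and [delta] being separating makes it 0. *)
Lemma nonsingular_adjoint x x' : adjoint_of x x' -> nonsingular x -> nonsingular x'.
Proof.
move=> ax nx.
have [c c0 cP] := column_scale x 0.
have [y yE] := groupVN_scale x c; have [y' y'E] := groupVN_scale x' c.
have a0 : adjoint_of 0 0 by move=> f h; rewrite /= (hil0l HB) (hil0r HB).
have z0 f : val (0 : LG) f = c%:C%C *: val (0 : LG) f by rewrite /= scaler0.
have [q [p [[ql qs qR q0 q1] [_ _ _ p0 _] tr]]] :=
  rank_nullity (adjoint_scale yE y'E ax) a0 (cP _ _ yE z0).
have pd : p d = 0.
  by apply: nx; apply: (scale_eq0 c0); rewrite -yE; exact: (congr1 (fun v : H * H => v.1) (p0 d)).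
have qd : q (0, d) = (0, d).
  by apply: q1; rewrite /= (linear0_fun (groupVN_linear y')) addr0.
have qq v : q (q v) = q v by apply: q1; exact: q0.
have [a [? [c' [aE _ aa _]]]] := projection_entries ql qs qR qq.
have ad : val a d = 0.
  have e : B2 (q (d, 0)) (d, 0) = B (val a d) (val a d) + B (val c' d) (val c' d).
    rewrite (_ : B2 (q (d, 0)) (d, 0) = B2 (q (d, 0)) (q (d, 0))); last first.
      by rewrite [RHS]qs qq [LHS]qs.
    by rewrite aE.
  apply: (hil_def HB); move: tr; rewrite pd (hil0l HB) qd e.
  have -> : B2 (0, d) (0, d) = 1 by rewrite /prod_form /= (hil0l HB) add0r delta_norm.
  have := hil_ge0 HB (val a d); have := hil_ge0 HB (val c' d).
  by set u := B _ _; set v := B _ _; lra.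
have a00 := groupVN_delta_inj ad.
move=> f f0; have : q (f, 0) = (f, 0).
  by apply: q1; rewrite /= y'E f0 scaler0 addr0.
by rewrite aE a00 => -[<-].
Qed.

Lemma nonsingularM x y : nonsingular x -> nonsingular y -> nonsingular (x * y).
Proof. by move=> nx ny f /nx /ny. Qed.

Lemma nonsingular1 : nonsingular 1. Proof. by []. Qed.

Lemma nonsingular_mulr x y : nonsingular (x * y) -> nonsingular y.
Proof.
move=> nxy f yf; apply: nxy; rewrite -[val (x * y) f]/(val x (val y f)) yf.
exact: linear0_fun (groupVN_linear x).
Qed.

(* This is where finiteness of the group von Neumann algebra enters. *)
Lemma nonsingular_mull x y : nonsingular (x * y) -> nonsingular x.
Proof.
move=> nxy; have [x' ax] := exists_star x; have [y' ay] := exists_star y.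
have := nonsingular_adjoint (adjoint_ofM ax ay) nxy => /nonsingular_mulr.
exact: nonsingular_adjoint (adjoint_ofC ax).
Qed.

(** The adjoint of s is injective too, so s' x' = 0 forces x' = 0. *)
Lemma nonsingular_mul0r x s : nonsingular s -> x * s = 0 -> x = 0.
Proof.
move=> ns xs; have [x' ax] := exists_star x; have [s' as_] := exists_star s.
have ns' := nonsingular_adjoint as_ ns.
have x'0 f : val x' f = 0.
  apply: ns'; apply: (hil_ext HB) => h.
  rewrite -[val s' _]/(val (s' * x') f) (hilC HB) -(adjoint_ofM ax as_) xs.
  by rewrite /= !(hil0l HB).
apply/val_inj/funext => f; apply: (hil_ext HB) => h.
by rewrite ax x'0 (hil0r HB) /= (hil0l HB).
Qed.

Lemma nonsingular_mulr0 x t : nonsingular t -> t * x = 0 -> x = 0.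
Proof.
move=> nt tx; apply/val_inj/funext => f; apply: nt.
by rewrite -[val t _]/(val (t * x) f) tx.
Qed.

Lemma ore x s : nonsingular s -> exists t y, nonsingular t /\ t * x = y * s.
Proof.
move=> ns; have [x' ax] := exists_star x; have [s' as_] := exists_star s.
have ns' := nonsingular_adjoint as_ ns.
have [c c0 cP] := column_scale x s.
have [u uE] := groupVN_scale x c; have [u' u'E] := groupVN_scale x' c.
have [r rE] := groupVN_scale s c; have [r' r'E] := groupVN_scale s' c.
have au := adjoint_scale uE u'E ax; have ar := adjoint_scale rE r'E as_.
have [q [p [[ql qs qR q0 q1] [_ _ _ p0 _] tr]]] :=
  rank_nullity au ar (cP _ _ uE rE).
have pd : p d = 0.
  by apply: ns; apply: (scale_eq0 c0); rewrite -rE; exact: (congr1 (fun v : H * H => v.2) (p0 d)).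
have qq v : q (q v) = q v by apply: q1; exact: q0.
have [a [b [e [aE bE aa ae]]]] := projection_entries ql qs qR qq.
have qD v w : q (v + w) = q v + q w by exact: linearD_fun.
have qcol f : q (column u r f) = 0.
  apply: (hil_def HB2); rewrite qs qq /prod_form /= au ar -(hilDr HB) q0.
  exact: hil0r HB _.
have split2 v : v = (v.1, 0) + (0, v.2).
  by case: v => v v'; congr (_, _); rewrite /= ?addr0 ?add0r.
have q1E v : (q v).1 = val a v.1 + val b v.2.
  by rewrite [v in LHS]split2 qD aE /= bE.
exists a, (- b); split; last first.
  apply/val_inj/funext => f; apply/eqP; rewrite mulNr -subr_eq0 opprK.
  apply/eqP; apply: (scale_eq0 c0); rewrite scalerDr.
  rewrite -[val (a * x) f]/(val a (val x f)) -[val (b * s) f]/(val b (val s f)).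
  rewrite -(linearZ_fun (groupVN_linear a)) -(linearZ_fun (groupVN_linear b)) -uE -rE.
  by have := q1E (column u r f); rewrite qcol /= => <-.
(* If the first coordinate of q v vanishes, the equation defining the range of q leaves s' (q v).2 =
   0, and s' is injective. So the first row of q has the same kernel as q. *)
have ker_q v : val a v.1 + val b v.2 = 0 -> q v = 0.
  rewrite -q1E => qv0; have := q0 v; rewrite qv0 (linear0_fun (groupVN_linear u')) add0r.
  rewrite r'E => /(scale_eq0 c0) /ns' qv1.
  by rewrite [q v]surjective_pairing qv0 qv1.
have contr f : B2 (column a e f) (column a e f) <= B f f.
  rewrite /column -aE; apply: le_trans (symmetric_projection_contr HB2 qs qq _) _.
  by rewrite /prod_form /= (hil0l HB) addr0.
(* The second application is to the first column of q, whose adjoint is its first row. The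
   projection q' onto the kernel of that row is 1 - q. *)
have [q' [p' [[q'l q's _ q'0 q'1] [p'l p's p'R p'0 p'1] tr']]] := rank_nullity aa ae contr.
have q'E v : q' v = v - q v.
  have qq' w : q (q' w) = 0 by apply: ker_q; exact: q'0.
  have q'q w : q' (q w) = 0.
    by apply: (hil_nondeg HB2) => z; rewrite q's qs qq' (hil0r HB2).
  have <- : q' (v - q v) = v - q v.
    apply: q'1; rewrite -q1E (linearB_fun ql) qq subrr //.
  by rewrite (linearB_fun q'l) q'q subr0.
(* The first application gives tr q = 1, so tr q' = 2 - 1 = 1 and tr p' = 0. *)
have p'd : p' d = 0.
  apply: (hil_def HB); have p'p' : p' (p' d) = p' d by apply: p'1; exact: p'0.
  rewrite p's p'p' -p's.
  move: tr' tr; rewrite pd (hil0l HB) !q'E !(hilBl HB2).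
  have -> : B2 (d, 0) (d, 0) = 1 by rewrite /prod_form /= (hil0l HB) addr0 delta_norm.
  have -> : B2 (0, d) (0, d) = 1 by rewrite /prod_form /= (hil0l HB) add0r delta_norm.
  lra.
have [|pp ppE] := in_groupVN p'l _ p'R.
  exists 1 => // f; rewrite mul1r.
  apply: (symmetric_projection_contr HB p's) => h; apply: p'1; exact: p'0.
have pp0 : pp = 0 by apply: groupVN_delta_inj; rewrite ppE.
(* From a f = 0 follows |q(f, 0)|^2 = <a f, f> = 0, so f is in the kernel of the first column, which
   is the range of p' = 0. *)
move=> f af; have qf : q (f, 0) = 0.
  apply: (hil_def HB2); rewrite qs qq /prod_form aE /= af (hil0r HB) (hil0l HB).
  by rewrite addr0.
have := p'1 f; rewrite /column -aE qf => /(_ erefl) <-.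
by rewrite -ppE pp0.
Qed.

End Ore.

(** * Small groups *)

Section OreSpan.
Variables (R : realType) (G : groupType).
Local Notation LG := (groupVN R G).
Local Notation u := (@group_unitary R G).
Implicit Types (x y t s : LG).

Lemma group_unitary1 : u 1%g = 1.
Proof.
by apply/val_inj/funext => f; apply/val_inj/funext => x /=; rewrite invg1 mul1g.
Qed.

Definition ore_span (V : lmodType LG) (w v : V) : Prop :=
  exists t y, nonsingular t /\ t *: v = y *: w.

Section Span.
Variable V : lmodType LG.
Implicit Types (v w : V).

Lemma ore_span_refl w : ore_span w w.
Proof. by exists 1, 1; split=> //; exact: nonsingular1. Qed.

Lemma ore_span0 w : ore_span w 0.
Proof. by exists 1, 0; split; [exact: nonsingular1 | rewrite scaler0 scale0r]. Qed.

(** The Ore condition provides a common left multiple s t = z t' of the two denominators. *)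
Lemma ore_spanD w v v' : ore_span w v -> ore_span w v' -> ore_span w (v + v').
Proof.
move=> [t [y [nt e]]] [t' [y' [nt' e']]].
have [s [z [ns sz]]] := ore t nt'.
exists (s * t), (s * y + z * y'); split; first exact: nonsingularM.
by rewrite scalerDr {2}sz -!scalerA e e' scalerDl !scalerA.
Qed.

Lemma ore_spanZ w x v : ore_span w v -> ore_span w (x *: v).
Proof.
move=> [t [y [nt e]]]; have [s [z [ns sz]]] := ore x nt.
by exists s, (z * y); split=> //; rewrite scalerA sz -!scalerA e.
Qed.

Lemma ore_spanN w v : ore_span w v -> ore_span w (- v).
Proof. by rewrite -scaleN1r; exact: ore_spanZ. Qed.

Lemma ore_span_trans w v v' : ore_span w v -> ore_span v v' -> ore_span w v'.
Proof.
move=> wv [t [y [nt e]]]; have [s [z [ns sz]]] := ore_spanZ y wv.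
by exists (s * t), z; split; [exact: nonsingularM | rewrite -scalerA e].
Qed.

Lemma ore_span_div w s v : nonsingular s -> ore_span w (s *: v) -> ore_span w v.
Proof.
move=> ns [t [y [nt e]]]; exists (t * s), y.
by split; [exact: nonsingularM | rewrite -scalerA].
Qed.

Lemma ore_span_sum (I : Type) (r : seq I) (P : pred I) (F : I -> V) w :
  (forall i, P i -> ore_span w (F i)) -> ore_span w (\sum_(i <- r | P i) F i).
Proof.
move=> H; elim/big_ind: _ => //; first exact: ore_span0.
by move=> v v'; exact: ore_spanD.
Qed.

Definition cocycle (c : G -> V) := forall g h, c (g * h)%g = c g + u g *: c h.

Lemma cocycle1 c : cocycle c -> c 1%g = 0.
Proof.
move=> cc; have := cc 1%g 1%g; rewrite mulg1.
by rewrite group_unitary1 scale1r => /(congr1 (fun v => v - c 1%g)); rewrite addrK subrr.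
Qed.

Lemma cocycleV c g : cocycle c -> c g^-1%g = - (u g^-1%g *: c g).
Proof.
move=> cc; have := cc g^-1%g g; rewrite mulVg (cocycle1 cc) => /esym/eqP.
by rewrite addr_eq0 => /eqP.
Qed.

Lemma ore_span_cocycleM c w g h : cocycle c ->
  ore_span w (c g) -> ore_span w (c h) -> ore_span w (c (g * h)%g).
Proof. by move=> cc wg wh; rewrite cc; apply: ore_spanD => //; exact: ore_spanZ. Qed.

Lemma ore_span_cocycleV c w g : cocycle c ->
  ore_span w (c g) -> ore_span w (c g^-1%g).
Proof. by move=> cc wg; rewrite (cocycleV _ cc); apply/ore_spanN/ore_spanZ. Qed.

End Span.

Definition augmentation (g : G) : LG^o := u g - 1.

Lemma cocycle_augmentation : cocycle augmentation.
Proof.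
move=> g h; rewrite /augmentation group_unitaryM.
rewrite -[_ *: _]/(u g * (u h - 1)) mulrBr mulr1.
by rewrite [RHS]addrC subrKA.
Qed.

(** A span relation for the pair has the same coefficients in both components; with [augmentation]
    as second component this gives control over those coefficients. *)
Lemma cocycle_pair (V W : lmodType LG) (c : G -> V) (c' : G -> W) :
  cocycle c -> cocycle c' -> cocycle (fun g => (c g, c' g) : V * W).
Proof. by move=> cc cc' g h; rewrite cc cc'. Qed.

Lemma rsum_ge_seq (X : choiceType) (F : X -> R) (s : seq X) : uniq s ->
  (forall z, 0 <= F z) -> abs_summable F -> \sum_(z <- s) F z <= rsum F.
Proof.
move=> us F0 sF; have := rsum_ge [fset z in s]%fset F0 sF.
rewrite (perm_big s) //; apply: uniq_perm => // z.
by rewrite !inE.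
Qed.

(** A kernel vector is invariant under g, hence constant on orbits of its powers. These orbits are
    infinite by torsion-freeness, so square-summability forces it to vanish. *)
Lemma augmentation_nonsingular g : torsion_free G -> g <> 1%g ->
  nonsingular (augmentation g).
Proof.
move=> tf g1 f fg; apply: l2_eq => x; apply/eqP.
have inv (z : G) : val f (g^-1 * z)%g = val f z.
  have /eqP := congr1 (fun h : l2 R G => val h z) fg.
  by rewrite [X in X == _ -> _]/= subr_eq0 => /eqP.
have invX n : val f (g ^- n * x)%g = val f x.
  elim: n => [|n IH]; first by rewrite expg0 invg1 mul1g.
  by rewrite expgSr invgM -mulgA inv.
have injX : injective (fun n => g ^- n * x)%g.
  have main n k : (g ^- n * x = g ^- (n + k.+1) * x)%g -> False.
    move/mulIg/invg_inj; rewrite expgnDr -{1}[(g ^+ n)%g]mulg1 => /mulgI/esym.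
    by move/tf.
  move=> n m nm; case: (ltngtP n m) => // lt; exfalso.
    by apply: (main n (m - n.+1)%N); rewrite addnS -addSn subnKC.
  by apply: (main m (n - m.+1)%N); rewrite addnS -addSn subnKC.
have le n : n%:R * redot (val f x) (val f x) <= l2form f f.
  have us : uniq [seq (g ^- k * x)%g | k <- iota 0 n].
    by rewrite map_inj_uniq ?iota_uniq.
  have := rsum_ge_seq us (fun z : G => redot_ge0 (val f z)) (l2_sqr_summable f).
  rewrite big_map; under eq_bigr => k _ do rewrite invX.
  by rewrite big_const_seq count_predT size_iota iter_addr_0 mulr_natl.
have r0 : redot (val f x) (val f x) = 0.
  have [//|rN0] := eqVneq (redot (val f x) (val f x)) 0.
  have rp : 0 < redot (val f x) (val f x) by rewrite lt_def rN0 redot_ge0.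
  have := le (Num.truncn (l2form f f / redot (val f x) (val f x))).+1.
  rewrite -ler_pdivlMr // leNgt.
  by rewrite truncnS_gt.
move: r0; rewrite /redot /=; case: (val f x) => a b /= h.
have a2 := sqr_ge0 a; have b2 := sqr_ge0 b.
have /eqP : a ^+ 2 = 0 by nra.
have /eqP : b ^+ 2 = 0 by nra.
by rewrite !expf_eq0 /= => /eqP -> /eqP ->.
Qed.

(* Equivalently, H_1(G; U) = 0. *)
Definition small := forall (V : lmodType LG) (c : G -> V), cocycle c ->
  forall g h, g <> 1%g -> ore_span (c g) (c h).

(* Applying the hypothesis to (c, h |-> h - 1) yields t c(g) = y c(g0) and
   t (g - 1) = y (g0 - 1) simultaneously; the latter makes y nonsingular. *)
Lemma small_of_base (g0 : G) : torsion_free G -> g0 <> 1%g ->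
  (forall (V : lmodType LG) (c : G -> V), cocycle c ->
     forall h, ore_span (c g0) (c h)) -> small.
Proof.
move=> tf g01 base V c cc g h g1.
apply: ore_span_trans (base V c cc h).
have [t [y [nt e]]] := base _ _ (cocycle_pair cc cocycle_augmentation) g.
have e1 : t *: c g = y *: c g0 := congr1 (fun v : V * LG^o => v.1) e.
have e2 : t * augmentation g = y * augmentation g0 :=
  congr1 (fun v : V * LG^o => v.2) e.
exists y, t; split; last by rewrite e1.
apply: (@nonsingular_mull _ _ y (augmentation g0)); rewrite -e2.
exact: nonsingularM nt (augmentation_nonsingular tf g1).
Qed.

End OreSpan.

Lemma ler_sum_subset (R : realType) (X : eqType) (F : X -> R) (s s' : seq X) :
  uniq s -> uniq s' -> {subset s <= s'} -> (forall z, 0 <= F z) ->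
  \sum_(z <- s) F z <= \sum_(z <- s') F z.
Proof.
move=> us us' ss' F0; rewrite [leRHS](bigID (mem s)) /= -[X in _ <= X + _]big_filter.
rewrite [X in _ <= X + _](perm_big s) /=; first by rewrite lerDl sumr_ge0.
apply: uniq_perm => //; first exact: filter_uniq.
by move=> z; rewrite mem_filter; case: (boolP (z \in s)) => //= /ss'.
Qed.

Lemma rsum_sum (R : realType) (X : choiceType) (I : eqType) (s : seq I) (F : I -> X -> R) :
  (forall i, abs_summable (F i)) ->
  abs_summable (fun x => \sum_(i <- s) F i x) /\
  rsum (fun x => \sum_(i <- s) F i x) = \sum_(i <- s) rsum (F i).
Proof.
move=> sF; elim: s => [|i s [IH1 IH2]].
  have e : (fun x : X => \sum_(i <- [::]) F i x) = (fun=> 0).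
    by apply/funext => x; rewrite big_nil.
  rewrite e big_nil; split.
    by apply: (abs_summable_bound (M := 0)) => // E; rewrite big1.
  apply/eqP; rewrite eq_le; apply/andP; split.
    by apply: rsum_le => // E; rewrite big1.
  by apply: rsum_ge0 => //; apply: (abs_summable_bound (M := 0)) => // E; rewrite big1.
have e : (fun x : X => \sum_(j <- i :: s) F j x) = (fun x => F i x + \sum_(j <- s) F j x).
  by apply/funext => x; rewrite big_cons.
by rewrite e big_cons; split; [exact: abs_summableD | rewrite rsumD // IH2].
Qed.

(** * Induction of operators along an injective homomorphism *)

Section Induction.
Variables (R : realType) (A B : groupType) (i : A -> B).
Hypothesis iM : {morph i : x y / (x * y)%g}.
Hypothesis iI : injective i.
Local Notation LA := (groupVN R A).
Local Notation LB := (groupVN R B).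
Local Notation HA := (l2 R A).
Local Notation HB := (l2 R B).
Local Notation BA := (@l2form R A).
Local Notation BB := (@l2form R B).

Let i1 : i 1%g = 1%g.
Proof. by have := iM 1%g 1%g; rewrite mulg1 -{1}[i 1%g]mulg1 => /mulgI. Qed.

Let iV a : i a^-1%g = (i a)^-1%g.
Proof. by apply: (mulgI (i a)); rewrite -iM !mulgV i1. Qed.

Fact pullback_in (f : HB) (b : B) : (fun a => val f (i a * b)%g) \in @square_summable R A.
Proof.
rewrite in_l2E; apply: (abs_summable_bound (M := BB f f)) => [a|E].
  exact: redot_ge0.
have us : uniq [seq (i a * b)%g | a <- enum_fset E].
  by rewrite map_inj_uniq ?fset_uniq // => a a' /mulIg /iI.
have := rsum_ge_seq us (fun z => redot_ge0 (val f z)) (l2_sqr_summable f).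
by rewrite big_map.
Qed.

(** The restriction of f to the coset i(A) b, read as a function on A. *)
Definition pullback (f : HB) (b : B) : HA := l2_of (pullback_in f b).

Lemma pullback_linear b : linear (fun f => pullback f b).
Proof. by move=> c f h; apply: l2_eq. Qed.

Lemma pullbackM f a b : pullback f (i a * b)%g = right_translate a (pullback f b).
Proof. by apply: l2_eq => k /=; rewrite iM mulgA. Qed.

(** The hypothesis puts the members of P in distinct cosets, so the restrictions have disjoint
    supports in B. *)
Lemma pullback_sum f (P : seq B) : uniq P ->
  (forall b b' a a', b \in P -> b' \in P -> (i a * b = i a' * b')%g -> b = b') ->
  \sum_(b <- P) BA (pullback f b) (pullback f b) <= BB f f.
Proof.
move=> uP PP.
have [sF <-] := rsum_sum P (fun b => l2_sqr_summable (pullback f b)).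
apply: rsum_le => [a|D]; first by apply: sumr_ge0 => b _; exact: redot_ge0.
have us : uniq [seq (i a * b)%g | a <- enum_fset D, b <- P].
  apply: allpairs_uniq => //; first exact: fset_uniq.
  move=> [a b] [a' b'] /allpairsP[[? ?] [/= _ bP [-> ->]]].
  move=> /allpairsP[[? ?] [/= _ b'P [-> ->]]] /= e.
  by have bb := PP _ _ _ _ bP b'P e; move: e; rewrite bb => /mulIg /iI ->.
have := rsum_ge_seq us (fun z => redot_ge0 (val f z)) (l2_sqr_summable f).
by rewrite big_allpairs_dep.
Qed.

Definition same_coset (b c : B) := `[< exists a, c = (i a * b)%g >].
Definition coset_rep (b : B) : B := choose (same_coset b) b.

Lemma coset_repP b : exists a, b = (i a * coset_rep b)%g.
Proof.
have /asboolP[a e] : same_coset b (coset_rep b).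
  by apply: chooseP; apply/asboolP; exists 1%g; rewrite i1 mul1g.
by exists a^-1%g; rewrite e iV mulKg.
Qed.

Lemma coset_repM a b : coset_rep (i a * b)%g = coset_rep b.
Proof.
rewrite /coset_rep; have e : same_coset (i a * b)%g =1 same_coset b.
  move=> c; apply/asboolP/asboolP => -[k ->].
    by exists (k * a)%g; rewrite iM mulgA.
  by exists (k / a)%g; rewrite iM iV mulgA mulgVK.
rewrite (eq_choose e); apply: choose_id.
  by apply/asboolP; exists a.
by apply/asboolP; exists 1%g; rewrite i1 mul1g.
Qed.

Lemma groupVN_pullback (T : LA) f a b :
  val (val T (pullback f (i a * b)%g)) 1%g = val (val T (pullback f b)) a.
Proof. by rewrite pullbackM groupVN_right /= mul1g. Qed.

(** Writing b = i(k b) times its coset representative turns the value at 1 into the value at [k b]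
    for the representative. So the sum is at most the sum, over the cosets met by E, of full squared
    norms, each bounded by K times that of a restriction of f. *)
Lemma induce_bound (T : LA) : exists2 K : R, 0 <= K & forall (f : HB) (E : seq B), uniq E ->
  \sum_(b <- E) redot (val (val T (pullback f b)) 1%g) (val (val T (pullback f b)) 1%g)
    <= K * BB f f.
Proof.
have [K K0 TK] := groupVN_bound T; exists K => // f E uE.
have [k kE] := choice coset_repP.
pose g (p : B * A) := redot (val (val T (pullback f p.1)) p.2) (val (val T (pullback f p.1)) p.2).
have gE b : redot (val (val T (pullback f b)) 1%g) (val (val T (pullback f b)) 1%g) =
    g (coset_rep b, k b).
  by rewrite [in LHS](kE b) groupVN_pullback.
under eq_bigr => b _ do rewrite gE.
rewrite -(big_map (fun b => (coset_rep b, k b)) xpredT g).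
pose P := undup [seq coset_rep b | b <- E]; pose D := undup [seq k b | b <- E].
apply: (@le_trans _ _ (\sum_(p <- [seq (b, a) | b <- P, a <- D]) g p)).
  apply: ler_sum_subset => [|||p]; last exact: redot_ge0.
  - rewrite map_inj_uniq // => b b' [e1 e2].
    by rewrite (kE b) (kE b') e1 e2.
  - by apply: allpairs_uniq; rewrite ?undup_uniq // => -[? ?] [? ?].
  - move=> _ /mapP[b bE ->]; apply/allpairsP; exists (coset_rep b, k b).
    by rewrite /= !mem_undup !map_f.
rewrite big_allpairs.
apply: (@le_trans _ _ (\sum_(b <- P) K * BA (pullback f b) (pullback f b))).
  apply: ler_sum => b _; apply: le_trans (TK _).
  exact: (rsum_ge_seq (undup_uniq _)
    (fun z => redot_ge0 (val (val T (pullback f b)) z)) (l2_sqr_summable (val T (pullback f b)))).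
rewrite -mulr_sumr ler_wpM2l //; apply: pullback_sum; first exact: undup_uniq.
move=> b b' a a'; rewrite !mem_undup => /mapP[c _ ->] /mapP[c' _ ->].
move=> /(congr1 coset_rep); rewrite !coset_repM.
have idem z : coset_rep (coset_rep z) = coset_rep z.
  by have [l e] := coset_repP z; rewrite [in RHS]e coset_repM.
by rewrite !idem.
Qed.

Fact induce_in (T : LA) (f : HB) :
  (fun b => val (val T (pullback f b)) 1%g) \in @square_summable R B.
Proof.
have [K _ TK] := induce_bound T; rewrite in_l2E.
apply: (abs_summable_bound (M := K * BB f f)) => [b|E]; first exact: redot_ge0.
exact: TK (fset_uniq E).
Qed.

(* On each coset of i(A), identified with A, the operator acts as T. *)
Definition induce_fun (T : LA) (f : HB) : HB := l2_of (induce_in T f).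

Fact induce_fun_in (T : LA) : induce_fun T \in groupVN_pred (G := B) (R := R).
Proof.
apply/groupVNP; split; last first.
  move=> g f; apply: l2_eq => b /=; congr (val (val T _) _).
  by apply: l2_eq => a /=; rewrite mulgA.
apply/bounded_operatorP; split.
  move=> c f h; apply: l2_eq => b /=.
  by rewrite (pullback_linear b) groupVN_linear.
have [K K0 TK] := induce_bound T; exists K => // f.
by apply: rsum_le => [b|E]; [exact: redot_ge0 | exact: TK (fset_uniq E)].
Qed.

Definition induce (T : LA) : LB := Sub (induce_fun T) (induce_fun_in T).

Lemma val_induce T f b : val (val (induce T) f) b = val (val T (pullback f b)) 1%g.
Proof. by []. Qed.

Lemma pullback_induce T f b : pullback (val (induce T) f) b = val T (pullback f b).
Proof. by apply: l2_eq => a; rewrite /= groupVN_pullback. Qed.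

Lemma groupVN_eq (G : groupType) (S T : groupVN R G) :
  (forall f x, val (val S f) x = val (val T f) x) -> S = T.
Proof. by move=> e; apply/val_inj/funext => f; apply: l2_eq. Qed.

Lemma induceD S T : induce (S + T) = induce S + induce T.
Proof. by apply: groupVN_eq. Qed.

Lemma induceB S T : induce (S - T) = induce S - induce T.
Proof. by apply: groupVN_eq. Qed.

Lemma induceM S T : induce (S * T) = induce S * induce T.
Proof.
apply: groupVN_eq => f b.
rewrite -[val (induce S * _) f]/(val (induce S) (val (induce T) f)).
by rewrite !val_induce pullback_induce.
Qed.

Lemma induce1 : induce 1 = 1.
Proof. by apply: groupVN_eq => f b; rewrite val_induce /= i1 mul1g. Qed.

Lemma induce_unitary a : induce (group_unitary R a) = group_unitary R (i a).
Proof. by apply: groupVN_eq => f b; rewrite val_induce /= mulg1 iV. Qed.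

Lemma induce_nonsingular T : nonsingular T -> nonsingular (induce T).
Proof.
move=> nT f Tf; apply: l2_eq => b.
have /(congr1 (fun h : HA => val h 1%g)) : pullback f b = 0.
  apply: nT; rewrite -pullback_induce Tf.
  exact: linear0_fun (pullback_linear b).
by rewrite /= i1 mul1g.
Qed.

Definition extend_zero_fun (f : HA) (b : B) : R[i] :=
  if pselect (exists a, b = i a) is left ab then val f (sval (cid ab)) else 0.

Lemma extend_zero_funE f a : extend_zero_fun f (i a) = val f a.
Proof.
rewrite /extend_zero_fun; case: pselect => [ab|[]]; last by exists a.
by case: cid => a' /= /iI ->.
Qed.

(** A kernel vector of T, extended by zero outside i(A), is a kernel vector of [induce T]: its
    restriction to i(A) is a translate of the given vector, and the other restrictions vanish. *)
Lemma nonsingular_induce T : nonsingular (induce T) -> nonsingular T.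
Proof.
move=> nT f Tf.
have in_e : extend_zero_fun f \in @square_summable R B.
  rewrite in_l2E; apply: (abs_summable_bound (M := BA f f)) => [b|E]; first exact: redot_ge0.
  pose g b : A := if pselect (exists a, b = i a) is left ab then sval (cid ab) else 1%g.
  have gK a : g (i a) = a.
    by rewrite /g; case: pselect => [ab|[]]; [case: cid => a' /= /iI | exists a].
  rewrite (bigID (fun b => `[< exists a, b = i a >])) /= [X in _ + X]big1 ?addr0; last first.
    move=> b /asboolP ab; rewrite /extend_zero_fun; case: pselect => // _.
    by rewrite /redot mul0r addr0.
  rewrite -big_filter.
  have -> : [seq b <- enum_fset E | `[< exists a, b = i a >]] =
            [seq i a | a <- [seq g b | b <- enum_fset E & `[< exists a, b = i a >]]].
    rewrite -map_comp -[LHS]map_id; apply/eq_in_map => b.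
    by rewrite mem_filter => /andP[/asboolP[a ->] _] /=; rewrite gK.
  rewrite big_map; under eq_bigr => a _ do rewrite extend_zero_funE.
  apply: rsum_ge_seq (fun z => redot_ge0 (val f z)) (l2_sqr_summable f).
  rewrite map_inj_in_uniq ?filter_uniq ?fset_uniq // => b b'.
  rewrite !mem_filter => /andP[/asboolP[a ->] _] /andP[/asboolP[a' ->] _].
  by rewrite !gK => ->.
have /nT e0 : val (induce T) (l2_of in_e) = 0.
  apply: l2_eq => b; rewrite val_induce.
  suff -> : val T (pullback (l2_of in_e) b) = 0 by [].
  have [[a ->]|ab] := pselect (exists a, b = i a).
    have -> : pullback (l2_of in_e) (i a) = right_translate a f.
      by apply: l2_eq => k /=; rewrite -iM extend_zero_funE.
    by rewrite groupVN_right Tf (linear0_fun (right_translate_linear a)).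
  suff -> : pullback (l2_of in_e) b = 0 by exact: linear0_fun (groupVN_linear T).
  apply: l2_eq => k /=; rewrite /extend_zero_fun; case: pselect => // -[a e].
  by case: ab; exists (k^-1 * a)%g; rewrite iM iV -e mulKg.
apply: l2_eq => a; have := congr1 (fun h : HB => val h (i a)) e0.
by rewrite /= extend_zero_funE.
Qed.

End Induction.

(** * Restriction of scalars *)

Section Restriction.
Variables (S T : nzRingType) (f : S -> T).

Definition ring_hom := [/\ forall x y, f (x + y) = f x + f y,
  forall x y, f (x * y) = f x * f y & f 1 = 1].

(** An alias of V that records the homomorphism, so that it can carry the S-module structure beside
    the T-module structure of V. *)
Definition restriction of ring_hom := fun V : lmodType T => (V : Type).

Variables (hf : ring_hom) (V : lmodType T).
Local Notation RV := (restriction hf V).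

HB.instance Definition _ := GRing.Zmodule.copy RV V.

Let scale (a : S) (v : RV) : RV := f a *: (v : V).

Fact restriction_scaleA a b v : scale a (scale b v) = scale (a * b) v.
Proof. by have [_ fM _] := hf; rewrite /scale fM scalerA. Qed.
Fact restriction_scale1 : left_id 1 scale.
Proof. by have [_ _ f1] := hf; move=> v; rewrite /scale f1 scale1r. Qed.
Fact restriction_scaleDr : right_distributive scale +%R.
Proof. by move=> a v w; rewrite /scale scalerDr. Qed.
Fact restriction_scaleDl v : {morph scale^~ v : a b / a + b >-> a + b}.
Proof. by have [fD _ _] := hf; move=> a b; rewrite /scale fD scalerDl. Qed.

HB.instance Definition _ := GRing.Zmodule_isLmodule.Build S RV
  restriction_scaleA restriction_scale1 restriction_scaleDr restriction_scaleDl.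

Lemma restriction_scaleE a (v : RV) : a *: v = f a *: (v : V). Proof. by []. Qed.

End Restriction.

Section Transfer.
Variables (R : realType) (A B : groupType) (i : A -> B).
Hypothesis iM : {morph i : x y / (x * y)%g}.
Hypothesis iI : injective i.

Lemma induce_ring_hom : ring_hom (induce (R := R) iM iI).
Proof.
by split; [exact: induceD | exact: induceM | exact: induce1].
Qed.

(** The restriction of c to A is a cocycle in the restricted module, and denominators stay
    nonsingular under induction. *)
Lemma small_transfer (V : lmodType (groupVN R B)) (c : B -> V) :
  small R A -> cocycle c -> forall a a', a <> 1%g -> ore_span (c (i a)) (c (i a')).
Proof.
move=> sA cc a a' a1.
pose c' (a : A) : restriction induce_ring_hom V := c (i a).
have cc' : cocycle c'.
  by move=> x y; rewrite /c' iM cc restriction_scaleE induce_unitary.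
have [t [y [nt e]]] := sA _ c' cc' a a' a1.
exists (induce (R := R) iM iI t), (induce (R := R) iM iI y).
by split; first exact: induce_nonsingular.
Qed.

End Transfer.

(** * Subgroups given by predicates and by generators *)

Section Subgroups.
Variable G : groupType.
Local Open Scope group_scope.

Section OfProp.
Variable P : G -> Prop.
Hypotheses (P1 : P 1) (PM : forall x y, P x -> P y -> P (x * y))
  (PV : forall x, P x -> P x^-1).

Definition prop_subgroup of P 1 & (forall x y, P x -> P y -> P (x * y)) &
  (forall x, P x -> P x^-1) : {pred G} := fun x => `[< P x >].
Local Notation K := (prop_subgroup P1 PM PV).

Fact prop_subgroupM : mulg_closed K.
Proof. by move=> x y /asboolP Px /asboolP Py; apply/asboolP/PM. Qed.
Fact prop_subgroup1 : 1 \in K. Proof. exact/asboolP. Qed.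
Fact prop_subgroupV : invg_closed K.
Proof. by move=> x /asboolP Px; apply/asboolP/PV. Qed.
HB.instance Definition _ := isMulClosed.Build G K prop_subgroupM.
HB.instance Definition _ := isMul1Closed.Build G K prop_subgroup1.
HB.instance Definition _ := isInvClosed.Build G K prop_subgroupV.

Lemma exists_subgroup : exists H : groupClosed G, forall x, x \in H <-> P x.
Proof. by exists (GroupClosed.clone G K _) => x; split=> [/asboolP|?]; [|exact/asboolP]. Qed.
End OfProp.

Lemma generated_subgroup (X : set G) : exists K : groupClosed G,
  X `<=` [set` K] /\
  forall K' : groupClosed G, X `<=` [set` K'] -> {subset K <= K'}.
Proof.
have [|||K KP] := @exists_subgroup
  (fun x => forall K' : groupClosed G, X `<=` [set` K'] -> x \in K').
- by move=> K' _; exact: gpred1.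
- by move=> x y Kx Ky K' XK'; apply: gpredM; [exact: Kx | exact: Ky].
- by move=> x Kx K' XK'; rewrite gpredV; exact: Kx.
exists K; split=> [x Xx|K' XK' x /KP]; last exact.
by apply/KP => K' /(_ x Xx).
Qed.

Definition inclusion (A K : groupClosed G) (AK : {subset A <= K})
  (x : subgroup_of A) : subgroup_of K := Sub (val x) (AK _ (valP x)).

Lemma inclusionM (A K : groupClosed G) (AK : {subset A <= K}) :
  {morph inclusion AK : x y / x * y}.
Proof. by move=> x y; apply/val_inj. Qed.

Lemma inclusion_inj (A K : groupClosed G) (AK : {subset A <= K}) : injective (inclusion AK).
Proof. by move=> x y /(congr1 val) /= /val_inj. Qed.

Lemma subgroup_torsion_free (K : groupClosed G) :
  torsion_free G -> torsion_free (subgroup_of K).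
Proof.
move=> tf x n xn; apply/val_inj/(tf _ n).
have valX m : val (x ^+ m) = val x ^+ m.
  by elim: m => //= m IH; rewrite !expgS -IH.
by rewrite -valX xn.
Qed.

End Subgroups.

(** * Constructions of small subgroups *)

Section SmallSubgroups.
Variables (R : realType) (G : groupType).
Hypothesis tf : torsion_free G.
Implicit Types (A B K : groupClosed G) (g : G).

Definition small_subgroup K := small R (subgroup_of K).

Lemma small_sub A K (V : lmodType (groupVN R (subgroup_of K)))
    (c : subgroup_of K -> V) (x y : subgroup_of K) :
  {subset A <= K} -> small_subgroup A -> cocycle c -> val x \in A -> val y \in A ->
  x <> 1%g -> ore_span (c x) (c y).
Proof.
move=> AK sA cc Ax Ay x1.
have := @small_transfer R _ _ _ (inclusionM AK) (@inclusion_inj _ _ _ AK) V c sA cc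
  (Sub (val x) Ax) (Sub (val y) Ay).
rewrite (_ : inclusion AK (Sub (val x) Ax) = x); last exact/val_inj.
rewrite (_ : inclusion AK (Sub (val y) Ay) = y); last exact/val_inj.
by apply=> e; apply: x1; apply: val_inj; have /(congr1 val) := e.
Qed.

(** For a fixed cocycle c, the elements k with c(k) in the span of c(g0) form a subgroup, so it
    suffices to check generators. *)
Lemma small_generated K (X : set G) (g0 : subgroup_of K) :
  X `<=` [set` K] ->
  (forall K' : groupClosed G, X `<=` [set` K'] -> {subset K <= K'}) ->
  g0 <> 1%g ->
  (forall (V : lmodType (groupVN R (subgroup_of K))) (c : subgroup_of K -> V),
     cocycle c -> forall k, X (val k) -> ore_span (c g0) (c k)) ->
  small_subgroup K.
Proof.
move=> XK genK g01 H; apply: (small_of_base (subgroup_torsion_free tf) g01).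
move=> V c cc h.
have [|||K' K'P] := @exists_subgroup G
  (fun x => exists2 k : subgroup_of K, val k = x & ore_span (c g0) (c k)).
- by exists 1%g => //; rewrite cocycle1 //; exact: ore_span0.
- move=> _ _ [k <- ck] [l <- cl]; exists (k * l)%g => //.
  exact: ore_span_cocycleM.
- move=> _ [k <- ck]; exists k^-1%g => //; exact: ore_span_cocycleV.
have /K'P[k /val_inj -> //] : val h \in K'.
apply: (genK _ _ _ (valP h)) => x Xx; apply/K'P.
by exists (Sub x (XK x Xx)); rewrite ?SubK //; apply: H => //; rewrite SubK.
Qed.

Lemma small_join A B k : small_subgroup A -> small_subgroup B ->
  k \in A -> k \in B -> k <> 1%g ->
  exists K, [/\ small_subgroup K, {subset A <= K} & {subset B <= K}].
Proof.
move=> sA sB Ak Bk k1.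
have [K [XK genK]] := generated_subgroup ([set` A] `|` [set` B]).
have AK : {subset A <= K} by move=> x Ax; apply: XK; left.
have BK : {subset B <= K} by move=> x Bx; apply: XK; right.
exists K; split=> //.
apply: (small_generated (g0 := Sub k (AK k Ak)) XK genK).
  by move=> /(congr1 val); rewrite SubK.
have g01 : (Sub k (AK k Ak) : subgroup_of K) <> 1%g.
  by move=> /(congr1 val); rewrite SubK.
move=> V c cc x [Ax|Bx].
  by apply: (small_sub AK) => //; rewrite SubK.
by apply: (small_sub BK) => //; rewrite SubK.
Qed.

Lemma small_cycle g : g <> 1%g -> exists2 K, small_subgroup K & g \in K.
Proof.
move=> g1; have [K [XK genK]] := generated_subgroup [set g].
have Kg : g \in K by exact: XK.
exists K => //; apply: (small_generated (g0 := Sub g Kg) XK genK).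
  by move=> /(congr1 val); rewrite SubK.
move=> V c cc k /= kg; rewrite (_ : k = Sub g Kg); first exact: ore_span_refl.
exact/val_inj.
Qed.

(** With k = g h g^-1, expanding c on both sides of k g = g h gives (k - 1) c(g) = g c(h) - c(k).
    The right side is in the span of c(h), and k - 1 is nonsingular. *)
Lemma small_normalizer A g h : small_subgroup A -> h <> 1%g -> h \in A ->
  (g * h * g^-1)%g \in A ->
  exists K, [/\ small_subgroup K, {subset A <= K} & g \in K].
Proof.
move=> sA h1 Ah Agh.
have [K [XK genK]] := generated_subgroup ([set` A] `|` [set g]).
have AK : {subset A <= K} by move=> x Ax; apply: XK; left.
have Kg : g \in K by apply: XK; right.
pose h' : subgroup_of K := Sub h (AK h Ah).
have h'1 : h' <> 1%g by move=> /(congr1 val); rewrite SubK.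
exists K; split=> //; apply: (small_generated XK genK h'1) => V c cc x [Ax|xg].
  by apply: (small_sub AK) => //; rewrite SubK.
pose k := (x * h' * x^-1)%g.
have kA : val k \in A by rewrite /= xg.
have k1 : k <> 1%g.
  move=> /(congr1 (fun y => x^-1 * (y * x))%g); rewrite /k mulgVK mulKg mul1g mulVg.
  exact: h'1.
have ck : ore_span (c h') (c k) by apply: (small_sub AK); rewrite ?SubK.
have e : c (k * x)%g = c (x * h')%g by rewrite /k mulgVK.
rewrite (cc k x) (cc x h') in e.
have tfK := subgroup_torsion_free (K := K) tf.
apply: (ore_span_div (augmentation_nonsingular (R := R) tfK k1)).
have -> : augmentation R k *: c x = group_unitary R x *: c h' - c k.
  have ukx : group_unitary R k *: c x = c x + group_unitary R x *: c h' - c k.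
    by rewrite -e addrAC subrr add0r.
  by rewrite /augmentation scalerBl scale1r ukx addrAC [c x + _]addrC addrK.
by apply: ore_spanD; [exact/ore_spanZ/ore_span_refl | exact: ore_spanN].
Qed.

End SmallSubgroups.

(** * Pairs of small subgroups that are not free from each other *)

Section FreeCriterion.
Variables (G : groupType) (A B : groupClosed G).
Local Open Scope group_scope.
Local Notation U := (subgroup_of A).
Local Notation V := (subgroup_of B).
Local Notation word := (seq (U + V)).
Local Notation hom := (@canonical_hom G A B).

Lemma canonical_hom1 : hom 1 = 1.
Proof.
by have := canonical_homM (1 : free_product U V) 1; rewrite mulg1 -{1}[hom 1]mulg1 => /mulgI.
Qed.

Lemma canonical_homV x : hom x^-1 = (hom x)^-1.
Proof. by apply: (mulgI (hom x)); rewrite -canonical_homM !mulgV canonical_hom1. Qed.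

Lemma canonical_hom_surj z : exists x, hom x = z.
Proof.
have [|||K KP] := @exists_subgroup G (fun g => exists x, val (hom x) = g).
- by exists 1; rewrite canonical_hom1.
- by move=> _ _ [x <-] [y <-]; exists (x * y); rewrite canonical_homM.
- by move=> _ [x <-]; exists x^-1; rewrite canonical_homV.
have /asboolP/(_ K) zK := valP z.
have /KP[x xz] : val z \in K.
  apply: zK => g gAB; apply/KP.
    exists (fp_class [:: inl (Sub g gAB)]).
    by rewrite canonical_homE /word_val big_seq1.
  exists (fp_class [:: inr (Sub g gAB)]).
  by rewrite canonical_homE /word_val big_seq1.
by exists x; apply/val_inj.
Qed.

Lemma free_from_relations :
  (forall w : word, word_val w = 1 -> fprod_eq w [::]) -> free_from A B.
Proof.
move=> rel; have inj : injective hom.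
  move=> x y xy; apply: (mulIg y^-1); rewrite mulgV.
  have : hom (x / y) = 1 by rewrite canonical_homM canonical_homV xy mulgV.
  rewrite -[x / y]fp_classK => /(congr1 val); rewrite canonical_homE => /rel.
  by move/fp_classP => ->.
have [g gK] := choice canonical_hom_surj.
by exists g => // x; apply: inj; rewrite gK.
Qed.

Definition is_right (x : U + V) := if x is inr _ then true else false.

(* A shortest nontrivial relation starts with letters x, y of different types,
   and the prefix x is visited only once. *)
Lemma shortest_relation : ~ free_from A B -> exists (x y : U + V) (w : word),
  [/\ word_val [:: x, y & w] = 1, is_right x != is_right y, letter_val x <> 1
    & forall v1 v2, y :: w = v1 ++ v2 -> v1 <> [::] -> word_val v1 <> 1].
Proof.
move=> nfree.
pose bad n := `[< exists w : word, [/\ size w = n, word_val w = 1 & ~ fprod_eq w [::]] >].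
have ex_bad : exists n, bad n.
  apply: contrapT => H; apply: nfree; apply: free_from_relations => w w1.
  by apply: contrapT => nw; apply: H; exists (size w); apply/asboolP; exists w.
have [m /asboolP[u [um u1 nu]] mmin] := ex_minnP ex_bad.
have short (v : word) : (size v < m)%N -> word_val v = 1 -> fprod_eq v [::].
  move=> vm v1; apply: contrapT => nv.
  have := mmin (size v); rewrite leqNgt vm => H; suff : false by [].
  by apply: H; apply/asboolP; exists v.
case: u um u1 nu => [|x [|y w]] um u1 nu.
- by case: nu; exact: FpRefl.
- case: nu; move: u1; rewrite /word_val big_seq1; case: x {um} => a /= a1.
    by rewrite (_ : a = 1); [exact: FpOnel | exact/val_inj].
  by rewrite (_ : a = 1); [exact: FpOner | exact/val_inj].
(* A nonempty proper subword with value 1 can be removed: it and the remaining word are both shorter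
   relations, hence trivial, which would make the whole word trivial. *)
have cancel_sub v1 v2 : [:: x, y & w] = v1 ++ v2 -> forall v3 v4, v2 = v3 ++ v4 ->
    (size v3 < m)%N -> v3 <> [::] -> word_val v3 = 1 -> False.
  move=> e1 v3 v4 e2 s3 n3 w3; apply: nu; rewrite e1 e2.
  have t3 := short _ s3 w3.
  have : fprod_eq (v1 ++ v4) [::].
    apply: short; last by move: u1; rewrite e1 e2 !word_val_cat w3 mul1g.
    rewrite -um e1 e2 !size_cat -addnCA -[ltnLHS]add0n ltn_add2r.
    by case: (v3) n3.
  apply: FpTrans; apply: FpCat (FpRefl _) _.
  by rewrite -[X in fprod_eq _ X]cat0s; apply: FpCat t3 (FpRefl _).
exists x, y, w; split=> //.
(* Two adjacent letters from the same factor would multiply to one, giving a shorter relation. *)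
- have merge z : fprod_eq [:: x; y] [:: z] -> False.
    move=> xyz; apply: nu; have e : fprod_eq [:: x, y & w] (z :: w).
      rewrite -[[:: x, y & w]]/([:: x; y] ++ w) -[z :: w]/([:: z] ++ w).
      exact: FpCat xyz (FpRefl _).
    apply: (FpTrans e); apply: short; first by rewrite -um.
    by rewrite -(word_val_eq e).
  case: x y merge {um u1 nu cancel_sub} => a [b|b] //= merge.
    by have := merge (inl (a * b)) (FpMull _ a b).
  by have := merge (inr (a * b)) (FpMulr _ a b).
- move=> x1; apply: (@cancel_sub [::] [:: x, y & w] erefl [:: x] (y :: w)) => //.
    by rewrite -um.
  by rewrite /word_val big_seq1.
- move=> v1 v2 e n1 w1; apply: (@cancel_sub [:: x] (y :: w) erefl v1 v2) => //.
  by rewrite -um -[X in (_ < X)%N]/((size (y :: w)).+1) e size_cat ltnS leq_addr.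
Qed.

End FreeCriterion.

(** * Expansion of cocycles along a relation *)

Section NotFree.
Variables (R : realType) (G : groupType) (A B K : groupClosed G).
Hypotheses (AK : {subset A <= K}) (BK : {subset B <= K}).
Local Notation KT := (subgroup_of K).
Local Notation LK := (groupVN R KT).
Local Notation u := (@group_unitary R KT).
Local Notation letter := (subgroup_of A + subgroup_of B)%type.

Definition letter_in (x : letter) : KT :=
  match x with inl a => inclusion AK a | inr b => inclusion BK b end.

Lemma val_letter_in x : val (letter_in x) = letter_val x.
Proof. by case: x. Qed.

Fixpoint letter_prod (w : seq letter) : KT :=
  if w is x :: w' then (letter_in x * letter_prod w')%g else 1%g.

Lemma val_letter_prod w : val (letter_prod w) = word_val w.
Proof.
elim: w => [|x w IH]; first by rewrite /word_val big_nil.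
by rewrite /word_val big_cons -/(word_val w) -IH -val_letter_in.
Qed.

(* The contribution of one of the two factors when c is expanded along w,
   starting at the prefix p. *)
Fixpoint partial_sum (V : lmodType LK) (c : KT -> V) (b : bool) (p : KT) (w : seq letter) : V :=
  if w is x :: w' then
    (if is_right x == b then u p *: c (letter_in x) else 0) +
      partial_sum c b (p * letter_in x)%g w'
  else 0.

Lemma cocycle_letter_prod (V : lmodType LK) (c : KT -> V) p w : cocycle c ->
  c (p * letter_prod w)%g = c p + (partial_sum c true p w + partial_sum c false p w).
Proof.
move=> cc; elim: w p => [|x w IH] p /=; first by rewrite mulg1 !addr0.
rewrite mulgA IH cc; set s := partial_sum _ _ _ _; set s' := partial_sum _ _ _ _.
case: (is_right x) => /=; rewrite add0r.
  by rewrite -!addrA.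
by rewrite -!addrA; congr (_ + _); rewrite addrCA.
Qed.

Lemma ore_span_partial_sum (V : lmodType LK) (c : KT -> V) v b p w :
  (forall x, is_right x = b -> ore_span v (c (letter_in x))) ->
  ore_span v (partial_sum c b p w).
Proof.
move=> H; elim: w p => [|x w IH] p /=; first exact: ore_span0.
apply: ore_spanD (IH _); case: eqP => [/H xb|_]; last exact: ore_span0.
exact: ore_spanZ.
Qed.

Lemma partial_sum_pair (V W : lmodType LK) (c : KT -> V) (c' : KT -> W) b p w :
  partial_sum (fun g => (c g, c' g) : V * W) b p w =
  (partial_sum c b p w, partial_sum c' b p w).
Proof.
elim: w p => [|x w IH] p //=; rewrite IH; case: ifP => _ //.
Qed.

Local Notation ZG := (monalg.malg G int).

(** The sum of p x - p over the letters x from B, p being the prefix before x. It is the element of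
    ZG by which the letters of B act when c(k) = (k - 1) xi. *)
Fixpoint relation_element (p : G) (w : seq letter) : ZG :=
  if w is x :: w' then
    (if is_right x then monalg.mkmalgU (p * letter_val x)%g 1 - monalg.mkmalgU p 1 else 0)
      + relation_element (p * letter_val x)%g w'
  else 0.

Lemma group_ring_actE (D : {fset G}) (a : ZG) (f : l2 R G) :
  {subset monalg.msupp a <= D} ->
  group_ring_act a f = \sum_(g <- D) left_regular g f *~ monalg.mcoeff g a.
Proof.
move=> aD; rewrite /group_ring_act [RHS](big_fsetID _ (mem (monalg.msupp a))) /=.
rewrite [X in _ + X]big1_fset ?addr0; last first.
  move=> g; rewrite !inE => /andP[_ ga] _.
  by rewrite monalg.mcoeff_outdom // mulr0z.
apply: eq_fbigl => g; rewrite !inE.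
by case: (boolP (g \in monalg.msupp a)) => [/aD ->|]; rewrite ?andbF.
Qed.

Lemma group_ring_actB (a b : ZG) (f : l2 R G) :
  group_ring_act (a - b) f = group_ring_act a f - group_ring_act b f.
Proof.
pose D := (monalg.msupp (a - b) `|` monalg.msupp a `|` monalg.msupp b)%fset.
rewrite !(@group_ring_actE D); do ?by move=> g; rewrite !inE => ->; rewrite ?orbT.
rewrite -sumrB; apply: eq_bigr => g _.
by rewrite monalg.mcoeffB mulrzBr.
Qed.

Lemma group_ring_act0 (f : l2 R G) : group_ring_act (0 : ZG) f = 0.
Proof. by have := group_ring_actB 0 0 f; rewrite !subrr. Qed.

Lemma group_ring_actD (a b : ZG) (f : l2 R G) :
  group_ring_act (a + b) f = group_ring_act a f + group_ring_act b f.
Proof.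
rewrite -[b in LHS]opprK group_ring_actB -[X in _ - X]/(group_ring_act (- b) f).
by rewrite -[- b]sub0r group_ring_actB group_ring_act0 sub0r opprK.
Qed.

Lemma group_ring_actU g (f : l2 R G) :
  group_ring_act (monalg.mkmalgU g 1 : ZG) f = left_regular g f.
Proof.
rewrite (@group_ring_actE [fset g]%fset); last exact/fsubsetP/monalg.msuppU_le.
by rewrite big_seq_fset1 monalg.mcoeffUU mulr1z.
Qed.

Lemma valKM : {morph (val : KT -> G) : x y / (x * y)%g}.
Proof. by []. Qed.

Local Notation ind := (induce (R := R) valKM (@val_inj _ _ KT)).

(** Inducing from K to G turns the partial sum into an operator on l2 of G, where the hypothesis on
    the group ring applies. *)
Lemma partial_sum_augmentation p w f :
  val (ind (partial_sum (augmentation R (G := KT)) true p w)) f =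
  group_ring_act (relation_element (val p) w) f.
Proof.
elim: w p => [|x w IH] p.
  by rewrite group_ring_act0; apply: l2_eq.
rewrite [partial_sum _ _ _ _]/= [relation_element _ _]/= group_ring_actD induceD.
rewrite -[val (_ + _) f]/(val (ind _) f + val (ind _) f) IH.
rewrite -val_letter_in; congr (_ + _).
rewrite eqb_id; case: (is_right x); last by rewrite group_ring_act0; apply: l2_eq.
rewrite group_ring_actB !group_ring_actU.
rewrite (_ : u p *: _ = (u (p * letter_in x)%g - u p : LK^o)); last first.
  by rewrite /augmentation -[_ *: _]/(u p * (u (letter_in x) - 1)) mulrBr mulr1 group_unitaryM.
by rewrite induceB !induce_unitary.
Qed.

Lemma relation_element_coef0 p w q :
  (forall v1 v2, w = v1 ++ v2 -> (p * word_val v1)%g <> q) ->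
  monalg.mcoeff q (relation_element p w) = 0.
Proof.
elim: w p => [|x w IH] p H /=; first by rewrite monalg.mcoeff0.
have pq : p <> q by have := H [::] (x :: w) erefl; rewrite /word_val big_nil mulg1.
have pxq : (p * letter_val x)%g <> q.
  by have := H [:: x] w erefl; rewrite /word_val big_seq1.
rewrite monalg.mcoeffD IH ?addr0; last first.
  move=> v1 v2 e; have := H (x :: v1) v2; rewrite e => /(_ erefl).
  by rewrite /word_val big_cons mulgA.
case: (is_right x); last by rewrite monalg.mcoeff0.
by rewrite monalg.mcoeffB !monalg.mcoeffU; move/eqP/negbTE: pq => ->;
  move/eqP/negbTE: pxq => ->; rewrite subr0.
Qed.

(** The coefficient at the prefix x is 1 or -1: this prefix ends the first letter and starts the
    second, exactly one of the two belongs to B, and no other prefix has the same value. *)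
Lemma relation_element_neq0 x y w :
  is_right x != is_right y -> letter_val x <> 1%g ->
  (forall v1 v2, y :: w = v1 ++ v2 -> v1 <> [::] -> word_val v1 <> 1%g) ->
  relation_element 1%g [:: x, y & w] <> 0.
Proof.
move=> xy x1 H /(congr1 (monalg.mcoeff (letter_val x))).
rewrite /= mul1g !monalg.mcoeffD monalg.mcoeff0.
rewrite [X in _ + (_ + X)]relation_element_coef0; last first.
  move=> v1 v2 e; rewrite -mulgA => E; apply: (H (y :: v1) v2); rewrite ?e //.
  by rewrite /word_val big_cons; apply: (mulgI (letter_val x)); rewrite E mulg1.
have y1 : (letter_val x * letter_val y)%g <> letter_val x.
  rewrite -[X in _ <> X]mulg1 => /mulgI yy; apply: (H [:: y] w) => //.
  by rewrite /word_val big_seq1.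
move/eqP/negbTE: y1 => y1; move/nesym/eqP/negbTE: x1 => x1.
move: xy; case: (is_right x); case: (is_right y) => //= _;
  by rewrite ?monalg.mcoeffB ?monalg.mcoeff0 ?monalg.mcoeffU ?y1 ?eqxx ?x1 ?addr0 ?add0r.
Qed.

Hypothesis act_injective :
  forall a : ZG, a <> 0 -> injective (group_ring_act (R := R) a).

Lemma not_free_span (h k : KT) (V : lmodType LK) (c : KT -> V) :
  small_subgroup R A -> small_subgroup R B -> ~ free_from A B ->
  val h \in A -> h <> 1%g -> val k \in B -> k <> 1%g ->
  cocycle c -> ore_span (c h) (c k).
Proof.
move=> sA sB nfree Ah h1 Bk k1 cc.
have [x [y [w [w1 xy x1 H]]]] := shortest_relation nfree.
set r := [:: x, y & w] in w1.
have span_left z : is_right z = false -> ore_span (c h) (c (letter_in z)).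
  by case: z => // a _; apply: (small_sub AK) => //; exact: (valP a).
have chat := cocycle_pair cc (cocycle_augmentation R (G := KT)).
set c' := fun g : KT => _ in chat.
have span_right z : is_right z = true -> ore_span (c' k) (c' (letter_in z)).
  by case: z => // a _; apply: (small_sub BK) => //; exact: (valP a).
(* One pair (t, s) serves both c and the augmentation, replacing the vector xi of the informal
   argument. *)
have [t [s [nt]]] := ore_span_partial_sum 1%g r span_right.
rewrite partial_sum_pair => e.
have e1 : t *: partial_sum c true 1%g r = s *: c k.
  exact: (congr1 (fun v : V * LK^o => v.1) e).
have e2 : t * partial_sum (augmentation R (G := KT)) true 1%g r = s * augmentation R k.
  exact: (congr1 (fun v : V * LK^o => v.2) e).
(* Here s (k - 1) equals t times the image of the relation element, which is injective after
   induction to G; hence s is nonsingular. *)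
have ns : nonsingular s.
  apply: (@nonsingular_mull _ _ s (augmentation R k)); rewrite -e2.
  apply: (nonsingularM nt); apply: (@nonsingular_induce _ _ _ _ valKM (@val_inj _ _ KT)) => f.
  rewrite partial_sum_augmentation => f0.
  apply: (act_injective (relation_element_neq0 xy x1 H)).
  rewrite f0 /group_ring_act big1 // => g _.
  by rewrite (linear0_fun (left_regular_linear g)) mul0rz.
apply: (ore_span_div ns); rewrite -e1; apply: ore_spanZ.
(* The relation has value 1, so the contributions of A and B cancel, and the one of A is in the span
   of c(h). *)
have := cocycle_letter_prod 1%g r cc; rewrite mul1g (cocycle1 cc) add0r.
rewrite (_ : letter_prod r = 1%g); last by apply: val_inj; rewrite val_letter_prod.
rewrite (cocycle1 cc) => /esym/eqP; rewrite addr_eq0 => /eqP ->.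
by apply: ore_spanN; exact: ore_span_partial_sum.
Qed.

End NotFree.

(** * The first l2-Betti number *)

Section SmallBetti.
Variables (R : realType) (G : groupType).
Hypothesis tf : torsion_free G.
Hypothesis smallG : small R G.
Variable g0 : G.
Hypothesis g01 : g0 <> 1%g.
Local Notation LG := (groupVN R G).
Local Notation u := (@group_unitary R G).
Local Notation chain1 := (monalg.malg G LG).
Local Notation chain2 := (monalg.malg (G * G)%type LG).

Definition boundary_range : {pred chain1} := fun c => `[< exists b, boundary2 b = c >].

Fact boundary_range_submod : submod_closed boundary_range.
Proof.
split=> [|a z w /asboolP[b bz] /asboolP[c cw]]; apply/asboolP.
  by exists 0; rewrite raddf0.
by exists (a *: b + c); rewrite boundary2_linear bz cw.
Qed.

Local Notation coker := (quotient_module boundary_range_submod).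
Local Notation proj := (quotient_proj boundary_range_submod).

Lemma boundary2U (p : G * G) (m : LG) :
  boundary2 (monalg.mkmalgU p m) = bar_term2 p m.
Proof.
rewrite /boundary2 (@malg_liftE _ _ _ _ _ [fset p]%fset).
- by rewrite big_seq_fset1 monalg.mcoeffUU.
- by move=> k a b; rewrite /bar_term2 scalerDr scalerBr -!mkmalgUZ mulrA.
- by apply/fsubsetP/monalg.msuppU_le.
Qed.

Lemma quotient_proj0 (V : lmodType LG) (W : {pred V}) (sW : submod_closed W) :
  quotient_proj sW 0 = 0.
Proof.
have := quotient_projD sW 0 0; rewrite addr0.
by move=> /(congr1 (fun v => v - quotient_proj sW 0)); rewrite addrK subrr.
Qed.

Lemma proj_boundary b : proj (boundary2 b) = 0.
Proof.
rewrite -(quotient_proj0 boundary_range_submod); apply/quotient_projP; rewrite subr0.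
by apply/asboolP; exists b.
Qed.

Definition bar_class (g : G) : coker := proj (monalg.mkmalgU g 1).

(** The cocycle identity is the vanishing of the boundary of [g|h] modulo boundaries. *)
Lemma bar_class_cocycle : cocycle bar_class.
Proof.
move=> g h; have := proj_boundary (monalg.mkmalgU (g, h) 1).
rewrite boundary2U /bar_term2 /= mul1r => e.
rewrite /bar_class.
have -> : group_unitary R g *: proj (monalg.mkmalgU h 1) = proj (monalg.mkmalgU h (u g)).
  by rewrite -[LHS](quotient_projZ boundary_range_submod) -mkmalgUZ mulr1.
have := quotient_projD boundary_range_submod (monalg.mkmalgU h (u g) - monalg.mkmalgU (g * h)%g 1
  + monalg.mkmalgU g 1) (monalg.mkmalgU (g * h)%g 1).
rewrite e add0r => <-.
rewrite -(quotient_projD boundary_range_submod); congr proj.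
by rewrite addrAC subrK addrC.
Qed.

(** Smallness, applied to the bar class paired with the augmentation, gives t (z, boundary of z) = y
    ([g0], g0 - 1). For a cycle this means y (g0 - 1) = 0, so y = 0 and t z is a boundary. *)
Lemma homology1_torsion (z : homology1 R G) :
  exists2 t, nonsingular t & t *: z = 0.
Proof.
rewrite -[z](@quotient_projK _ _ _ (boundaries_submod R G)).
move: (repr z) => {}z.
have chat := cocycle_pair bar_class_cocycle (cocycle_augmentation R (G := G)).
set c' := fun g : G => _ in chat.
pose zs := monalg.msupp (val z).
have [t [y [nt]]] : ore_span (c' g0) (\sum_(g <- zs) monalg.mcoeff g (val z) *: c' g).
  by apply: ore_span_sum => g _; apply: ore_spanZ; exact: smallG chat g0 g g01.
have e1 : (\sum_(g <- zs) monalg.mcoeff g (val z) *: c' g).1 = proj (val z).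
  have zE : val z = \sum_(g <- zs) monalg.mcoeff g (val z) *: monalg.mkmalgU g 1.
    rewrite [LHS]monalg.monalgE; apply: eq_bigr => g _.
    by rewrite -mkmalgUZ mulr1.
  rewrite [in RHS]zE (big_morph fst (id1 := 0) (op1 := +%R)) //.
  rewrite (big_morph proj (quotient_projD _)
    (quotient_proj0 boundary_range_submod)); apply: eq_bigr => g _.
  exact: esym (quotient_projZ boundary_range_submod _ _).
have e2 : (\sum_(g <- zs) monalg.mcoeff g (val z) *: c' g).2 = boundary1 (val z).
  rewrite (big_morph snd (id1 := 0) (op1 := +%R)) // /boundary1 /malg_lift.
  apply: eq_bigr => g _; rewrite /bar_term1 -[in X in _ = _ - X](mulr1 (monalg.mcoeff g (val z))).
  by rewrite -mulrBr.
have z0 : boundary1 (val z) = 0 by have := valP z; rewrite unfold_in => /eqP.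
move=> e.
have f2 : y * augmentation R g0 = 0.
  have := congr1 (fun v : coker * LG^o => v.2) e.
  by rewrite /= e2 z0 scaler0 => /esym.
have y0 := nonsingular_mul0r (augmentation_nonsingular tf g01) f2.
have f1 : proj (t *: val z) = proj 0.
  have : t *: (\sum_(g <- zs) monalg.mcoeff g (val z) *: c' g).1 = y *: bar_class g0.
    exact: (congr1 (fun v : coker * LG^o => v.1) e).
  rewrite e1 y0 scale0r -[LHS](quotient_projZ boundary_range_submod).
  by rewrite (quotient_proj0 boundary_range_submod).
exists t; first exact: nt.
have {f1} : t *: val z - 0 \in boundary_range by exact/(quotient_projP boundary_range_submod).
rewrite subr0 => /asboolP[b bz].
rewrite -[LHS](quotient_projZ (boundaries_submod R G)).
rewrite -(quotient_proj0 (boundaries_submod R G)).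
apply/quotient_projP; rewrite subr0.
by apply/asboolP; exists b; rewrite bz.
Qed.

(** Every element of the homology is killed by a nonsingular element, which acts injectively on free
    modules. So no nonzero submodule of a free module embeds, and only the zero idempotent matrix
    occurs. *)
Lemma small_l2_betti1 : l2_betti1 R G = 0%E.
Proof.
have A0 (P : set (homology1 R G)) n (A : 'M[LG]_n) : fg_projective P A -> A = 0.
  move=> [_ [phi [phi_inj _]]].
  have v0 (x : 'rV[LG]_n) : x *m A = 0.
    have [t nt te] := homology1_torsion (phi (x *m A)).
    have tv : t *: (x *m A) = 0.
      apply: phi_inj; rewrite ?inE.
      - by exists (t *: x) => //; rewrite scalemxAl.
      - by exists 0 => //; rewrite mul0mx.
      - by rewrite linear0 -[RHS]te; exact: linearZ_LR.
    apply/matrixP => i j; rewrite [RHS]mxE; apply: (nonsingular_mulr0 nt).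
    have /matrixP/(_ i j) := tv; rewrite [RHS]mxE => <-.
    by rewrite [RHS]mxE.
  apply/row_matrixP => i; rewrite row0 rowE; exact: v0.
have tr0 n : matrix_trace (0 : 'M[LG]_n) = 0.
  by rewrite /matrix_trace big1 // => i _; rewrite mxE /groupVN_trace.
rewrite /l2_betti1 /luck_dim.
rewrite (_ : [set d | _] = [set 0%E]) ?ereal_sup1 //.
apply/seteqP; split=> d /=.
  by move=> [P [n [A [/A0 -> ->]]]]; rewrite tr0.
move=> ->.
(* The rank 0 module shows that the supremum is over a nonempty set, so that it is 0 and not -oo. *)
pose phi : {linear 'rV[LG]_0 -> homology1 R G} := \0%R.
exists (phi @` range (fun x : 'rV[LG]_0 => x *m 0)), 0%N, 0; split; last by rewrite tr0.
split; first by rewrite mulmx0.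
by exists phi; split=> // x y _ _ _; rewrite (thinmx0 x) (thinmx0 y).
Qed.

End SmallBetti.

(** * Maximal small subgroups *)

Section MaximalSmallSubgroups.
Variables (R : realType) (G : groupType).
Hypothesis tf : torsion_free G.
Implicit Types (K : groupClosed G) (g x : G).

(** The union of all small subgroups containing g is a subgroup, because two of them meet
    nontrivially in g and so have a small common overgroup. For g = 1 the witness is arbitrary. *)
Lemma small_hull g : exists M : groupClosed G, g <> 1%g ->
  forall x, x \in M <-> exists K, [/\ small_subgroup R K, g \in K & x \in K].
Proof.
have [g1|g1] := pselect (g = 1%g).
  by have [K _] := generated_subgroup (set0 : set G); exists K.
have [K0 sK0 gK0] := small_cycle R tf g1.
have [|||M MP] := @exists_subgroup G
  (fun x => exists K, [/\ small_subgroup R K, g \in K & x \in K]).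
- by exists K0; split=> //; exact: gpred1.
- move=> x y [K [sK gK xK]] [K' [sK' gK' yK']].
  have [J [sJ KJ K'J]] := small_join tf sK sK' gK gK' g1.
  exists J; split=> //; first exact: KJ.
  by apply: gpredM; [exact: KJ | exact: K'J].
- by move=> x [K [sK gK xK]]; exists K; rewrite gpredV.
by exists M.
Qed.

Definition hull g : groupClosed G := sval (cid (small_hull g)).

Lemma hullP g x : g <> 1%g ->
  x \in hull g <-> exists K, [/\ small_subgroup R K, g \in K & x \in K].
Proof. by move=> g1; rewrite /hull; case: cid => M /= /(_ g1). Qed.

Lemma hull_max K g : small_subgroup R K -> g \in K -> g <> 1%g -> {subset K <= hull g}.
Proof. by move=> sK gK g1 x xK; apply/hullP => //; exists K. Qed.

Lemma hull_id g : g <> 1%g -> g \in hull g.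
Proof.
by move=> g1; have [K sK gK] := small_cycle R tf g1; exact: (hull_max sK gK g1 gK).
Qed.

(** Any two elements of the hull lie in a common small subgroup inside it. *)
Lemma hull_small g : g <> 1%g -> small_subgroup R (hull g).
Proof.
move=> g1 V c cc x y x1.
have /(hullP _ g1)[K [sK gK xK]] := valP x.
have /(hullP _ g1)[K' [sK' gK' yK']] := valP y.
have [J [sJ KJ K'J]] := small_join tf sK sK' gK gK' g1.
apply: (small_sub (A := J)) => //; [|exact: KJ|exact: K'J].
by apply: hull_max => //; exact: KJ.
Qed.

Lemma hull_eq g x : g <> 1%g -> x <> 1%g -> x \in hull g -> hull x =i hull g.
Proof.
move=> g1 x1 xg y; apply/idP/idP; last exact: (hull_max (hull_small g1) xg x1).
move=> /(hullP _ x1)[K [sK xK yK]].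
have [J [sJ KJ gJ]] := small_join tf sK (hull_small g1) xK xg x1.
exact: (hull_max sJ (gJ _ (hull_id g1)) g1 (KJ _ yK)).
Qed.

Lemma hull_malnormal g : g <> 1%g -> malnormal (hull g).
Proof.
move=> g1 k kM; apply/seteqP; split=> [_ [[h hM <-] khM] /=|_ ->]; last first.
  by split; [exists 1%g; rewrite ?mulg1 ?mulgV //; exact: gpred1 | exact: gpred1].
apply: contrapT => kh1; have h1 : h <> 1%g.
  by move=> h1; apply: kh1; rewrite h1 mulg1 mulgV.
have [K [sK MK kK]] := small_normalizer tf (hull_small g1) h1 hM khM.
by case/negP: kM; apply: (hull_max sK (MK _ (hull_id g1)) g1 kK).
Qed.

(** Equal hulls define equal predicates, so [choose] returns the same element for all nontrivial
    members of one hull. *)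
Definition hull_rep g : G := choose (fun x => (x != 1%g) && (x \in hull g)) g.

Lemma hull_repP g : g <> 1%g -> hull_rep g <> 1%g /\ hull_rep g \in hull g.
Proof.
move=> g1; have /andP[/eqP] : (hull_rep g != 1%g) && (hull_rep g \in hull g).
  apply: (chooseP (P := fun x => (x != 1%g) && (x \in hull g))).
  by rewrite hull_id // andbT; apply/eqP.
by [].
Qed.

Lemma hull_rep_eq g x : g <> 1%g -> x <> 1%g -> x \in hull g -> hull_rep x = hull_rep g.
Proof.
move=> g1 x1 xg; rewrite /hull_rep.
rewrite (eq_choose (Q := fun y => (y != 1%g) && (y \in hull g))); last first.
  by move=> y; rewrite (hull_eq g1 x1 xg).
by apply: choose_id; rewrite ?xg ?hull_id // andbT; exact/eqP.
Qed.

End MaximalSmallSubgroups.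

Theorem theorem4p1 (R : realType) (G : groupType)
    (countableG : countable [set: G]) (torsionfreeG : torsion_free G) :
  exists (I : Type) (Gs : I -> groupClosed G),
    [/\ [set: G] = [set 1%g] `|` \bigcup_(i in [set: I]) ([set` Gs i] `\ 1%g)
          /\ trivIset [set: I] (fun i => [set` Gs i] `\ 1%g),
        forall i, malnormal (Gs i),
        (forall a : monalg.malg G int, a <> 0 -> injective (group_ring_act (R := R) a)) ->
          forall i j, i <> j -> free_from (Gs i) (Gs j)
      & forall i, l2_betti1 R (subgroup_of (Gs i)) = 0%E ].
Proof.
pose M := hull R torsionfreeG; pose rep := hull_rep R torsionfreeG.
(* Indexing by the chosen representatives lists each hull once, so that distinct indices have hulls
   meeting only in 1. *)
pose I := {g : G | (g != 1%g) && (rep g == g)}.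
have I1 (i : I) : val i <> 1%g by have /andP[/eqP] := valP i.
have Irep (i : I) : rep (val i) = val i by have /andP[_ /eqP] := valP i.
have Ieq (i j : I) x : x <> 1%g -> x \in M (val i) -> x \in M (val j) -> i = j.
  move=> x1 xi xj; apply/val_inj; rewrite -[LHS]Irep -[RHS]Irep /rep.
  by rewrite -(hull_rep_eq (I1 i) x1 xi) -(hull_rep_eq (I1 j) x1 xj).
exists I, (fun i => M (val i)); split=> [|i|inj i j ij|i].
- split.
    apply/seteqP; split=> // x _; have [->|x1] := pselect (x = 1%g); [by left|right].
    have [r1 rx] := hull_repP R torsionfreeG x1.
    have rr : (rep x != 1%g) && (rep (rep x) == rep x).
      by rewrite /rep (hull_rep_eq x1 r1 rx) eqxx andbT; apply/eqP.
    exists (Sub (rep x) rr : I) => //; split=> //=.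
    by rewrite /M (hull_eq x1 r1 rx); exact: hull_id.
  apply/trivIsetP => i j _ _ /eqP ij; apply/seteqP; split=> // x [[/= xi x1] [xj _]].
  by case: ij; exact: Ieq x1 xi xj.
- exact: hull_malnormal (I1 i).
- apply: contrapT => nfree; apply: ij.
  have sA := hull_small (R := R) (tf := torsionfreeG) (I1 i).
  have sB := hull_small (R := R) (tf := torsionfreeG) (I1 j).
  have [K [XK genK]] := generated_subgroup ([set` M (val i)] `|` [set` M (val j)]).
  have AK : {subset M (val i) <= K} by move=> x Ax; apply: XK; left.
  have BK : {subset M (val j) <= K} by move=> x Bx; apply: XK; right.
  have iM := hull_id R torsionfreeG (I1 i).
  have jM := hull_id R torsionfreeG (I1 j).
  pose h : subgroup_of K := Sub (val i) (AK _ iM).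
  pose k : subgroup_of K := Sub (val j) (BK _ jM).
  have h1 : h <> 1%g by move=> /(congr1 val); rewrite SubK; exact: I1.
  have k1 : k <> 1%g by move=> /(congr1 val); rewrite SubK; exact: I1.
  (* If the two hulls are not free from each other, they generate a small subgroup; by maximality it
     lies in the first hull, which then contains [val j]. *)
  have sK : small_subgroup R K.
    apply: (small_generated torsionfreeG XK genK h1) => V c cc x [Ax|Bx].
      by apply: (small_sub AK sA cc) => //; rewrite SubK.
    have hk : ore_span (c h) (c k).
      by apply: (not_free_span AK BK inj sA sB nfree) => //; rewrite SubK.
    apply: ore_span_trans hk _.
    by apply: (small_sub BK sB cc) => //; rewrite SubK.
  apply: (Ieq i j (val j) (I1 j)) => //.
  exact: (hull_max torsionfreeG sK (AK _ iM) (I1 i) (BK _ jM)).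
- have iM := hull_id R torsionfreeG (I1 i).
  have i1 : (Sub (val i) iM : subgroup_of (M (val i))) <> 1%g.
    by move=> /(congr1 val); rewrite SubK; exact: I1.
  apply: (small_l2_betti1 _ _ i1); first exact: subgroup_torsion_free.
  exact: hull_small (I1 i).
Qed.
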